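(* For every constant integer $k\geq 3$, Minimum Weight $k$-Cycle in directed $m$-edge graphs can be solved in $\tilde{O}(m^{2-2/(k+1)})$ time if $k$ is odd, and in $\tilde{O}(m^{2-2/k})$ time if $k$ is even.
   Context: Minimum Weight $k$-Cycle: given a directed graph with integer edge weights, find a simple directed cycle on exactly $k$ vertices of minimum total edge weight. $\tilde{O}$ hides polylogarithmic factors. Computational model: Word-RAM with $O(\log n)$-bit words. *)

(* Defs.v *)
From Stdlib Require Import Reals ZArith List Arith.
Import ListNotations.

(** * Weighted directed graphs and Minimum Weight k-Cycle *)

(* Vertices are [0 .. order - 1]; only the values of [weight] on [arcs] matter.
   The order of the list [arcs] is the order in which the edges are presented
   to the algorithm. *)
Record wdigraph : Type := WDigraph {
  order : nat;
  arcs : list (nat * nat);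
  weight : nat * nat -> Z;
  arcs_bounded : forall u v, In (u, v) arcs -> u < order /\ v < order;
  arcs_nodup : NoDup arcs
}.

Definition num_edges (G : wdigraph) : nat := length (arcs G).

(* [v0; ...; v(k-1)] yields (v0,v1), ..., (v(k-2),v(k-1)), (v(k-1),v0). *)
Definition cyclic_pairs (c : list nat) : list (nat * nat) :=
  combine c (tl c ++ firstn 1 c).

Definition is_kcycle (G : wdigraph) (k : nat) (c : list nat) : Prop :=
  length c = k /\ NoDup c /\ incl (cyclic_pairs c) (arcs G).

Definition cycle_weight (G : wdigraph) (c : list nat) : Z :=
  fold_right Z.add 0%Z (map (weight G) (cyclic_pairs c)).

Definition is_min_kcycle (G : wdigraph) (k : nat) (c : list nat) : Prop :=
  is_kcycle G k c /\
  forall c', is_kcycle G k c' -> (cycle_weight G c <= cycle_weight G c')%Z.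

(** * Word-RAM *)

(* Words of [w] bits are the integers in [0, 2^w). Comparisons are unsigned and
   return 0 or 1. *)
Inductive binop : Type :=
| OpAdd | OpSub | OpMul | OpDiv | OpMod
| OpAnd | OpOr | OpXor | OpShl | OpShr
| OpEq | OpLt.

Inductive instr : Type :=
| Const (rd : nat) (z : Z)
| Move (rd rs : nat)
| Bin (op : binop) (rd r1 r2 : nat)
| ReadMem (rd ra : nat)                (* rd <- memory[ra] *)
| WriteMem (ra rs : nat)               (* memory[ra] <- rs *)
| Jump (l : nat)
| JumpIfZero (r l : nat)
| Halt.

Definition program : Type := list instr.

Record state : Type := State {
  pc : nat;
  regs : nat -> Z;
  mem : Z -> Z
}.

Definition to_word (w : nat) (z : Z) : Z := (z mod 2 ^ Z.of_nat w)%Z.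

Definition eval_binop (w : nat) (op : binop) (x y : Z) : Z :=
  to_word w
    match op with
    | OpAdd => (x + y)%Z
    | OpSub => (x - y)%Z
    | OpMul => (x * y)%Z
    | OpDiv => (x / y)%Z
    | OpMod => (x mod y)%Z
    | OpAnd => Z.land x y
    | OpOr => Z.lor x y
    | OpXor => Z.lxor x y
    | OpShl => Z.shiftl x y
    | OpShr => Z.shiftr x y
    | OpEq => if (x =? y)%Z then 1%Z else 0%Z
    | OpLt => if (x <? y)%Z then 1%Z else 0%Z
    end.

Definition set_reg (f : nat -> Z) (r : nat) (v : Z) : nat -> Z :=
  fun r' => if Nat.eqb r' r then v else f r'.

Definition set_mem (f : Z -> Z) (a : Z) (v : Z) : Z -> Z :=
  fun a' => if Z.eqb a' a then v else f a'.

Definition fetch (P : program) (s : state) : instr := nth (pc s) P Halt.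

Definition exec (w : nat) (i : instr) (s : state) : state :=
  let next := S (pc s) in
  match i with
  | Const rd z => State next (set_reg (regs s) rd (to_word w z)) (mem s)
  | Move rd rs => State next (set_reg (regs s) rd (regs s rs)) (mem s)
  | Bin op rd r1 r2 =>
      State next
        (set_reg (regs s) rd (eval_binop w op (regs s r1) (regs s r2))) (mem s)
  | ReadMem rd ra => State next (set_reg (regs s) rd (mem s (regs s ra))) (mem s)
  | WriteMem ra rs => State next (regs s) (set_mem (mem s) (regs s ra) (regs s rs))
  | Jump l => State l (regs s) (mem s)
  | JumpIfZero r l =>
      State (if (regs s r =? 0)%Z then l else next) (regs s) (mem s)
  | Halt => s
  end.

Definition step (w : nat) (P : program) (s : state) : state :=
  exec w (fetch P s) s.

(* Every instruction costs one time unit. *)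
Definition run (w : nat) (P : program) (t : nat) (s : state) : state :=
  Nat.iter t (step w P) s.

Definition halted (P : program) (s : state) : Prop := fetch P s = Halt.

(** * Input and output conventions *)

(* n, m, then for each edge its tail, its head and its weight; negative weights
   become two's complement words in [initial_state]. *)
Definition input_data (G : wdigraph) : list Z :=
  Z.of_nat (order G) :: Z.of_nat (num_edges G) ::
  flat_map (fun e => [Z.of_nat (fst e); Z.of_nat (snd e); weight G e]) (arcs G).

(* Addresses are words, so [mem] is only ever accessed at arguments >= 0. *)
Definition initial_state (w : nat) (G : wdigraph) : state :=
  State 0 (fun _ => 0%Z)
    (fun a => to_word w (nth (Z.to_nat a) (input_data G) 0%Z)).

(* Cell 0 tells whether a k-cycle exists; if so, cells 1 .. k list the vertices
   of one of minimum weight, in cyclic order. *)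
Definition output_correct (G : wdigraph) (k : nat) (M : Z -> Z) : Prop :=
  (M 0%Z = 1%Z /\
   exists c, is_min_kcycle G k c /\
     map (fun i => M (Z.of_nat i)) (seq 1 k) = map Z.of_nat c) \/
  (M 0%Z = 0%Z /\ ~ exists c, is_kcycle G k c).

(** * Complexity *)

(* The number of bits of [n], i.e. log n up to a constant factor. *)
Definition bits (n : nat) : nat := S (Nat.log2 n).

Definition weights_fit (b : nat) (G : wdigraph) : Prop :=
  forall e, In e (arcs G) -> (Z.abs (weight G e) < 2 ^ Z.of_nat b)%Z.

Definition soft_O (T : nat -> nat) (f : nat -> R) : Prop :=
  exists (C : R) (d m0 : nat), forall m : nat, m0 <= m ->
    (INR (T m) <= C * f m * ln (INR m) ^ d)%R.

(* One program, for all inputs: for edge weights of c log n bits, it works on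
   every Word-RAM whose words have a log n bits, for all sufficiently large
   constants a. The running time is bounded in terms of the number of edges
   only. *)
Definition min_kcycle_solvable_in (k : nat) (f : nat -> R) : Prop :=
  exists P : program,
  forall c : nat, exists a0 : nat, forall a : nat, a0 <= a ->
  exists T : nat -> nat, soft_O T f /\
  forall G : wdigraph,
    weights_fit (c * bits (order G)) G ->
    let w := a * bits (order G) in
    exists t : nat, t <= T (num_edges G) /\
      let s := run w P t (initial_state w G) in
      halted P s /\ output_correct G k (mem s).

(* Main.v *)
Require Import Defs.
From Stdlib Require Import Reals ZArith List Arith Lia Lra Bool Permutation.
From Stdlib Require Import Classical ClassicalEpsilon.
Import ListNotations.

(* Let [s = ceil(k/2)] and let [D] be least with [m <= D^s]. Call a vertex heavy
   if its out-degree exceeds [D]; there are at most [m/D] of them.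

   Simplicity of the cycle is enforced by deterministic colour coding: for each
   pair of positions [i, j] on the cycle guess a bit position and a bit value
   that separate the labels of the [i]-th and the [j]-th vertex. There are only
   polylogarithmically many guesses, each of them restricts every position to a
   class of vertices, and the classes of different positions are disjoint.

   For a guess, a cheapest cycle through a heavy vertex is found by dynamic
   programming over the [k] layers, in time [O(m)] per heavy vertex, hence
   [O(m^2/D)]. A cycle without heavy vertices splits into two paths with at most
   [s] edges; there are at most [m D^(s-1)] such paths, they are enumerated by
   their first edge and the ranks of the next edges in the adjacency lists, and
   joined through a table indexed by their end points. Both bounds are
   [O(m^(2-1/s))].

   Memory outside the input is zero and polynomially large, so sparse tables
   need no initialisation. Path weights [x] are stored as [2^(w-1) + x], which
   makes unsigned comparison correct and leaves 0 for empty cells; the vertices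
   of a path are stored in one word, in base [n]. *)

(** * A structured language over the Word-RAM *)

(** The time must be bounded by m alone, while n may be arbitrarily larger, so no step may scan the
    vertices or clear a table. Hence the label of a vertex is the index of one of its out-edges:
    labels are below m and have O(log m) bits, and a guess, an array of k^2 digits of [t + 1] bits
    with [2 ^ t = O(log m)], takes polylogarithmically many values in m. For the same reason no
    table is reused: every guess and every heavy source works in a fresh area, and all areas
    together stay polynomially large.

    The classes also settle the joining of halves. Positions 0..s-1 and s..k-1 have disjoint
    classes, so halves with matching ends share no further vertex, and it is enough to keep the
    cheapest first half for each pair of ends.

    The choice of [D] balances the two searches: m^2/D and m D^(s-1) agree when D^s is about m. *)

(* [WOp] and [Op] run the same instruction; [WOp] marks the places where
   wrap-around is intended, see [xeval]. *)
Inductive expr : Type :=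
| V (x : nat)
| Num (z : Z)
| Op (op : binop) (a b : expr)
| WOp (op : binop) (a b : expr)
| Rd (a : expr).

Inductive cmd : Type :=
| Skip
| Assign (x : nat) (e : expr)
| Store (a e : expr)
| Seq (c1 c2 : cmd)
| If (e : expr) (c1 c2 : cmd)
| For (x l : nat) (c : cmd).

Record store : Type := MkStore { vars : nat -> Z; smem : Z -> Z }.

Definition setv (s : store) (x : nat) (z : Z) : store :=
  MkStore (set_reg (vars s) x z) (smem s).

Fixpoint loop (f : Z -> store -> store) (n : nat) (s : store) : store :=
  match n with
  | O => s
  | S n' => f (Z.of_nat n') (loop f n' s)
  end.

Section Semantics.
Variable w : nat.

Fixpoint eval (s : store) (e : expr) : Z :=
  match e with
  | V x => vars s x
  | Num z => to_word w z
  | Op op a b => eval_binop w op (eval s a) (eval s b)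
  | WOp op a b => eval_binop w op (eval s a) (eval s b)
  | Rd a => smem s (eval s a)
  end.

(** On exit the counter of a loop holds the limit, because this is the value at which the test of
    the compiled loop fails. *)
Fixpoint sem (c : cmd) (s : store) : store :=
  match c with
  | Skip => s
  | Assign x e => setv s x (eval s e)
  | Store a e => MkStore (vars s) (set_mem (smem s) (eval s a) (eval s e))
  | Seq c1 c2 => sem c2 (sem c1 s)
  | If e c1 c2 => if (eval s e =? 0)%Z then sem c2 s else sem c1 s
  | For x l c =>
      setv (loop (fun i s' => sem c (setv s' x i)) (Z.to_nat (vars s l)) s)
        x (vars s l)
  end.

Fixpoint ecost (e : expr) : nat :=
  match e with
  | V _ | Num _ => 1
  | Op _ a b | WOp _ a b => ecost a + ecost b + 1
  | Rd a => ecost a + 1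
  end.

(** A round pays five instructions of loop control: comparison, conditional jump, loading 1,
    increment, jump back. The 3 outside the sum are the initialisation of the counter and the last,
    failing test. The first branch of [If] pays one more for jumping over the second. *)
Fixpoint time (c : cmd) (s : store) : nat :=
  match c with
  | Skip => 0
  | Assign x e => ecost e + 1
  | Store a e => ecost a + ecost e + 1
  | Seq c1 c2 => time c1 s + time c2 (sem c1 s)
  | If e c1 c2 =>
      ecost e + 1 + (if (eval s e =? 0)%Z then time c2 s else time c1 s + 1)
  | For x l c =>
      let body i s' := sem c (setv s' x i) in
      let cost i := time c (setv (loop body i s) x (Z.of_nat i)) + 5 in
      3 + list_sum (map cost (seq 0 (Z.to_nat (vars s l))))
  end.

Fixpoint ecomp (e : expr) (d : nat) : list instr :=
  match e with
  | V x => [Move (2 * d + 1) (2 * x)]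
  | Num z => [Const (2 * d + 1) z]
  | Op op a b | WOp op a b =>
      ecomp a d ++ ecomp b (S d) ++ [Bin op (2 * d + 1) (2 * d + 1) (2 * S d + 1)]
  | Rd a => ecomp a d ++ [ReadMem (2 * d + 1) (2 * d + 1)]
  end.

Fixpoint clen (c : cmd) : nat :=
  match c with
  | Skip => 0
  | Assign _ e => ecost e + 1
  | Store a e => ecost a + ecost e + 1
  | Seq c1 c2 => clen c1 + clen c2
  | If e c1 c2 => ecost e + 1 + clen c1 + 1 + clen c2
  | For _ _ c => 3 + clen c + 3
  end.

(* Variable [x] lives in register [2x], the [d]-th temporary in [2d+1]. *)
Fixpoint comp (c : cmd) (off : nat) : list instr :=
  match c with
  | Skip => []
  | Assign x e => ecomp e 0 ++ [Move (2 * x) 1]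
  | Store a e => ecomp a 0 ++ ecomp e 1 ++ [WriteMem 1 3]
  | Seq c1 c2 => comp c1 off ++ comp c2 (off + clen c1)
  | If e c1 c2 =>
      let o1 := off + ecost e + 1 in
      let o2 := o1 + clen c1 + 1 in
      ecomp e 0 ++ [JumpIfZero 1 o2] ++ comp c1 o1 ++
      [Jump (o2 + clen c2)] ++ comp c2 o2
  | For x l c =>
      [Const (2 * x) 0; Bin OpLt 1 (2 * x) (2 * l);
       JumpIfZero 1 (off + 3 + clen c + 3)] ++
      comp c (off + 3) ++
      [Const 1 1; Bin OpAdd (2 * x) (2 * x) 1; Jump (off + 1)]
  end.

Fixpoint assigned (c : cmd) (x : nat) : bool :=
  match c with
  | Skip | Store _ _ => false
  | Assign y _ => x =? y
  | Seq c1 c2 | If _ c1 c2 => assigned c1 x || assigned c2 x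
  | For y _ c => (x =? y) || assigned c x
  end.

Fixpoint stores (c : cmd) : bool :=
  match c with
  | Skip | Assign _ _ => false
  | Store _ _ => true
  | Seq c1 c2 | If _ c1 c2 => stores c1 || stores c2
  | For _ _ c => stores c
  end.

(** [sem] reads a loop limit once, whereas the compiled code compares both registers afresh in every
    round; the two agree because the body changes neither. *)
Fixpoint wfc (c : cmd) : bool :=
  match c with
  | Skip | Store _ _ | Assign _ _ => true
  | Seq c1 c2 | If _ c1 c2 => wfc c1 && wfc c2
  | For x l c =>
      wfc c && negb (assigned c x) && negb (assigned c l) && negb (x =? l)
  end.

(** A bound that no longer looks at the store: limits are replaced by [rho], and both branches of a
    conditional are paid for. *)
Fixpoint time_bound (rho : nat -> nat) (c : cmd) : nat :=
  match c with
  | Skip => 0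
  | Assign x e => ecost e + 1
  | Store a e => ecost a + ecost e + 1
  | Seq c1 c2 => time_bound rho c1 + time_bound rho c2
  | If e c1 c2 => ecost e + 2 + (time_bound rho c1 + time_bound rho c2)
  | For x l c => 3 + rho l * (time_bound rho c + 5)
  end.

(** * Words, well-formed stores and frame properties *)

Definition word (z : Z) : Prop := (0 <= z < 2 ^ Z.of_nat w)%Z.

Definition wf_store (s : store) : Prop :=
  (forall x, word (vars s x)) /\ (forall a, word (smem s a)).

Lemma to_word_word (z : Z) : word (to_word w z).
Proof. apply Z.mod_pos_bound. lia. Qed.

Lemma to_word_small (z : Z) : word z -> to_word w z = z.
Proof. intros H. apply Z.mod_small, H. Qed.

Lemma to_word_add_l (x y : Z) : to_word w (to_word w x + y) = to_word w (x + y).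
Proof. apply Zplus_mod_idemp_l. Qed.

Lemma to_word_add_r (x y : Z) : to_word w (x + to_word w y) = to_word w (x + y).
Proof. apply Zplus_mod_idemp_r. Qed.

Lemma eval_word (s : store) (e : expr) : wf_store s -> word (eval s e).
Proof.
  intros [H1 H2]; induction e; cbn; auto using to_word_word;
    apply to_word_word.
Qed.

Lemma setv_wf (s : store) (x : nat) (z : Z) :
  wf_store s -> word z -> wf_store (setv s x z).
Proof.
  intros [H1 H2] Hz. split; cbn; auto.
  intros y. unfold set_reg. now destruct (y =? x).
Qed.

Lemma vars_setv_same (s : store) (x : nat) (z : Z) : vars (setv s x z) x = z.
Proof. cbn. unfold set_reg. now rewrite Nat.eqb_refl. Qed.

Lemma vars_setv_other (s : store) (x y : nat) (z : Z) :
  y <> x -> vars (setv s x z) y = vars s y.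
Proof. intros H. cbn. unfold set_reg. now rewrite (proj2 (Nat.eqb_neq _ _) H). Qed.

Lemma loop_ind (P : nat -> store -> Prop) (f : Z -> store -> store) (n : nat)
  (s : store) :
  P 0 s -> (forall i s', i < n -> P i s' -> P (S i) (f (Z.of_nat i) s')) ->
  P n (loop f n s).
Proof.
  intros H0 HS. assert (H : forall i, i <= n -> P i (loop f i s)).
  { induction i; intros Hi; cbn; auto. apply HS; auto with arith. }
  apply H; auto.
Qed.

Lemma sem_frame (c : cmd) (s : store) (x : nat) :
  assigned c x = false -> vars (sem c s) x = vars s x.
Proof.
  revert s; induction c; intros s; cbn [assigned sem]; intros H; auto.
  - apply Nat.eqb_neq in H. apply vars_setv_other; auto.
  - apply orb_false_elim in H as [? ?]. rewrite IHc2, IHc1; auto.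
  - apply orb_false_elim in H as [? ?]. destruct (_ =? 0)%Z; auto.
  - apply orb_false_elim in H as [H ?]. apply Nat.eqb_neq in H.
    rewrite vars_setv_other by auto.
    apply (loop_ind (fun _ s' => vars s' x = vars s x)); auto.
    intros i s' _ IH. rewrite IHc, vars_setv_other; auto.
Qed.

Lemma sem_mem_frame (c : cmd) (s : store) :
  stores c = false -> smem (sem c s) = smem s.
Proof.
  revert s; induction c; intros s; cbn [stores sem]; intros H; auto; try easy.
  - apply orb_false_elim in H as [? ?]. rewrite IHc2, IHc1; auto.
  - apply orb_false_elim in H as [? ?]. destruct (_ =? 0)%Z; auto.
  - cbn [setv smem].
    apply (loop_ind (fun _ s' => smem s' = smem s)); auto.
    intros i s' _ IH. rewrite IHc; auto.
Qed.

Lemma sem_wf (c : cmd) (s : store) : wf_store s -> wf_store (sem c s).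
Proof.
  revert s; induction c; intros s Hs; cbn [sem]; auto.
  - apply setv_wf; auto using eval_word.
  - destruct Hs as [H1 H2]. split; cbn; auto. intros b. unfold set_mem.
    destruct (_ =? _)%Z; auto. apply eval_word; split; auto.
  - destruct (_ =? 0)%Z; auto.
  - apply setv_wf; [|apply Hs].
    apply (loop_ind (fun _ s' => wf_store s')); auto.
    intros i s' Hi IH. apply IHc, setv_wf; auto.
    pose proof (proj1 Hs l) as Hl. unfold word in *. lia.
Qed.

Lemma ecomp_length (e : expr) (d : nat) : length (ecomp e d) = ecost e.
Proof.
  revert d; induction e; intros d; cbn; rewrite ?length_app; cbn; auto;
    rewrite ?length_app, ?IHe1, ?IHe2, ?IHe; cbn; lia.
Qed.

Lemma comp_length (c : cmd) (off : nat) : length (comp c off) = clen c.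
Proof.
  revert off; induction c; intros off; cbn [comp clen]; cbn zeta;
    repeat (rewrite ?length_app, ?ecomp_length, ?IHc1, ?IHc2, ?IHc;
            cbn [length]); lia.
Qed.

(** * Correctness of the compiled code *)

Definition code_at (P : program) (off : nat) (code : list instr) : Prop :=
  forall i, i < length code -> nth (off + i) P Halt = nth i code Halt.

Lemma code_at_app (P : program) (off : nat) (c1 c2 : list instr) :
  code_at P off (c1 ++ c2) ->
  code_at P off c1 /\ code_at P (off + length c1) c2.
Proof.
  intros H. split; intros i Hi.
  - rewrite H by (rewrite length_app; lia). now rewrite app_nth1.
  - rewrite <- Nat.add_assoc, H by (rewrite length_app; lia).
    rewrite app_nth2 by lia. f_equal; lia.
Qed.

Lemma run_add (P : program) (t1 t2 : nat) (st : state) :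
  run w P (t1 + t2) st = run w P t2 (run w P t1 st).
Proof. unfold run. now rewrite Nat.add_comm, Nat.iter_add. Qed.

Lemma run_one (P : program) (off : nat) (i : instr) (st : state) :
  code_at P off [i] -> pc st = off -> run w P 1 st = exec w i st.
Proof.
  intros H Hpc. cbn. unfold step, fetch. rewrite Hpc.
  specialize (H 0). cbn in H. rewrite Nat.add_0_r in H. now rewrite H by lia.
Qed.

Definition sim (s : store) (st : state) : Prop :=
  (forall x, regs st (2 * x) = vars s x) /\ (forall a, mem st a = smem s a).

Lemma set_reg_eq (f : nat -> Z) (r : nat) (z : Z) : set_reg f r z r = z.
Proof. unfold set_reg. now rewrite Nat.eqb_refl. Qed.

Lemma set_reg_neq (f : nat -> Z) (r r' : nat) (z : Z) :
  r' <> r -> set_reg f r z r' = f r'.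
Proof. intros H. unfold set_reg. now rewrite (proj2 (Nat.eqb_neq _ _) H). Qed.

(** Temporaries form a stack. The last clause, that those below depth [d] survive, keeps the first
    operand intact while the second is evaluated at depth [S d]. *)
Lemma ecomp_correct (P : program) (e : expr) (s : store) (d off : nat)
  (st : state) :
  code_at P off (ecomp e d) -> sim s st -> pc st = off ->
  let st' := run w P (ecost e) st in
  pc st' = off + ecost e /\ sim s st' /\ regs st' (2 * d + 1) = eval s e /\
  forall d', d' < d -> regs st' (2 * d' + 1) = regs st (2 * d' + 1).
Proof.
  (* [Op] and [WOp] compile to the same code, so one argument serves both cases. *)
  assert (Hbin : forall op a b,
    (forall d off st, code_at P off (ecomp a d) -> sim s st -> pc st = off ->
      let st' := run w P (ecost a) st in
      pc st' = off + ecost a /\ sim s st' /\ regs st' (2 * d + 1) = eval s a /\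
      forall d', d' < d -> regs st' (2 * d' + 1) = regs st (2 * d' + 1)) ->
    (forall d off st, code_at P off (ecomp b d) -> sim s st -> pc st = off ->
      let st' := run w P (ecost b) st in
      pc st' = off + ecost b /\ sim s st' /\ regs st' (2 * d + 1) = eval s b /\
      forall d', d' < d -> regs st' (2 * d' + 1) = regs st (2 * d' + 1)) ->
    forall d off st, code_at P off (ecomp (Op op a b) d) -> sim s st -> pc st = off ->
      let st' := run w P (ecost (Op op a b)) st in
      pc st' = off + ecost (Op op a b) /\ sim s st' /\
      regs st' (2 * d + 1) = eval s (Op op a b) /\
      forall d', d' < d -> regs st' (2 * d' + 1) = regs st (2 * d' + 1)).
  { intros op a b IHa IHb d' off' st' H Hs Hpc.
    cbn [ecomp ecost] in *.
    apply code_at_app in H as [Ha H]. apply code_at_app in H as [Hb H].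
    rewrite !ecomp_length in *.
    rewrite !run_add.
    destruct (IHa d' off' st' Ha Hs Hpc) as (Hpc1 & Hs1 & Hv1 & Hd1).
    set (st1 := run w P (ecost a) st') in *.
    destruct (IHb (S d') _ st1 Hb Hs1 Hpc1) as (Hpc2 & Hs2 & Hv2 & Hd2).
    set (st2 := run w P (ecost b) st1) in *.
    rewrite (run_one P _ _ st2 H Hpc2). cbn [exec pc regs mem].
    rewrite (Hd2 d') by lia. rewrite Hv1, Hv2.
    split; [lia|split; [|split]].
    - destruct Hs2 as [A B]. split; [|exact B]. intros x. cbn [regs].
      rewrite set_reg_neq by lia. apply A.
    - now rewrite set_reg_eq.
    - intros d2 Hlt. rewrite set_reg_neq by lia. rewrite Hd2 by lia. apply Hd1; lia. }
  revert d off st; induction e as [x|z|op a IHa b IHb|op a IHa b IHb|a IHa]; intros d off st H Hs Hpc; cbn zeta.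
  - cbn [ecost]. rewrite (run_one P off _ st H Hpc). cbn [exec pc regs mem].
    destruct Hs as [A B]. split; [lia|split; [|split]].
    + split; [|exact B]. intros y. cbn [regs]. rewrite set_reg_neq by lia. apply A.
    + rewrite set_reg_eq. apply A.
    + intros d' ?. rewrite set_reg_neq by lia. reflexivity.
  - cbn [ecost]. rewrite (run_one P off _ st H Hpc). cbn [exec pc regs mem].
    destruct Hs as [A B]. split; [lia|split; [|split]].
    + split; [|exact B]. intros y. cbn [regs]. rewrite set_reg_neq by lia. apply A.
    + now rewrite set_reg_eq.
    + intros d' ?. rewrite set_reg_neq by lia. reflexivity.
  - exact (Hbin op a b IHa IHb d off st H Hs Hpc).
  - exact (Hbin op a b IHa IHb d off st H Hs Hpc).
  - cbn [ecomp ecost] in *. apply code_at_app in H as [Ha H].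
    rewrite ecomp_length in *.
    rewrite run_add.
    destruct (IHa d off st Ha Hs Hpc) as (Hpc1 & Hs1 & Hv1 & Hd1).
    set (st1 := run w P (ecost a) st) in *.
    rewrite (run_one P _ _ st1 H Hpc1). cbn [exec pc regs mem].
    rewrite Hv1. destruct Hs1 as [A B]. split; [lia|split; [|split]].
    + split; [|exact B]. intros y. cbn [regs]. rewrite set_reg_neq by lia. apply A.
    + rewrite set_reg_eq. apply B.
    + intros d' ?. rewrite set_reg_neq by lia. apply Hd1; lia.
Qed.

Lemma list_sum_S (f : nat -> nat) (n : nat) :
  list_sum (map f (seq 0 (S n))) = list_sum (map f (seq 0 n)) + f n.
Proof. rewrite seq_S, map_app, list_sum_app. cbn. lia. Qed.

(** Induction on the command, with [time] as the exact number of steps. The simulation only sees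
    even registers and memory, so leftover temporaries in odd registers do no harm. *)
Lemma comp_correct (P : program) (c : cmd) (s : store) (off : nat) (st : state) :
  wfc c = true -> wf_store s ->
  code_at P off (comp c off) -> sim s st -> pc st = off ->
  let st' := run w P (time c s) st in
  pc st' = off + clen c /\ sim (sem c s) st'.
Proof.
  revert s off st; induction c as [|x e|a e|c1 IH1 c2 IH2|e c1 IH1 c2 IH2|x l c IH];
    intros s off st Hwf Hws H Hs Hpc; cbn zeta; cbn [wfc] in Hwf.
  - cbn. split; [lia|auto].
  - cbn [comp time sem clen] in *. apply code_at_app in H as [He H].
    rewrite ecomp_length in H. rewrite run_add.
    destruct (ecomp_correct P e s 0 off st He Hs Hpc) as (Hpc1 & [A B] & Hv1 & _).
    set (st1 := run w P (ecost e) st) in *.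
    rewrite (run_one P _ _ st1 H Hpc1). cbn [exec pc regs mem].
    split; [lia|]. split; [|exact B]. intros y. cbn [regs vars setv].
    destruct (Nat.eq_dec y x) as [->|n].
    + rewrite !set_reg_eq. exact Hv1.
    + rewrite !set_reg_neq by lia. apply A.
  - cbn [comp time sem clen] in *. apply code_at_app in H as [Ha H].
    apply code_at_app in H as [He H]. rewrite !ecomp_length in *.
    rewrite !run_add.
    destruct (ecomp_correct P a s 0 off st Ha Hs Hpc) as (Hpc1 & Hs1 & Hv1 & Hd1).
    set (st1 := run w P (ecost a) st) in *.
    destruct (ecomp_correct P e s 1 _ st1 He Hs1 Hpc1) as (Hpc2 & [A B] & Hv2 & Hd2).
    set (st2 := run w P (ecost e) st1) in *.
    rewrite (run_one P _ _ st2 H Hpc2). cbn [exec pc regs mem].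
    split; [lia|]. split; [exact A|]. intros b. cbn [mem smem].
    specialize (Hd2 0 Nat.lt_0_1). cbn [Nat.mul Nat.add] in Hv1, Hv2, Hd2.
    rewrite Hd2, Hv1, Hv2. unfold set_mem.
    destruct (_ =? _)%Z; auto.
  - cbn [comp time sem clen] in *. apply andb_prop in Hwf as [W1 W2].
    apply code_at_app in H as [H1 H2]. rewrite comp_length in H2.
    rewrite run_add.
    destruct (IH1 s off st W1 Hws H1 Hs Hpc) as [Hpc1 Hs1].
    destruct (IH2 (sem c1 s) _ _ W2 (sem_wf c1 s Hws) H2 Hs1 Hpc1) as [Hpc2 Hs2].
    split; [rewrite Hpc2; lia|auto].
  - cbn [comp time sem clen] in *. apply andb_prop in Hwf as [W1 W2].
    apply code_at_app in H as [He H]. apply code_at_app in H as [Hj H].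
    apply code_at_app in H as [H1 H]. apply code_at_app in H as [Hj2 H2].
    rewrite ?ecomp_length, ?comp_length in *. cbn [length] in *.
    rewrite !run_add.
    destruct (ecomp_correct P e s 0 off st He Hs Hpc) as (Hpc1 & Hs1 & Hv1 & _).
    set (st1 := run w P (ecost e) st) in *.
    rewrite (run_one P _ _ st1 Hj Hpc1). cbn [exec].
    change (2 * 0 + 1) with 1 in Hv1. rewrite Hv1.
    destruct (eval s e =? 0)%Z.
    + match goal with |- context [run w P _ ?st2] =>
        destruct (IH2 s (off + ecost e + 1 + clen c1 + 1) st2 W2 Hws) as [A B] end; auto.
      split; [cbn in A; rewrite A; lia|exact B].
    + rewrite run_add.
      match goal with |- context [run w P (time c1 s) ?st2] =>
        destruct (IH1 s (off + ecost e + 1) st2 W1 Hws) as [A B] end; auto.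
      { cbn. lia. }
      match type of A with pc ?st3 = _ => set (st4 := st3) in * end.
      rewrite (run_one P _ _ st4 Hj2 A). cbn [exec].
      split; [cbn; lia|exact B].
  - apply andb_prop in Hwf as [Hwf Wn]. apply andb_prop in Hwf as [Hwf Wl].
    apply andb_prop in Hwf as [Wc Wx]. apply negb_true_iff in Wn, Wl, Wx.
    apply Nat.eqb_neq in Wn.
    cbn [comp time sem clen] in *. cbn zeta.
    set (body := fun i s' => sem c (setv s' x i)) in *.
    set (cost := fun i => time c (setv (loop body i s) x (Z.of_nat i)) + 5).
    assert (Hc0 : code_at P off [Const (2 * x) 0]).
    { intros i Hi. cbn in Hi. rewrite H by (cbn; lia). now replace i with 0 by lia. }
    change ([Const (2 * x) 0; Bin OpLt 1 (2 * x) (2 * l);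
       JumpIfZero 1 (off + 3 + clen c + 3)]) with
      ([Const (2 * x) 0] ++ [Bin OpLt 1 (2 * x) (2 * l)] ++
       [JumpIfZero 1 (off + 3 + clen c + 3)]) in H.
    change ([Const 1 1; Bin OpAdd (2 * x) (2 * x) 1; Jump (off + 1)]) with
      ([Const 1 1] ++ [Bin OpAdd (2 * x) (2 * x) 1] ++ [Jump (off + 1)]) in H.
    rewrite <- !app_assoc in H.
    apply code_at_app in H as [_ H]. apply code_at_app in H as [Hc1 H].
    apply code_at_app in H as [Hc2 H]. apply code_at_app in H as [Hbody H].
    apply code_at_app in H as [Hc3 H]. apply code_at_app in H as [Hc4 Hc5].
    rewrite ?comp_length in *. cbn [length] in *.
    replace (off + 1 + 1 + 1) with (off + 3) in * by lia.
    assert (Hl : word (vars s l)) by apply Hws.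
    (* The invariant is taken at [off + 1], in front of the test. There the counter register holds
       [i], which the store produced by [loop] need not do yet; hence the [setv]. *)
    assert (Hinv : forall i, i <= Z.to_nat (vars s l) ->
      let st' := run w P (1 + list_sum (map cost (seq 0 i))) st in
      pc st' = off + 1 /\ wf_store (loop body i s) /\
      vars (loop body i s) l = vars s l /\
      sim (setv (loop body i s) x (Z.of_nat i)) st').
    { induction i as [|i IHi]; intros Hi; cbn zeta.
      - cbn [seq map list_sum loop Nat.add fold_right].
        rewrite (run_one P _ _ st Hc0 Hpc). cbn [exec pc].
        split; [lia|]. split; [auto|split; [auto|]].
        destruct Hs as [A B]. split; [|exact B]. intros y. cbn [regs vars setv].
        destruct (Nat.eq_dec y x) as [->|n].
        + rewrite !set_reg_eq. apply to_word_small. unfold word; lia.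
        + rewrite !set_reg_neq by lia. apply A.
      - rewrite list_sum_S, Nat.add_assoc, run_add.
        destruct IHi as (Hpc1 & Hw1 & Hl1 & Hs1); [lia|].
        set (st1 := run w P (1 + list_sum (map cost (seq 0 i))) st) in *.
        unfold cost.
        set (si := setv (loop body i s) x (Z.of_nat i)) in *.
        replace (time c si + 5) with (1 + (1 + (time c si + (1 + (1 + 1))))) by lia.
        rewrite run_add, (run_one P _ _ st1 Hc1 Hpc1). cbn [exec].
        destruct Hs1 as [A B]. rewrite !A.
        replace (vars si x) with (Z.of_nat i) by (unfold si; now rewrite vars_setv_same).
        replace (vars si l) with (vars s l) by (unfold si; rewrite vars_setv_other; auto).
        unfold eval_binop.
        assert (Hlt : (Z.of_nat i < vars s l)%Z) by lia.
        rewrite (proj2 (Z.ltb_lt _ _) Hlt).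
        assert (H1w : word 1) by (unfold word in *; lia).
        rewrite (to_word_small 1 H1w).
        rewrite run_add.
        match goal with |- context [run w P 1 ?st2] =>
          rewrite (run_one P _ _ st2 Hc2) by (cbn [pc]; lia) end.
        cbn [exec pc regs mem]. rewrite set_reg_eq. cbn [Z.eqb].
        rewrite run_add.
        assert (Hwi : wf_store si).
        { apply setv_wf; auto. unfold word in *. lia. }
        match goal with |- context [run w P (time c si) ?st2] =>
          destruct (IH si (off + 3) st2 Wc Hwi Hbody) as [Hpc2 Hs2] end.
        { split; [|exact B]. intros y. cbn [regs]. rewrite set_reg_neq by lia. apply A. }
        { cbn [pc]. lia. }
        match type of Hpc2 with pc ?st3 = _ => set (st4 := st3) in * end.
        rewrite run_add, (run_one P _ _ st4 Hc3 Hpc2). cbn [exec].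
        rewrite run_add.
        match goal with |- context [run w P 1 (run w P 1 ?st2)] =>
          rewrite (run_one P _ _ st2 Hc4) by (cbn [pc]; lia) end.
        cbn [exec pc regs mem].
        match goal with |- context [run w P 1 ?st2] =>
          rewrite (run_one P _ _ st2 Hc5) by (cbn [pc]; lia) end.
        cbn [exec pc regs mem].
        destruct Hs2 as [A2 B2].
        rewrite set_reg_eq, set_reg_neq, A2 by lia.
        rewrite (to_word_small 1 H1w).
        assert (Hx : vars (sem c si) x = Z.of_nat i).
        { rewrite sem_frame by auto. apply vars_setv_same. }
        rewrite Hx. unfold eval_binop.
        (* [i + 1] is at most the limit, which is a word, so the increment does not wrap. *)
        rewrite to_word_small by (unfold word in *; lia).
        split; [lia|]. split; [|split].
        + cbn [loop]. unfold body at 1. now apply sem_wf.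
        + cbn [loop]. unfold body at 1. rewrite sem_frame by auto.
          rewrite vars_setv_other by auto. exact Hl1.
        + split; [|exact B2]. intros y. cbn [regs vars setv loop].
          destruct (Nat.eq_dec y x) as [->|n].
          * rewrite !set_reg_eq. lia.
          * rewrite !set_reg_neq by lia. apply A2. }
    specialize (Hinv _ (le_n _)). cbn zeta in Hinv.
    destruct Hinv as (Hpc1 & Hw1 & Hl1 & Hs1).
    set (n := Z.to_nat (vars s l)) in *.
    replace (3 + list_sum (map cost (seq 0 n))) with
      (1 + list_sum (map cost (seq 0 n)) + (1 + 1)) by lia.
    rewrite run_add.
    set (st1 := run w P (1 + list_sum (map cost (seq 0 n))) st) in *.
    rewrite run_add, (run_one P _ _ st1 Hc1 Hpc1). cbn [exec].
    destruct Hs1 as [A B]. rewrite !A, vars_setv_same, vars_setv_other, Hl1 by auto.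
    assert (Hn : Z.of_nat n = vars s l) by (unfold n, word in *; lia).
    rewrite Hn. unfold eval_binop. rewrite Z.ltb_irrefl.
    rewrite (to_word_small 0) by (unfold word; lia).
    match goal with |- context [run w P 1 ?st2] =>
      rewrite (run_one P _ _ st2 Hc2) by (cbn [pc]; lia) end.
    cbn [exec pc regs mem]. rewrite set_reg_eq. cbn [Z.eqb].
    split; [lia|]. split; [|exact B]. intros y. cbn [regs].
    rewrite set_reg_neq by lia. rewrite A, Hn. reflexivity.
Qed.

(* The variables satisfying [tr] never exceed [rho]: they are only copied from
   each other. All loop limits are among them. *)
Fixpoint tracked (rho : nat -> nat) (tr : nat -> bool) (c : cmd) : Prop :=
  match c with
  | Skip | Store _ _ => True
  | Assign x e =>
      tr x = false \/ exists y, e = V y /\ tr y = true /\ rho y <= rho x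
  | Seq c1 c2 | If _ c1 c2 => tracked rho tr c1 /\ tracked rho tr c2
  | For x l c => tr x = false /\ tr l = true /\ tracked rho tr c
  end.

(** The second conclusion carries the induction: the next command or round must again find the
    tracked variables below [rho]. Untracked variables are never limits, so they may be computed
    freely. *)
Lemma time_le_bound (rho : nat -> nat) (tr : nat -> bool) (c : cmd) (s : store) :
  tracked rho tr c -> (forall y, tr y = true -> Z.to_nat (vars s y) <= rho y) ->
  time c s <= time_bound rho c /\
  forall y, tr y = true -> Z.to_nat (vars (sem c s) y) <= rho y.
Proof.
  revert s; induction c as [|x e|a e|c1 IH1 c2 IH2|e c1 IH1 c2 IH2|x l c IH];
    intros s Ht Hr; cbn [time time_bound tracked sem] in *; auto.
  - split; [auto|]. intros y Hy. destruct (Nat.eq_dec y x) as [->|Hn].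
    + destruct Ht as [Ht|(z & -> & Hz & Hle)]; [congruence|].
      rewrite vars_setv_same. cbn. specialize (Hr z Hz). lia.
    + rewrite vars_setv_other; auto.
  - destruct Ht as [T1 T2]. destruct (IH1 s T1 Hr) as [A1 B1].
    destruct (IH2 (sem c1 s) T2 B1) as [A2 B2]. split; [lia|auto].
  - destruct Ht as [T1 T2]. destruct (IH1 s T1 Hr) as [A1 B1].
    destruct (IH2 s T2 Hr) as [A2 B2]. destruct (_ =? 0)%Z; split; auto; lia.
  - destruct Ht as (Tx & Tl & Tc). cbn zeta.
    set (body := fun i s' => sem c (setv s' x i)).
    assert (Hs : forall s' i, (forall y, tr y = true -> Z.to_nat (vars s' y) <= rho y) ->
      forall y, tr y = true -> Z.to_nat (vars (setv s' x i) y) <= rho y).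
    { intros s' i Hs' y Hy. rewrite vars_setv_other by congruence. auto. }
    assert (Hf : forall i y, tr y = true -> Z.to_nat (vars (loop body i s) y) <= rho y).
    { intros i. apply (loop_ind (fun _ s' => forall y, tr y = true ->
        Z.to_nat (vars s' y) <= rho y)); auto.
      intros j s' _ Hs'. apply (IH _ Tc). auto. }
    split; [|auto]. apply le_n_S, le_n_S, le_n_S.
    assert (Hn : forall n, list_sum (map (fun i =>
      time c (setv (loop body i s) x (Z.of_nat i)) + 5) (seq 0 n)) <=
      n * (time_bound rho c + 5)).
    { induction n as [|n IHn]; [cbn; lia|]. rewrite list_sum_S.
      destruct (IH (setv (loop body n s) x (Z.of_nat n)) Tc) as [A _]; [auto|]. lia. }
    eapply Nat.le_trans; [apply Hn|]. apply Nat.mul_le_mono_r, Hr, Tl.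
Qed.

(** * Exact integer semantics and the loop rule *)

Definition zop (op : binop) (x y : Z) : Z :=
  match op with
  | OpAdd => x + y
  | OpSub => x - y
  | OpMul => x * y
  | OpDiv => x / y
  | OpMod => x mod y
  | OpAnd => Z.land x y
  | OpOr => Z.lor x y
  | OpXor => Z.lxor x y
  | OpShl => Z.shiftl x y
  | OpShr => Z.shiftr x y
  | OpEq => if x =? y then 1 else 0
  | OpLt => if x <? y then 1 else 0
  end%Z.

Fixpoint xeval (s : store) (e : expr) : Z :=
  match e with
  | V x => vars s x
  | Num z => z
  | Op op a b => zop op (xeval s a) (xeval s b)
  | WOp op a b => to_word w (zop op (xeval s a) (xeval s b))
  | Rd a => smem s (xeval s a)
  end.

Fixpoint safe (s : store) (e : expr) : Prop :=
  match e with
  | V _ => True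
  | Num z => word z
  | Op op a b => safe s a /\ safe s b /\ word (zop op (xeval s a) (xeval s b))
  | WOp op a b => safe s a /\ safe s b
  | Rd a => safe s a
  end.

Lemma eval_exact (s : store) (e : expr) : safe s e -> eval s e = xeval s e.
Proof.
  induction e; cbn; intros H; auto.
  - now apply to_word_small.
  - destruct H as (H1 & H2 & H3). rewrite IHe1, IHe2 by auto.
    now apply to_word_small.
  - destruct H as [H1 H2]. now rewrite IHe1, IHe2 by auto.
  - now rewrite IHe.
Qed.

(** Invariant rule for loops. The step is told that whatever the body neither assigns nor stores is
    as on entry, so an invariant only has to mention what changes. *)
Lemma sem_for (P : Z -> store -> Prop) (x l : nat) (c : cmd) (s : store) :
  (0 <= vars s l)%Z -> P 0%Z s ->
  (forall i s', (0 <= i < vars s l)%Z -> P i s' ->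
    (forall y, y <> x -> assigned c y = false -> vars s' y = vars s y) ->
    (stores c = false -> smem s' = smem s) ->
    P (i + 1)%Z (sem c (setv s' x i))) ->
  exists s', sem (For x l c) s = setv s' x (vars s l) /\ P (vars s l) s'.
Proof.
  intros H0 HP HS. eexists. split; [reflexivity|].
  set (f := fun i s' => sem c (setv s' x i)).
  enough (H : let s' := loop f (Z.to_nat (vars s l)) s in
    P (Z.of_nat (Z.to_nat (vars s l))) s' /\
    (forall y, y <> x -> assigned c y = false -> vars s' y = vars s y) /\
    (stores c = false -> smem s' = smem s)).
  { rewrite Z2Nat.id in H by auto. apply H. }
  apply (loop_ind (fun i s' => P (Z.of_nat i) s' /\
    (forall y, y <> x -> assigned c y = false -> vars s' y = vars s y) /\
    (stores c = false -> smem s' = smem s))).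
  - auto.
  - intros i s' Hi (H1 & H2 & H3). unfold f. split; [|split].
    + replace (Z.of_nat (S i)) with (Z.of_nat i + 1)%Z by lia. apply HS; auto; lia.
    + intros y Hy Ha. rewrite sem_frame, vars_setv_other; auto.
    + intros Hc. rewrite sem_mem_frame by auto. cbn. auto.
Qed.

End Semantics.

Definition compile (c : cmd) : program := comp c 0.

Lemma compile_correct (w : nat) (c : cmd) (s : store) (st : state) :
  wfc c = true -> wf_store w s -> sim s st -> pc st = 0 ->
  let st' := run w (compile c) (time w c s) st in
  halted (compile c) st' /\ forall a, mem st' a = smem (sem w c s) a.
Proof.
  intros Hwf Hws Hs Hpc.
  destruct (comp_correct w (compile c) c s 0 st Hwf Hws) as [H1 H2]; auto.
  { intros i Hi. reflexivity. }
  (* The program counter ends just past the code, where [fetch] falls back on its default [Halt]. *)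
  split; [|apply H2]. unfold halted, fetch. rewrite H1. apply nth_overflow.
  unfold compile. rewrite comp_length. apply le_n.
Qed.

(** * Separating classes *)

Section Classes.
Open Scope Z_scope.
Variables k t : Z.
Hypothesis Hk : 0 <= k.
Hypothesis Ht : 0 <= t.

Definition digit (g p : Z) : Z := Z.shiftr g ((t + 1) * p) mod 2 ^ (t + 1).

(* [d] encodes the bit position [d / 2] together with the expected value. *)
Definition chi (d x : Z) : Z := (Z.shiftr x (d / 2) + d) mod 2.

(** The digit at [i * k + j] is to tell position [i] from position [j]: vertices at [i] answer 1,
    those at [j] answer 0. A vertex at [i] thus faces row [i] and column [i] of the array, which is
    tested in time O(k). *)
Definition cls (g i x : Z) : Prop :=
  forall j, 0 <= j < k -> j <> i ->
    chi (digit g (i * k + j)) x = 1 /\ chi (digit g (j * k + i)) x = 0.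

(** A common element would answer both 1 and 0 to the digit at [i * k + j]. *)
Lemma cls_disjoint (g i j x : Z) :
  0 <= i < k -> 0 <= j < k -> cls g i x -> cls g j x -> i = j.
Proof.
  intros Hi Hj H1 H2. destruct (Z.eq_dec i j) as [|n]; auto.
  destruct (H1 j Hj) as [H _]; auto. destruct (H2 i Hi n) as [_ H']. lia.
Qed.

Lemma chi_even (p x : Z) : 0 <= p -> chi (2 * p) x = Z.b2z (Z.testbit x p).
Proof.
  intros Hp. unfold chi.
  replace (2 * p / 2) with p by (rewrite Z.mul_comm, Z.div_mul; lia).
  rewrite Z.testbit_spec', Z.shiftr_div_pow2 by auto.
  rewrite (Z.mul_comm 2), Z_mod_plus_full. reflexivity.
Qed.

Lemma chi_odd (p x : Z) : 0 <= p -> chi (2 * p + 1) x = 1 - Z.b2z (Z.testbit x p).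
Proof.
  intros Hp. unfold chi.
  replace ((2 * p + 1) / 2) with p
    by (rewrite (Z.add_comm (2 * p)), (Z.mul_comm 2), Z.div_add; cbn; lia).
  rewrite Z.testbit_spec', Z.shiftr_div_pow2 by auto.
  replace (x / 2 ^ p + (2 * p + 1)) with ((x / 2 ^ p + 1) + p * 2) by ring.
  rewrite Z_mod_plus_full. generalize (x / 2 ^ p). intros y.
  pose proof (Z.mod_pos_bound y 2). rewrite Z.add_mod by lia.
  assert (E : y mod 2 = 0 \/ y mod 2 = 1) by lia. destruct E as [-> | ->]; reflexivity.
Qed.

(** Different numbers of at most [2 ^ t] bits differ at a bit position below [2 ^ t]. The position
    takes [t] bits of [d]; the lowest bit of [d] decides between the tested bit and its negation. *)
Lemma chi_separates (x y : Z) :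
  0 <= x < 2 ^ 2 ^ t -> 0 <= y < 2 ^ 2 ^ t -> x <> y ->
  exists d, 0 <= d < 2 ^ (t + 1) /\ chi d x = 1 /\ chi d y = 0.
Proof.
  intros Hx Hy Hn.
  assert (E : exists p, 0 <= p /\ Z.testbit x p <> Z.testbit y p).
  { apply NNPP. intros H. apply Hn, Z.bits_inj'. intros p Hp. apply NNPP.
    intros H'. apply H. eauto. }
  destruct E as (p & Hp & E).
  assert (Hlt : p < 2 ^ t).
  { destruct (Z_lt_le_dec p (2 ^ t)) as [|Hge]; auto. exfalso. apply E.
    assert (B : forall z, 0 <= z < 2 ^ 2 ^ t -> Z.testbit z p = false).
    { intros z Hz. destruct (Z.eq_dec z 0) as [->|]; [apply Z.testbit_0_l|].
      apply Z.bits_above_log2; [lia|]. apply Z.log2_lt_pow2; [lia|].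
      eapply Z.lt_le_trans; [apply Hz|]. apply Z.pow_le_mono_r; lia. }
    rewrite !B; auto. }
  rewrite Z.pow_add_r by lia.
  destruct (Z.testbit x p) eqn:Ex, (Z.testbit y p) eqn:Ey; try congruence.
  - exists (2 * p). rewrite !chi_even, Ex, Ey by auto. cbn [Z.b2z]. change (2 ^ 1) with 2. lia.
  - exists (2 * p + 1). rewrite !chi_odd, Ex, Ey by auto. cbn [Z.b2z]. change (2 ^ 1) with 2. lia.
Qed.

Lemma digits_exist (f : Z -> Z) (P : nat) :
  (forall p, 0 <= f p < 2 ^ (t + 1)) ->
  exists g, 0 <= g < 2 ^ ((t + 1) * Z.of_nat P) /\
    forall p, 0 <= p < Z.of_nat P -> digit g p = f p.
Proof.
  revert f; induction P as [|P IH]; intros f Hf.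
  - exists 0. rewrite Z.mul_0_r. split; [cbn; lia|lia].
  - destruct (IH (fun p => f (p + 1))) as (g & Hg & Hd); [auto|].
    set (b := 2 ^ (t + 1)) in *.
    assert (Hb : 0 < b) by (apply Z.pow_pos_nonneg; lia).
    exists (f 0 + g * b).
    replace ((t + 1) * Z.of_nat (S P)) with ((t + 1) * Z.of_nat P + (t + 1)) by lia.
    rewrite Z.pow_add_r by lia. fold b. specialize (Hf 0) as Hf0. split; [nia|].
    intros p Hp. unfold digit. rewrite Z.shiftr_div_pow2 by nia.
    destruct (Z.eq_dec p 0) as [->|Hn].
    + rewrite Z.mul_0_r, Z.pow_0_r, Z.div_1_r. fold b.
      rewrite Z_mod_plus_full. now apply Z.mod_small.
    + replace ((t + 1) * p) with ((t + 1) + (t + 1) * (p - 1)) by ring.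
      rewrite Z.pow_add_r by nia. fold b.
      rewrite <- Z.div_div by (try apply Z.pow_pos_nonneg; nia).
      rewrite Z.div_add, (Z.div_small (f 0)) by (auto; lia).
      specialize (Hd (p - 1)). unfold digit in Hd. rewrite Z.shiftr_div_pow2 in Hd by nia.
      rewrite Z.add_0_l. fold b in Hd. rewrite Hd by lia. f_equal; lia.
Qed.

(** Each off-diagonal digit is chosen on its own, as a separator of the two elements concerned.
    Choice enters this existence proof alone; the program runs through all [g]. *)
Lemma cls_exists (xs : list Z) :
  Z.of_nat (length xs) = k -> NoDup xs ->
  (forall x, In x xs -> 0 <= x < 2 ^ 2 ^ t) ->
  exists g, 0 <= g < 2 ^ ((t + 1) * (k * k)) /\
    forall i, 0 <= i < k -> cls g i (nth (Z.to_nat i) xs 0).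
Proof.
  intros Hl Hnd Hr.
  assert (Hf : exists f : Z -> Z, forall p, 0 <= f p < 2 ^ (t + 1) /\
    forall i j, 0 <= i < k -> 0 <= j < k -> i <> j -> p = i * k + j ->
      chi (f p) (nth (Z.to_nat i) xs 0) = 1 /\ chi (f p) (nth (Z.to_nat j) xs 0) = 0).
  { enough (H : forall p, exists d, 0 <= d < 2 ^ (t + 1) /\
      forall i j, 0 <= i < k -> 0 <= j < k -> i <> j -> p = i * k + j ->
      chi d (nth (Z.to_nat i) xs 0) = 1 /\ chi d (nth (Z.to_nat j) xs 0) = 0).
    { exists (fun p => proj1_sig (constructive_indefinite_description _ (H p))).
      intros p. exact (proj2_sig (constructive_indefinite_description _ (H p))). }
    intros p.
    assert (Hb : 0 < 2 ^ (t + 1)) by (apply Z.pow_pos_nonneg; lia).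
    destruct (classic (exists i j, 0 <= i < k /\ 0 <= j < k /\ i <> j /\ p = i * k + j))
      as [(i & j & Hi & Hj & Hn & Hp)|Hno].
    - destruct (chi_separates (nth (Z.to_nat i) xs 0) (nth (Z.to_nat j) xs 0))
        as (d & Hd & H1 & H2).
      + apply Hr, nth_In. lia.
      + apply Hr, nth_In. lia.
      + intros E. apply NoDup_nth in E; auto; lia.
      + exists d. split; auto. intros i' j' Hi' Hj' _ Hp'.
        destruct (Z.div_mod_unique k i' i j' j) as [-> ->]; auto; lia.
    (* Indices that belong to no pair of distinct positions, such as the diagonal, get the digit
       0. *)
    - exists 0. split; [lia|]. intros i j Hi Hj Hn Hp. exfalso. apply Hno. eauto 6. }
  destruct Hf as [f Hf].
  destruct (digits_exist f (Z.to_nat (k * k))) as (g & Hg & Hd); [apply Hf|].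
  rewrite Z2Nat.id in Hg, Hd by nia.
  exists g. split; auto. intros i Hi j Hj Hn.
  rewrite !Hd by nia. split.
  - apply (proj2 (Hf (i * k + j)) i j); auto.
  - apply (proj2 (Hf (j * k + i)) j i); auto.
Qed.

End Classes.

(** * Walks as lists of edge indices *)

Section Walks.
Open Scope Z_scope.
Variable G : wdigraph.

Definition nv : Z := Z.of_nat (order G).
Definition ne : Z := Z.of_nat (num_edges G).
Definition arc (e : Z) : nat * nat := nth (Z.to_nat e) (arcs G) (0%nat, 0%nat).
Definition src (e : Z) : Z := Z.of_nat (fst (arc e)).
Definition dst (e : Z) : Z := Z.of_nat (snd (arc e)).
Definition wt (e : Z) : Z := weight G (arc e).

Lemma arc_in (e : Z) : 0 <= e < ne -> In (arc e) (arcs G).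
Proof. intros H. apply nth_In. unfold ne, num_edges in H. lia. Qed.

Lemma src_bound (e : Z) : 0 <= e < ne -> 0 <= src e < nv.
Proof.
  intros H. pose proof (arc_in e H) as A. unfold src, nv.
  destruct (arc e) as [u v]. apply arcs_bounded in A. cbn; lia.
Qed.

Lemma dst_bound (e : Z) : 0 <= e < ne -> 0 <= dst e < nv.
Proof.
  intros H. pose proof (arc_in e H) as A. unfold dst, nv.
  destruct (arc e) as [u v]. apply arcs_bounded in A. cbn; lia.
Qed.

(** Arcs are distinct pairs of vertices. This turns bounds polynomial in m into bounds polynomial in
    n, hence into words of O(log n) bits. *)
Lemma ne_le : ne <= nv * nv.
Proof.
  assert (H : (length (arcs G) <= length (list_prod (seq 0 (order G)) (seq 0 (order G))))%nat).
  { apply NoDup_incl_length; [apply arcs_nodup|]. intros [u v] H.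
    apply arcs_bounded in H. apply in_prod; apply in_seq; lia. }
  rewrite length_prod, !length_seq in H. unfold ne, nv, num_edges. lia.
Qed.

Lemma nth_input (l : list (nat * nat)) (i : nat) :
  (i < length l)%nat ->
  let d := flat_map (fun e => [Z.of_nat (fst e); Z.of_nat (snd e); weight G e]) l in
  let a := nth i l (0%nat, 0%nat) in
  nth (3 * i) d 0 = Z.of_nat (fst a) /\ nth (3 * i + 1) d 0 = Z.of_nat (snd a) /\
  nth (3 * i + 2) d 0 = weight G a.
Proof.
  revert i; induction l as [|x l IH]; intros i Hi; cbn in Hi; [lia|].
  destruct i as [|i]; [cbn; auto|]. cbn zeta.
  replace (3 * S i)%nat with (S (S (S (3 * i)))) by lia. cbn [flat_map app nth Nat.add].
  apply IH. lia.
Qed.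

Lemma input_edge (e : Z) : 0 <= e < ne ->
  nth (Z.to_nat (2 + 3 * e)) (input_data G) 0 = src e /\
  nth (Z.to_nat (3 + 3 * e)) (input_data G) 0 = dst e /\
  nth (Z.to_nat (4 + 3 * e)) (input_data G) 0 = wt e.
Proof.
  intros H. destruct (nth_input (arcs G) (Z.to_nat e)) as (H1 & H2 & H3).
  { unfold ne, num_edges in H. lia. }
  replace (Z.to_nat (2 + 3 * e)) with (2 + 3 * Z.to_nat e)%nat by lia.
  replace (Z.to_nat (3 + 3 * e)) with (2 + (3 * Z.to_nat e + 1))%nat by lia.
  replace (Z.to_nat (4 + 3 * e)) with (2 + (3 * Z.to_nat e + 2))%nat by lia.
  cbn [input_data nth Nat.add]. auto.
Qed.

Fixpoint walk (u : Z) (es : list Z) (v : Z) : Prop :=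
  match es with
  | [] => u = v
  | e :: es' => 0 <= e < ne /\ src e = u /\ walk (dst e) es' v
  end.

Fixpoint psum (es : list Z) : Z :=
  match es with
  | [] => 0
  | e :: es' => wt e + psum es'
  end.

(** The tails as a number in base n, the first one most significant: extended by one multiplication,
    joined by one shift, and read back by division from the end. *)
Definition pcode (es : list Z) : Z := fold_left (fun c e => c * nv + src e) es 0.

Lemma walk_app (u v : Z) (a b : list Z) :
  walk u (a ++ b) v <-> exists x, walk u a x /\ walk x b v.
Proof.
  revert u; induction a as [|e a IH]; intros u; cbn.
  - split; [intros H; eauto|intros (x & -> & H); auto].
  - rewrite IH. split.
    + intros (He & Ht & x & H1 & H2). eauto.
    + intros (x & (He & Ht & H1) & H2). eauto.
Qed.

Lemma walk_end (u v v' : Z) (es : list Z) : walk u es v -> walk u es v' -> v = v'.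
Proof.
  revert u; induction es as [|e es IH]; intros u; cbn; [congruence|].
  intros (_ & _ & H1) (_ & _ & H2). eauto.
Qed.

Lemma walk_edges (u v : Z) (es : list Z) (e : Z) :
  walk u es v -> In e es -> 0 <= e < ne.
Proof.
  revert u; induction es as [|e' es IH]; intros u; cbn; [easy|].
  intros (He & _ & H) [->|Hi]; eauto.
Qed.

Lemma psum_app (a b : list Z) : psum (a ++ b) = psum a + psum b.
Proof. induction a; cbn; lia. Qed.

Lemma psum_bound (B : Z) (es : list Z) :
  (forall e, In e es -> Z.abs (wt e) <= B) ->
  Z.abs (psum es) <= Z.of_nat (length es) * B.
Proof.
  induction es as [|e es IH]; intros H; [cbn; lia|].
  assert (Z.abs (wt e) <= B) by (apply H; now left).
  assert (Z.abs (psum es) <= Z.of_nat (length es) * B)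
    by (apply IH; intros; apply H; now right).
  cbn [psum length]. nia.
Qed.

Lemma pcode_snoc (es : list Z) (e : Z) : pcode (es ++ [e]) = pcode es * nv + src e.
Proof. unfold pcode. now rewrite fold_left_app. Qed.

Lemma pcode_app (a b : list Z) :
  pcode (a ++ b) = pcode a * nv ^ Z.of_nat (length b) + pcode b.
Proof.
  induction b as [|e b IH] using rev_ind.
  - rewrite app_nil_r. cbn. lia.
  - rewrite app_assoc, !pcode_snoc, IH, length_app. cbn [length].
    replace (Z.of_nat (length b + 1)) with (Z.succ (Z.of_nat (length b))) by lia.
    rewrite Z.pow_succ_r by lia. ring.
Qed.

Lemma pcode_bound (es : list Z) :
  (forall e, In e es -> 0 <= e < ne) -> 0 <= pcode es < nv ^ Z.of_nat (length es).
Proof.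
  induction es as [|e es IH] using rev_ind; intros H.
  - cbn. lia.
  - rewrite pcode_snoc, length_app. cbn [length].
    replace (Z.of_nat (length es + 1)) with (Z.succ (Z.of_nat (length es))) by lia.
    rewrite Z.pow_succ_r by lia.
    assert (0 <= src e < nv) by (apply src_bound, H, in_or_app; cbn; auto).
    assert (0 <= pcode es < nv ^ Z.of_nat (length es))
      by (apply IH; intros; apply H, in_or_app; auto).
    nia.
Qed.

(** In a walk the head of each edge is the tail of the next one, so the tails paired with their own
    shift give back the edges. *)
Lemma combine_shift (es : list Z) (u v : Z) :
  walk u es v ->
  combine (map (fun e => fst (arc e)) es)
    (tl (map (fun e => fst (arc e)) es) ++ [Z.to_nat v]) = map arc es.
Proof.
  revert u; induction es as [|e es IH]; intros u; cbn [walk]; [easy|].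
  intros (He & Ht & H). destruct es as [|e' es].
  - cbn in *. subst v. unfold dst. rewrite Nat2Z.id. now destruct (arc e).
  - specialize (IH _ H). cbn [map tl app combine] in IH |- *. rewrite IH.
    f_equal. destruct H as (_ & H & _). unfold src, dst in H.
    destruct (arc e); cbn in *. f_equal. lia.
Qed.

Lemma closed_walk_pairs (es : list Z) (u : Z) :
  es <> [] -> walk u es u ->
  cyclic_pairs (map (fun e => fst (arc e)) es) = map arc es.
Proof.
  intros Hn H. rewrite <- (combine_shift es u u H). unfold cyclic_pairs.
  destruct es as [|e es]; [easy|]. cbn [map firstn tl].
  destruct H as (_ & H & _). unfold src in H. repeat f_equal. lia.
Qed.

Lemma psum_map (es : list Z) :
  psum es = fold_right Z.add 0 (map (weight G) (map arc es)).
Proof. induction es; cbn; [auto|]. now rewrite <- IHes. Qed.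

(** Together with [kcycle_closed_walk] this translates between cycles as vertex lists and closed
    walks of edge indices with distinct tails, the form in which the program searches. *)
Lemma closed_walk_kcycle (es : list Z) (u : Z) (k : nat) :
  es <> [] -> walk u es u -> length es = k -> NoDup (map src es) ->
  is_kcycle G k (map (fun e => fst (arc e)) es) /\
  cycle_weight G (map (fun e => fst (arc e)) es) = psum es.
Proof.
  intros Hn H Hl Hd. unfold is_kcycle, cycle_weight.
  rewrite (closed_walk_pairs es u Hn H), length_map, psum_map.
  split; [|reflexivity]. split; [auto|split].
  - apply (NoDup_map_inv Z.of_nat). rewrite map_map. exact Hd.
  - intros p Hp. apply in_map_iff in Hp as (e & <- & He).
    apply arc_in, (walk_edges u u es); auto.
Qed.

Lemma arc_index (p : nat * nat) : In p (arcs G) -> exists e, 0 <= e < ne /\ arc e = p.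
Proof.
  intros H. apply (In_nth _ _ (0%nat, 0%nat)) in H as (i & Hi & H).
  exists (Z.of_nat i). unfold ne, num_edges, arc. rewrite Nat2Z.id. split; [lia|auto].
Qed.

Lemma chain_walk (c : list nat) (x z : nat) :
  incl (combine (x :: c) (c ++ [z])) (arcs G) ->
  exists es, walk (Z.of_nat x) es (Z.of_nat z) /\
    map src es = map Z.of_nat (x :: c) /\
    map arc es = combine (x :: c) (c ++ [z]).
Proof.
  revert x; induction c as [|y c IH]; intros x H.
  - destruct (arc_index (x, z)) as (e & He & Ha); [apply H; cbn; auto|].
    exists [e]. cbn. unfold src, dst. rewrite Ha. cbn. auto.
  - destruct (arc_index (x, y)) as (e & He & Ha); [apply H; cbn; auto|].
    destruct (IH y) as (es & H1 & H2 & H3).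
    { intros p Hp. apply H. cbn [app combine]. right. exact Hp. }
    exists (e :: es). cbn [walk map app combine]. rewrite H2, H3, Ha.
    unfold src, dst. rewrite Ha. cbn. auto.
Qed.

Lemma kcycle_closed_walk (k : nat) (c : list nat) :
  (0 < k)%nat -> is_kcycle G k c ->
  exists es u, walk u es u /\ length es = k /\ NoDup (map src es) /\
    psum es = cycle_weight G c.
Proof.
  intros Hk (Hl & Hd & Hi). destruct c as [|x c]; [cbn in Hl; lia|].
  unfold cyclic_pairs, cycle_weight in *. cbn [tl firstn] in *.
  destruct (chain_walk c x x Hi) as (es & H1 & H2 & H3).
  exists es, (Z.of_nat x). split; [auto|]. split; [|split].
  - rewrite <- Hl, <- (length_map Z.of_nat (x :: c)), <- H2. now rewrite length_map.
  - rewrite H2. apply FinFun.Injective_map_NoDup; auto. intros a b E; lia.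
  - rewrite psum_map, H3. reflexivity.
Qed.

(** Lets a closed walk through a heavy vertex start there. *)
Lemma walk_rotate (a b : list Z) (u : Z) :
  walk u (a ++ b) u -> exists x, walk x (b ++ a) x.
Proof.
  intros H. apply walk_app in H as (x & H1 & H2). exists x. apply walk_app. eauto.
Qed.

End Walks.

(** * Walks whose vertices lie in the classes of their positions *)

Section ClassedWalks.
Open Scope Z_scope.
Variable G : wdigraph.
Variables k t : Z.
Variable lab : Z -> Z.

(** Only tails are tested. Consecutive pieces thus test every position once, and the common end of a
    closed walk is tested as the tail of its first edge. *)
Fixpoint cwalk (g pos u : Z) (es : list Z) (v : Z) : Prop :=
  match es with
  | [] => u = v
  | e :: es' =>
      0 <= e < ne G /\ src G e = u /\ cls k t g pos (lab u) /\
      cwalk g (pos + 1) (dst G e) es' v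
  end.

Lemma cwalk_walk (g pos u v : Z) (es : list Z) : cwalk g pos u es v -> walk G u es v.
Proof.
  revert pos u; induction es as [|e es IH]; intros pos u; cbn; auto.
  intros (H1 & H2 & _ & H3). eauto.
Qed.

Lemma cwalk_app (g pos u v : Z) (a b : list Z) :
  cwalk g pos u (a ++ b) v <->
  exists x, cwalk g pos u a x /\ cwalk g (pos + Z.of_nat (length a)) x b v.
Proof.
  revert pos u; induction a as [|e a IH]; intros pos u; cbn [app cwalk length].
  - rewrite Z.add_0_r. split; [intros H; eauto|intros (x & -> & H); auto].
  - rewrite IH. replace (pos + Z.of_nat (S (length a))) with
      (pos + 1 + Z.of_nat (length a)) by lia. split.
    + intros (He & Ht & Hc & x & H1 & H2). eauto 7.
    + intros (x & (He & Ht & Hc & H1) & H2). eauto 7.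
Qed.

Lemma cwalk_snoc (g pos u v : Z) (a : list Z) (e : Z) :
  cwalk g pos u (a ++ [e]) v <->
  0 <= e < ne G /\ cwalk g pos u a (src G e) /\
  cls k t g (pos + Z.of_nat (length a)) (lab (src G e)) /\ dst G e = v.
Proof.
  rewrite cwalk_app. cbn. split.
  - intros (x & H1 & He & <- & Hc & Hh). auto.
  - intros (He & H1 & Hc & Hh). eauto 7.
Qed.

Lemma cwalk_class (g pos u v x : Z) (es : list Z) :
  cwalk g pos u es v -> In x (map (src G) es) ->
  exists i, pos <= i < pos + Z.of_nat (length es) /\ cls k t g i (lab x).
Proof.
  revert pos u; induction es as [|e es IH]; intros pos u; cbn [cwalk map length]; [easy|].
  intros (He & Ht & Hc & H) [<-|Hi].
  - exists pos. rewrite Ht. split; [lia|auto].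
  - destruct (IH _ _ H Hi) as (i & Hr & Hci). exists i. split; [lia|auto].
Qed.

(** A repeated tail would lie in the classes of two different positions below [k]. *)
Lemma cwalk_nodup (g pos u v : Z) (es : list Z) :
  0 <= pos -> pos + Z.of_nat (length es) <= k ->
  cwalk g pos u es v -> NoDup (map (src G) es).
Proof.
  revert pos u; induction es as [|e es IH]; intros pos u Hp Hl; cbn [cwalk map];
    [constructor|]. intros (He & Ht & Hc & H). cbn [length] in Hl.
  constructor; [|apply (IH (pos + 1) (dst G e)); auto; lia].
  intros Hi. destruct (cwalk_class _ _ _ _ _ _ H Hi) as (i & Hr & Hci).
  rewrite Ht in Hci. enough (pos = i) by lia.
  eapply (cls_disjoint k t g pos i (lab u)); auto; lia.
Qed.

Hypothesis Ht : 0 <= t.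
Hypothesis Hm : ne G <= 2 ^ 2 ^ t.
Hypothesis Hlab : forall e, 0 <= e < ne G ->
  0 <= lab (src G e) < ne G /\ src G (lab (src G e)) = src G e.

(** The guess separates labels. The label of a tail is an edge with that tail, so different tails
    have different labels; labels are below m, so [2 ^ t] bits with [m <= 2 ^ 2 ^ t] suffice
    whatever n is. *)
Lemma cwalk_exists (u v : Z) (es : list Z) :
  Z.of_nat (length es) = k -> NoDup (map (src G) es) -> walk G u es v ->
  exists g, 0 <= g < 2 ^ ((t + 1) * (k * k)) /\ cwalk g 0 u es v.
Proof.
  intros Hl Hd Hw.
  assert (Hin : forall e, In e es -> 0 <= e < ne G) by (intros; eapply walk_edges; eauto).
  destruct (cls_exists k t ltac:(lia) Ht (map (fun e => lab (src G e)) es))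
    as (g & Hg & Hc).
  - now rewrite length_map.
  - apply (NoDup_map_inv (src G)). rewrite map_map.
    erewrite map_ext_in; [exact Hd|]. intros e He. apply Hlab; auto.
  - intros x Hx. apply in_map_iff in Hx as (e & <- & He).
    specialize (Hlab e (Hin e He)). lia.
  - exists g. split; auto.
    (* The suffix [b] sits at position [length a]; generalising over the prefix carries the position
       through the induction. *)
    enough (E : forall b a u', es = a ++ b -> walk G u' b v ->
      cwalk g (Z.of_nat (length a)) u' b v) by exact (E es [] u eq_refl Hw).
    induction b as [|e b IH]; intros a u' E Hb; cbn in *; auto.
    destruct Hb as (He & <- & Hb). split; [auto|split; [auto|split]].
    + specialize (Hc (Z.of_nat (length a))). rewrite Nat2Z.id, E, map_app in Hc.
      rewrite app_nth2 in Hc by (rewrite length_map; auto).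
      rewrite length_map, Nat.sub_diag in Hc. cbn in Hc. apply Hc.
      rewrite <- Hl, E, length_app. cbn. lia.
    + specialize (IH (a ++ [e]) (dst G e)). rewrite length_app in IH.
      replace (Z.of_nat (length a) + 1) with (Z.of_nat (length a + length [e])) by (cbn; lia).
      apply IH; auto. now rewrite <- app_assoc.
Qed.

End ClassedWalks.

(** * Numbering the paths through light vertices *)

Section Ranks.
Open Scope Z_scope.
Variable G : wdigraph.
Variables deg : Z -> Z.
Variable adj : Z -> Z -> Z.
Variable D : Z.
Hypothesis HD : 0 < D.

(* [rest] lists, as base-[D] digits, the ranks of the edges among the out-edges
   of their tails. *)
Fixpoint ranks (es : list Z) (rest : Z) : Prop :=
  match es with
  | [] => True
  | e :: es' =>
      exists i rest', 0 <= i < D /\ i < deg (src G e) /\ adj (src G e) i = e /\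
        0 <= rest' /\ rest = i + D * rest' /\ ranks es' rest'
  end.

Definition path_index (es : list Z) (q : Z) : Prop :=
  match es with
  | [] => False
  | e :: es' => exists rest, 0 <= rest /\ q = e + ne G * rest /\ ranks es' rest
  end.

Definition light (es : list Z) : Prop := forall e, In e es -> deg (src G e) <= D.

Hypothesis Hadj : forall e, 0 <= e < ne G ->
  exists i, 0 <= i < deg (src G e) /\ adj (src G e) i = e.

Lemma ranks_exists (es : list Z) :
  (forall e, In e es -> 0 <= e < ne G) -> light es ->
  exists rest, 0 <= rest < D ^ Z.of_nat (length es) /\ ranks es rest.
Proof.
  induction es as [|e es IH]; intros Hin Hli.
  - exists 0. cbn. split; [lia|auto].
  - destruct IH as (rest & Hr & H).
    { intros; apply Hin; now right. }
    { intros x Hx; apply Hli; now right. }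
    destruct (Hadj e) as (i & Hi & Hai); [apply Hin; now left|].
    assert (deg (src G e) <= D) by (apply Hli; now left).
    exists (i + D * rest). cbn [length ranks].
    replace (Z.of_nat (S (length es))) with (Z.succ (Z.of_nat (length es))) by lia.
    rewrite Z.pow_succ_r by lia. split; [nia|]. exists i, rest. repeat split; auto; lia.
Qed.

(** The first edge is a digit in base m and each further edge a digit in base [D], as a light tail
    has at most [D] out-edges. [L] only bounds the length, so both halves of a cycle are found in
    one range of [q]. *)
Lemma path_index_exists (es : list Z) (L : Z) :
  es <> [] -> Z.of_nat (length es) <= L ->
  (forall e, In e es -> 0 <= e < ne G) -> light es ->
  exists q, 0 <= q < ne G * D ^ (L - 1) /\ path_index es q.
Proof.
  intros Hn HL Hin Hli. destruct es as [|e es]; [easy|]. cbn [length] in HL.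
  destruct (ranks_exists es) as (rest & Hr & H).
  { intros; apply Hin; now right. }
  { intros x Hx; apply Hli; now right. }
  assert (0 <= e < ne G) by (apply Hin; now left).
  assert (D ^ Z.of_nat (length es) <= D ^ (L - 1)) by (apply Z.pow_le_mono_r; lia).
  exists (e + ne G * rest). split; [nia|]. exists rest. repeat split; auto; lia.
Qed.

End Ranks.

(* A table cell with value [dw] and witness [dc], where [dw = 0] means that the
   cell is empty: nonempty cells are justified by [J], and every value in [P]
   has been taken into account. *)
Definition entry (dw dc : Z) (J : Z -> Z -> Prop) (P : Z -> Prop) : Prop :=
  (dw <> 0%Z -> J dw dc) /\ (forall x, P x -> dw <> 0%Z /\ (dw <= x)%Z).

Lemma entry_weaken (dw dc : Z) (J : Z -> Z -> Prop) (P P' : Z -> Prop) :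
  entry dw dc J P -> (forall x, P' x -> P x) -> entry dw dc J P'.
Proof. intros [H1 H2] H. split; auto. Qed.

(** * The program *)

Notation vN := 0%nat (only parsing).
Notation vM := 1%nat (only parsing).
Notation vK := 2%nat (only parsing).
Notation vS := 3%nat (only parsing).
Notation vR := 4%nat (only parsing).
Notation vBase := 5%nat (only parsing).
Notation vD := 6%nat (only parsing).
Notation vT := 7%nat (only parsing).
Notation vW := 8%nat (only parsing).
Notation vB := 9%nat (only parsing).
Notation vH := 10%nat (only parsing).
Notation vG := 11%nat (only parsing).
Notation vLim := 12%nat (only parsing).
Notation vNh := 13%nat (only parsing).
Notation vNR := 14%nat (only parsing).
Notation vFr := 15%nat (only parsing).
Notation vg := 16%nat (only parsing).
Notation vq := 17%nat (only parsing).
Notation vhi := 18%nat (only parsing).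
Notation vi := 19%nat (only parsing).
Notation ve := 20%nat (only parsing).
Notation vj := 21%nat (only parsing).
Notation vc := 22%nat (only parsing).
Notation vpos := 23%nat (only parsing).
Notation vx := 24%nat (only parsing).
Notation vd1 := 25%nat (only parsing).
Notation vd2 := 26%nat (only parsing).
Notation vok2 := 27%nat (only parsing).
Notation vok := 28%nat (only parsing).
Notation vrest := 29%nat (only parsing).
Notation vL := 30%nat (only parsing).
Notation vend := 31%nat (only parsing).
Notation vwt := 32%nat (only parsing).
Notation vcode := 33%nat (only parsing).
Notation vst := 34%nat (only parsing).
Notation vp0 := 36%nat (only parsing).
Notation vkey := 37%nat (only parsing).
Notation vnw := 38%nat (only parsing).
Notation vnc := 39%nat (only parsing).
Notation vcur := 40%nat (only parsing).
Notation vu := 41%nat (only parsing).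
Notation vd := 42%nat (only parsing).
Notation vh := 43%nat (only parsing).
Notation vP := 44%nat (only parsing).

Declare Scope expr_scope.
Delimit Scope expr_scope with expr.
Bind Scope expr_scope with expr.
Notation "a + b" := (Op OpAdd a b) : expr_scope.
Notation "a - b" := (Op OpSub a b) : expr_scope.
Notation "a * b" := (Op OpMul a b) : expr_scope.
Notation "a / b" := (Op OpDiv a b) : expr_scope.
Notation "a 'mod' b" := (Op OpMod a b) : expr_scope.
Notation "a << b" := (Op OpShl a b) (at level 45) : expr_scope.
Notation "a >> b" := (Op OpShr a b) (at level 45) : expr_scope.
Notation "a == b" := (Op OpEq a b) (at level 70) : expr_scope.
Notation "a < b" := (Op OpLt a b) : expr_scope.
Notation "a +w b" := (WOp OpAdd a b) (at level 50, left associativity) : expr_scope.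
Declare Scope cmd_scope.
Delimit Scope cmd_scope with cmd.
Bind Scope cmd_scope with cmd.
Notation "x ::= e" := (Assign x e%expr) (at level 55) : cmd_scope.
Notation "c1 ;; c2" := (Seq c1 c2) (at level 60, right associativity) : cmd_scope.
Open Scope cmd_scope.

Definition etail (e : expr) : expr := Rd (Num 2 + Num 3 * e).
Definition ehead (e : expr) : expr := Rd (Num 3 + Num 3 * e).
Definition ewt (e : expr) : expr := Rd (Num 4 + Num 3 * e).

(* Beyond the input, six arrays are interleaved. *)
Definition addr (j : Z) (x : expr) : expr := (V vBase + (Num 6 * x + Num j))%expr.
Definition get (j : Z) (x : expr) : expr := Rd (addr j x).
Definition put (j : Z) (x v : expr) : cmd := Store (addr j x) v.

Notation aAdj := 0%Z (only parsing).
Notation aDeg := 1%Z (only parsing).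
Notation aLab := 2%Z (only parsing).
Notation aHeavy := 3%Z (only parsing).
Notation aW := 4%Z (only parsing).
Notation aC := 5%Z (only parsing).

Definition edigit (p : expr) : expr := ((V vg >> (V vW * p)) mod V vB)%expr.

(** Adding 1 inside the second parity flips it, so that factor is 1 exactly if the column digit
    answers 0. [vok2] is the conjunction of the tests so far. *)
Definition CHECK_BODY : cmd :=
  If (V vc == V vpos) Skip
    (vd1 ::= edigit (V vpos * V vK + V vc) ;;
     vd2 ::= edigit (V vc * V vK + V vpos) ;;
     vok2 ::= (V vok2 * (((V vx >> (V vd1 / Num 2)) + V vd1) mod Num 2)) *
              (((V vx >> (V vd2 / Num 2)) + (V vd2 + Num 1)) mod Num 2)).

Definition CHECK : cmd := vok2 ::= Num 1 ;; For vc vK CHECK_BODY.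

(** The arguments are passed in [vkey], [vnw] and [vnc]. The sum in the condition is a disjunction:
    an empty cell, whose 0 would otherwise win every comparison, is always overwritten. *)
Definition RELAX : cmd :=
  vcur ::= get aW (V vkey) ;;
  If ((V vcur == Num 0) + (V vnw < V vcur))
    (put aW (V vkey) (V vnw) ;; put aC (V vkey) (V vnc)) Skip.

(** At [vj = 0] the edge has been chosen by [PATH]. If the rank is too large, [vok] is cleared but
    [ve] keeps the former edge, so later reads still concern an existing edge. *)
Definition CHOOSE : cmd :=
  If (V vj)
    (vd ::= V vrest mod V vD ;;
     vrest ::= V vrest / V vD ;;
     If (V vd < get aDeg (V vend))
       (ve ::= get aAdj (V vend * V vM + V vd))
       (vok ::= Num 0))
    Skip.

Definition STEP : cmd :=
  vpos ::= V vp0 + V vj ;;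
  vx ::= get aLab (etail (V ve)) ;;
  CHECK ;;
  vok ::= V vok * V vok2 ;;
  vcode ::= V vcode * V vN + etail (V ve) ;;
  vwt ::= V vwt +w ewt (V ve) ;;
  vend ::= ehead (V ve).

Definition PATH : cmd :=
  ve ::= V vq mod V vM ;;
  vrest ::= V vq / V vM ;;
  vok ::= Num 1 ;;
  vwt ::= V vH ;;
  vcode ::= Num 0 ;;
  vst ::= etail (V ve) ;;
  vend ::= V vst ;;
  For vj vL (CHOOSE ;; STEP).

Definition LIGHT1_BODY : cmd :=
  PATH ;;
  If (V vok)
    (vkey ::= V vFr + (V vst * V vN + V vend) ;;
     vnw ::= V vwt ;; vnc ::= V vcode ;; RELAX)
    Skip.

(** The second half leads back from the end of the first half to its start, so its key exchanges
    start and end. Both stored weights contain the offset [H]; a third [H] is added because [3 * H]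
    equals [H] modulo [2 ^ w]. *)
Definition LIGHT2_BODY : cmd :=
  PATH ;;
  If (V vok)
    (vkey ::= V vFr + (V vend * V vN + V vst) ;;
     vcur ::= get aW (V vkey) ;;
     If (V vcur)
       (vnw ::= (V vcur +w V vwt) +w V vH ;;
        vnc ::= get aC (V vkey) * V vNR + V vcode ;;
        vkey ::= Num 0 ;; RELAX)
       Skip)
    Skip.

(** The table of n^2 cells is abandoned by advancing [vFr]; clearing it would take time n^2. *)
Definition LIGHT : cmd :=
  vp0 ::= Num 0 ;; vL ::= V vS ;; For vq vLim LIGHT1_BODY ;;
  vp0 ::= V vS ;; vL ::= V vR ;; For vq vLim LIGHT2_BODY ;;
  vFr ::= V vFr + V vN * V vN.

Definition DP_BODY : cmd :=
  vu ::= etail (V ve) ;;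
  vkey ::= V vFr + (V vi * V vN + V vu) ;;
  vcur ::= get aW (V vkey) ;;
  If (V vcur)
    (vpos ::= V vi ;; vx ::= get aLab (V vu) ;; CHECK ;;
     If (V vok2)
       (vnw ::= V vcur +w ewt (V ve) ;;
        vnc ::= get aC (V vkey) * V vN + V vu ;;
        vkey ::= V vFr + ((V vi + Num 1) * V vN + ehead (V ve)) ;; RELAX)
       Skip)
    Skip.

(** Layers 0 to K of n cells each lie side by side. Layer 0 contains only the source, with the empty
    walk, whose weight 0 is stored as [H]; the cell of the source in layer K describes closed
    walks. *)
Definition HEAVY_BODY : cmd :=
  vh ::= get aHeavy (V vhi) ;;
  put aW (V vFr + V vh) (V vH) ;;
  put aC (V vFr + V vh) (Num 0) ;;
  For vi vK (For ve vM DP_BODY) ;;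
  vkey ::= V vFr + (V vK * V vN + V vh) ;;
  vnw ::= get aW (V vkey) ;;
  If (V vnw)
    (vnc ::= get aC (V vkey) ;; vkey ::= Num 0 ;; RELAX) Skip ;;
  vFr ::= V vFr + (V vK + Num 1) * V vN.

Definition HEAVY : cmd := For vhi vNh HEAVY_BODY.

Definition MAIN : cmd := For vg vG (LIGHT ;; HEAVY).

(** [H] is [2 ^ (w - 1)], obtained without knowing [w]: [0 - 1] wraps to all ones, is halved, and 1
    is added. Table cell 0 is reserved for the best cycle, so [vFr] starts at 1. *)
Definition LOAD (k : nat) : cmd :=
  let s := Nat.div2 (k + 1) in
  vN ::= Rd (Num 0) ;; vM ::= Rd (Num 1) ;;
  vK ::= Num (Z.of_nat k) ;; vS ::= Num (Z.of_nat s) ;; vR ::= Num (Z.of_nat (k - s)) ;;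
  vBase ::= Num 2 + Num 3 * V vM ;;
  vH ::= (WOp OpSub (Num 0) (Num 1) >> Num 1) + Num 1 ;;
  vFr ::= Num 1 ;; vD ::= Num 1 ;; vT ::= Num 0 ;; vNR ::= Num 1 ;; vLim ::= V vM.

(** Each of the m rounds costs O(s) and raises [vD] by at most one, so the root is found in linear
    time without large intermediate powers. *)
Definition DEGREE : cmd :=
  For vi vM
    (vP ::= Num 1 ;; For vj vS (vP ::= V vP * V vD) ;;
     If (V vP < V vM) (vD ::= V vD + Num 1) Skip).

Definition LOGLOG : cmd :=
  For vi vM (If (V vM < (Num 1 << (Num 1 << V vT))) Skip (vT ::= V vT + Num 1)).

(** The round [vj = 0] of the second loop is skipped, so [D] enters s-1 times: the first edge of a
    path is already counted by m. *)
Definition POWERS : cmd :=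
  For vj vR (vNR ::= V vNR * V vN) ;;
  For vj vS (If (V vj) (vLim ::= V vLim * V vD) Skip).

Definition SETUP : cmd := DEGREE ;; LOGLOG ;; POWERS.

Definition CONSTS : cmd :=
  vW ::= V vT + Num 1 ;; vB ::= Num 1 << V vW ;;
  vG ::= Num 1 << (V vW * (V vK * V vK)).

(** Row [u] of the adjacency array has m cells, and the label of [u] is its latest out-edge. A
    vertex enters the heavy list when its degree passes from [D] to [D + 1], hence only once. *)
Definition EDGE_BODY : cmd :=
  vu ::= etail (V ve) ;;
  vd ::= get aDeg (V vu) ;;
  put aAdj (V vu * V vM + V vd) (V ve) ;;
  put aDeg (V vu) (V vd + Num 1) ;;
  put aLab (V vu) (V ve) ;;
  If (V vd == V vD)
    (put aHeavy (V vNh) (V vu) ;; vNh ::= V vNh + Num 1) Skip.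

Definition EDGES : cmd := For ve vM EDGE_BODY.

(** The digits of the code come off last vertex first, so the cells are filled from K down to 1. The
    input may be overwritten by now. *)
Definition OUTPUT : cmd :=
  vcur ::= get aW (Num 0) ;; vnc ::= get aC (Num 0) ;;
  If (V vcur)
    (Store (Num 0) (Num 1) ;;
     For vj vK (Store (V vK - V vj) (V vnc mod V vN) ;; vnc ::= V vnc / V vN))
    (Store (Num 0) (Num 0)).

Definition PROG (k : nat) : cmd :=
  LOAD k ;; SETUP ;; CONSTS ;; EDGES ;; MAIN ;; OUTPUT.

Lemma PROG_wf (k : nat) : wfc (PROG k) = true.
Proof. reflexivity. Qed.

(** * Verification conditions *)

Definition wp (w : nat) (c : cmd) (Q : store -> Prop) (s : store) : Prop := Q (sem w c s).

Section WP.
Variable w : nat.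

Lemma sem_seq (c1 c2 : cmd) (s : store) : sem w (Seq c1 c2) s = sem w c2 (sem w c1 s).
Proof. reflexivity. Qed.

Lemma sem_assign (x : nat) (e : expr) (s : store) :
  safe w s e -> sem w (Assign x e) s = setv s x (xeval w s e).
Proof. intros H. cbn. now rewrite eval_exact. Qed.

Lemma wp_seq (c1 c2 : cmd) (Q : store -> Prop) (s : store) :
  wp w c1 (wp w c2 Q) s -> wp w (Seq c1 c2) Q s.
Proof. auto. Qed.

Lemma wp_skip (Q : store -> Prop) (s : store) : Q s -> wp w Skip Q s.
Proof. auto. Qed.

Lemma wp_assign (x : nat) (e : expr) (Q : store -> Prop) (s : store) :
  safe w s e -> Q (setv s x (xeval w s e)) -> wp w (Assign x e) Q s.
Proof. intros H HQ. unfold wp. cbn. now rewrite eval_exact. Qed.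

Lemma wp_store (a e : expr) (Q : store -> Prop) (s : store) :
  safe w s a -> safe w s e ->
  Q (MkStore (vars s) (set_mem (smem s) (xeval w s a) (xeval w s e))) ->
  wp w (Store a e) Q s.
Proof. intros H H' HQ. unfold wp. cbn. now rewrite !eval_exact. Qed.

Lemma wp_if (e : expr) (c1 c2 : cmd) (Q : store -> Prop) (s : store) :
  safe w s e -> (xeval w s e <> 0%Z -> wp w c1 Q s) ->
  (xeval w s e = 0%Z -> wp w c2 Q s) -> wp w (If e c1 c2) Q s.
Proof.
  intros H H1 H2. unfold wp in *. cbn [sem]. rewrite eval_exact by auto.
  destruct (Z.eqb_spec (xeval w s e) 0); auto.
Qed.

End WP.

(** * Magnitudes and absence of overflow *)

Section Below.
Open Scope Z_scope.
Variable X : Z.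
Hypothesis HX : 16 <= X.

(* Machine quantities are measured by the power of [X] that bounds them. *)
Definition below (i : nat) (z : Z) : Prop := 0 <= z < X ^ Z.of_nat i.

(** The exponent 12 leaves room for the addresses of table cells: a key is below [X ^ 8], and the
    rules for sums and products then put [base + (6 * key + j)] below [X ^ 11]. *)
Definition fits (w : nat) : Prop := X ^ 12 <= 2 ^ Z.of_nat w.

Lemma below_mono (i j : nat) (z : Z) : (i <= j)%nat -> below i z -> below j z.
Proof using HX.
  intros H [H1 H2]. split; auto. eapply Z.lt_le_trans; [exact H2|].
  apply Z.pow_le_mono_r; lia.
Qed.

Lemma below_word (w i : nat) (z : Z) :
  fits w -> below i z -> Nat.leb i 12 = true -> word w z.
Proof using HX.
  intros HXw H Hi. apply Nat.leb_le in Hi. apply (below_mono i 12) in H; auto.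
  unfold fits, below, word in *. change (Z.of_nat 12) with 12 in H. lia.
Qed.

Lemma below_const (z : Z) : 0 <= z < 16 -> below 1 z.
Proof using HX. unfold below. change (Z.of_nat 1) with 1. rewrite Z.pow_1_r. lia. Qed.

Lemma below_add (i j : nat) (a b : Z) :
  below i a -> below j b -> below (S (Nat.max i j)) (a + b).
Proof using HX.
  intros Ha Hb. apply (below_mono _ (Nat.max i j)) in Ha, Hb; try lia.
  unfold below in *.
  replace (Z.of_nat (S (Nat.max i j))) with (Z.succ (Z.of_nat (Nat.max i j))) by lia.
  rewrite Z.pow_succ_r by lia. nia.
Qed.

Lemma below_mul (i j : nat) (a b : Z) :
  below i a -> below j b -> below (i + j) (a * b).
Proof using HX.
  unfold below. intros Ha Hb. rewrite Nat2Z.inj_add, Z.pow_add_r by lia. nia.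
Qed.

Lemma below_le (i : nat) (a b : Z) : below i a -> 0 <= b <= a -> below i b.
Proof using HX. unfold below. lia. Qed.

Lemma below_div (i j : nat) (a b : Z) : below i a -> below j b -> below i (a / b).
Proof using HX.
  intros [H1 H2] [H3 _]. destruct (Z.eq_dec b 0) as [->|].
  - rewrite Zdiv_0_r. split; lia.
  - split; [apply Z.div_pos; lia|]. eapply Z.le_lt_trans; [|exact H2].
    apply Z.div_le_upper_bound; nia.
Qed.

Lemma below_mod (i j : nat) (a b : Z) : below i a -> below j b -> below i (a mod b).
Proof using HX.
  intros [H1 H2] [H3 _]. destruct (Z.eq_dec b 0) as [->|].
  - rewrite Zmod_0_r. split; lia.
  - pose proof (Z.mod_pos_bound a b). pose proof (Z.mod_le a b). split; lia.
Qed.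

Lemma below_shiftr (i j : nat) (a b : Z) :
  below i a -> below j b -> below i (Z.shiftr a b).
Proof using HX.
  intros [H1 H2] [H3 _]. split; [now apply Z.shiftr_nonneg|].
  rewrite Z.shiftr_div_pow2 by auto.
  assert (0 < 2 ^ b) by (apply Z.pow_pos_nonneg; lia).
  eapply Z.le_lt_trans; [|exact H2]. apply Z.div_le_upper_bound; nia.
Qed.

Lemma below_bool (b : bool) : below 1 (if b then 1 else 0).
Proof using HX. apply below_const. destruct b; lia. Qed.

Lemma below_one (z : Z) : 0 <= z < X -> below 1 z.
Proof using HX. unfold below. change (Z.of_nat 1) with 1. now rewrite Z.pow_1_r. Qed.

Lemma fits_intro (w : nat) : X ^ 12 <= 2 ^ Z.of_nat w -> fits w.
Proof using HX. auto. Qed.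

Lemma below_nonneg (i : nat) (z : Z) : below i z -> 0 <= z.
Proof using HX. intros H. apply H. Qed.

End Below.

#[global] Opaque below fits.

Ltac hyp_below :=
  match goal with B : below _ _ ?z |- below _ _ ?z => exact B end.

Ltac bd HX :=
  lazymatch goal with
  | |- below _ _ (if _ then 1%Z else 0%Z) => exact (below_bool _ HX _)
  | |- below _ _ (_ + _)%Z => first [hyp_below | eapply (below_add _ HX); bd HX]
  | |- below _ _ (_ * _)%Z => first [hyp_below | eapply (below_mul _ HX); bd HX]
  | |- below _ _ (_ / _)%Z => first [hyp_below | eapply (below_div _ HX); bd HX]
  | |- below _ _ (_ mod _)%Z => first [hyp_below | eapply (below_mod _ HX); bd HX]
  | |- below _ _ (Z.shiftr _ _)%Z => first [hyp_below | eapply (below_shiftr _ HX); bd HX]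
  | |- _ => first [hyp_below | apply (below_const _ HX); split; [apply Z.leb_le; reflexivity|apply Z.ltb_lt; reflexivity]]
  end.

Ltac framed Hfv E := rewrite Hfv; [exact E|discriminate|reflexivity].

Ltac rwv :=
  repeat match goal with
  | E : vars ?s ?x = _ |- context [vars ?s ?x] => rewrite E
  end.

Ltac red_goal :=
  cbn [safe xeval zop vars smem setv set_reg Nat.eqb etail ehead ewt addr get edigit].

(* Powers and local definitions in the context make [lia] very slow. *)
Ltac slia :=
  repeat match goal with x := _ |- _ => clearbody x end;
  repeat match goal with
  | H : context [(_ ^ _)%Z] |- _ => clear H
  | H : forall _, _ |- _ => clear H
  end; lia.

(** * Correctness of the main loop *)

Section Main.
Open Scope Z_scope.
Variable w : nat.
Variable G : wdigraph.
Variables X K Sz Rz t D nh H Wb : Z.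
Variables deg lab hv : Z -> Z.
Variable adj : Z -> Z -> Z.

Let n := nv G.
Let m := ne G.
Let base := 2 + 3 * m.
Let glim := 2 ^ ((t + 1) * (K * K)).
Let lim := m * D ^ (Sz - 1).

Hypothesis HX : 16 <= X.
Hypothesis HXw : fits X w.
Hypothesis Hn : below X 1 n.
Hypothesis Hm : below X 1 m.
Hypothesis HK : below X 1 K.
Hypothesis Ht : 0 <= t.
Hypothesis HW : below X 1 (t + 1).
Hypothesis HB : below X 1 (2 ^ (t + 1)).
Hypothesis Hglim : below X 1 glim.
Hypothesis Hlim : below X 1 lim.
Hypothesis HD : below X 1 D.
Hypothesis HD0 : 0 < D.
Hypothesis HnK : below X 1 (n ^ K).
Hypothesis Hnh : below X 1 nh.
Hypothesis HS : 1 <= Rz <= Sz.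
Hypothesis HSR : Sz + Rz = K.
Hypothesis HH : H + H = 2 ^ Z.of_nat w.
Hypothesis HWb : forall e, 0 <= e < m -> Z.abs (wt G e) <= Wb.
Hypothesis HKW : K * Wb < H.
Hypothesis Hm2t : m <= 2 ^ 2 ^ t.
Hypothesis Hdeg : forall u, 0 <= u < n -> 0 <= deg u <= m.
Hypothesis Hadj : forall u i, 0 <= u < n -> 0 <= i < deg u ->
  0 <= adj u i < m /\ src G (adj u i) = u.
Hypothesis Hadjc : forall e, 0 <= e < m ->
  exists i, 0 <= i < deg (src G e) /\ adj (src G e) i = e.
Hypothesis Hlabr : forall u, 0 <= u < n -> 0 <= lab u <= m.
Hypothesis Hlab : forall e, 0 <= e < m ->
  0 <= lab (src G e) < m /\ src G (lab (src G e)) = src G e.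
Hypothesis Hhv : forall i, 0 <= i < nh -> 0 <= hv i < n.
Hypothesis Hhvc : forall u, 0 <= u < n -> D < deg u -> exists i, 0 <= i < nh /\ hv i = u.

Definition cell (s : store) (j x : Z) : Z := smem s (base + (6 * x + j)).

(** What the main loop reads and never changes: the variables up to 14, the input and the first four
    arrays, whose contents are [adj], [deg], [lab] and [hv]. *)
Record Env (s : store) : Prop := {
  e_N : vars s vN = n;
  e_M : vars s vM = m;
  e_K : vars s vK = K;
  e_S : vars s vS = Sz;
  e_R : vars s vR = Rz;
  e_Base : vars s vBase = base;
  e_D : vars s vD = D;
  e_W : vars s vW = t + 1;
  e_B : vars s vB = 2 ^ (t + 1);
  e_H : vars s vH = H;
  e_G : vars s vG = glim;
  e_Lim : vars s vLim = lim;
  e_Nh : vars s vNh = nh;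
  e_NR : vars s vNR = n ^ Rz;
  e_tail : forall e, 0 <= e < m -> smem s (2 + 3 * e) = src G e;
  e_head : forall e, 0 <= e < m -> smem s (3 + 3 * e) = dst G e;
  e_wt : forall e, 0 <= e < m -> smem s (4 + 3 * e) = to_word w (wt G e);
  e_deg : forall u, 0 <= u < n -> cell s aDeg u = deg u;
  e_adj : forall u i, 0 <= u < n -> 0 <= i < deg u -> cell s aAdj (u * m + i) = adj u i;
  e_lab : forall u, 0 <= u < n -> cell s aLab u = lab u;
  e_hv : forall i, 0 <= i < nh -> cell s aHeavy i = hv i
}.

(** All addresses outside the arrays [aW] and [aC], the only ones that the main loop writes to. *)
Definition prot (a : Z) : Prop :=
  a < base \/ exists x j, a = base + (6 * x + j) /\ 0 <= j < 4.

Lemma Env_frame (s s' : store) :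
  Env s -> (forall y, (y <= 14)%nat -> vars s' y = vars s y) ->
  (forall a, prot a -> smem s' a = smem s a) -> Env s'.
Proof.
  intros E Hv Hp.
  assert (P : forall x j, 0 <= j < 4 -> cell s' j x = cell s j x).
  { intros x j Hj. apply Hp. right. eauto. }
  destruct E. constructor; rewrite ?Hv by lia; auto; intros.
  1-3: rewrite Hp; auto; left; unfold base; lia.
  all: rewrite P by lia; auto.
Qed.

Lemma Env_sem (c : cmd) (s : store) :
  forallb (fun y => negb (assigned c y)) (seq 0 15) = true -> stores c = false ->
  Env s -> Env (sem w c s).
Proof.
  intros Hc Hs E. apply (Env_frame s); auto.
  - intros y Hy. apply sem_frame. rewrite forallb_forall in Hc.
    apply negb_true_iff, Hc, in_seq. lia.
  - intros a _. now rewrite sem_mem_frame.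
Qed.

Lemma Env_setv (s : store) (x : nat) (z : Z) : (15 <= x)%nat -> Env s -> Env (setv s x z).
Proof.
  intros Hx E. apply (Env_frame s); auto.
  intros y Hy. apply vars_setv_other. lia.
Qed.

Ltac env_eqs E :=
  let e1 := fresh "EN" in pose proof (e_N _ E) as e1;
  let e1 := fresh "EM" in pose proof (e_M _ E) as e1;
  let e1 := fresh "EK" in pose proof (e_K _ E) as e1;
  let e1 := fresh "ES" in pose proof (e_S _ E) as e1;
  let e1 := fresh "ER" in pose proof (e_R _ E) as e1;
  let e1 := fresh "EBase" in pose proof (e_Base _ E) as e1;
  let e1 := fresh "ED" in pose proof (e_D _ E) as e1;
  let e1 := fresh "EW" in pose proof (e_W _ E) as e1;
  let e1 := fresh "EB" in pose proof (e_B _ E) as e1;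
  let e1 := fresh "EH" in pose proof (e_H _ E) as e1;
  let e1 := fresh "EG" in pose proof (e_G _ E) as e1;
  let e1 := fresh "ELim" in pose proof (e_Lim _ E) as e1;
  let e1 := fresh "ENh" in pose proof (e_Nh _ E) as e1;
  let e1 := fresh "ENR" in pose proof (e_NR _ E) as e1.

Ltac words :=
  repeat lazymatch goal with
  | |- _ /\ _ => split
  | |- True => exact I
  | |- safe _ _ _ => progress red_goal
  | |- word w _ => eapply (below_word X HX w _ _ HXw); [solve [bd HX] | reflexivity]
  end.

Ltac wp_set := apply wp_seq, wp_assign; [red_goal; rwv; words|]; red_goal; rwv.

Ltac sem_set := rewrite sem_seq, sem_assign by (red_goal; rwv; words); red_goal; rwv.

Ltac below_by z := apply (below_le X HX _ z); [hyp_below|slia].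

Ltac env_setv E := repeat (apply Env_setv; [lia|]); exact E.

Lemma base_below : below X 3 base.
Proof. unfold base. eapply (below_mono _ HX); [|bd HX]. cbn. lia. Qed.

Lemma check_spec (s : store) (g pos x : Z) :
  Env s -> vars s vg = g -> vars s vpos = pos -> vars s vx = x ->
  0 <= g < glim -> 0 <= pos < K -> below X 1 x ->
  let s' := sem w CHECK s in
  (vars s' vok2 = 1 /\ cls K t g pos x) \/ (vars s' vok2 = 0 /\ ~ cls K t g pos x).
Proof.
  intros E Eg Epos Ex Hg Hpos Hx. cbn zeta.
  pose proof base_below as Hbase.
  assert (Bg : below X 1 g) by (apply (below_le X HX _ glim); [hyp_below|lia]).
  assert (Bpos : below X 1 pos) by (apply (below_le X HX _ K); [hyp_below|lia]).
  env_eqs E.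
  unfold CHECK. rewrite sem_seq, sem_assign by words.
  cbn [xeval]. set (s0 := setv s vok2 1).
  (* Either all tests so far succeeded, or the class is already refuted; a failure is permanent
     because [vok2] is only ever multiplied. *)
  destruct (sem_for w (fun j s' =>
    (vars s' vok2 = 1 /\ forall i, 0 <= i < j -> i <> pos ->
      chi (digit t g (pos * K + i)) x = 1 /\ chi (digit t g (i * K + pos)) x = 0) \/
    (vars s' vok2 = 0 /\ ~ cls K t g pos x)) vc vK CHECK_BODY s0) as (s' & -> & HP).
  - cbn. rewrite EK. exact (below_nonneg X HX _ _ HK).
  - left. cbn. split; [reflexivity|lia].
  - intros j s' Hj IH Hfr _. change (vars s0 vK) with (vars s vK) in Hj. rewrite EK in Hj.
    assert (Bj : below X 1 j) by (apply (below_le X HX _ K); [hyp_below|lia]).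
    assert (Fg := Hfr vg ltac:(easy) eq_refl). change (vars s0 vg) with (vars s vg) in Fg.
    assert (Fp := Hfr vpos ltac:(easy) eq_refl). change (vars s0 vpos) with (vars s vpos) in Fp.
    assert (Fx := Hfr vx ltac:(easy) eq_refl). change (vars s0 vx) with (vars s vx) in Fx.
    assert (FK := Hfr vK ltac:(easy) eq_refl). change (vars s0 vK) with (vars s vK) in FK.
    assert (FW := Hfr vW ltac:(easy) eq_refl). change (vars s0 vW) with (vars s vW) in FW.
    assert (FB := Hfr vB ltac:(easy) eq_refl). change (vars s0 vB) with (vars s vB) in FB.
    rewrite Eg in Fg; rewrite Epos in Fp; rewrite Ex in Fx; rewrite EK in FK;
      rewrite EW in FW; rewrite EB in FB.
    assert (Bok : below X 1 (vars s' vok2)).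
    { destruct IH as [[-> _]|[-> _]]; apply (below_const X HX); lia. }
    match goal with |- ?Q => change (wp w CHECK_BODY (fun s' =>
    (vars s' vok2 = 1 /\ forall i, 0 <= i < j + 1 -> i <> pos ->
      chi (digit t g (pos * K + i)) x = 1 /\ chi (digit t g (i * K + pos)) x = 0) \/
    (vars s' vok2 = 0 /\ ~ cls K t g pos x)) (setv s' vc j)) end.
    apply wp_if.
    + red_goal. rwv. words.
    + red_goal. rwv. destruct (Z.eqb_spec j pos) as [->|]; [|easy]. intros _.
      apply wp_skip. red_goal. destruct IH as [[I1 I2]|IH]; [left|right; auto].
      split; auto. intros i Hi Hne. apply I2; lia.
    + red_goal. rwv. destruct (Z.eqb_spec j pos) as [->|Hne]; [easy|]. intros _.
      apply wp_seq, wp_assign; [red_goal; rwv; words|].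
      apply wp_seq, wp_assign; [red_goal; rwv; words|].
      red_goal; rwv.
      set (d1 := Z.shiftr g ((t + 1) * (pos * K + j)) mod 2 ^ (t + 1)).
      set (d2 := Z.shiftr g ((t + 1) * (j * K + pos)) mod 2 ^ (t + 1)).
      assert (Bd1 : below X 1 d1) by (unfold d1; bd HX).
      assert (Bd2 : below X 1 d2) by (unfold d2; bd HX).
      apply wp_assign; [red_goal; rwv; words|].
      red_goal; rwv.
      assert (C1 : chi (digit t g (pos * K + j)) x = (Z.shiftr x (d1 / 2) + d1) mod 2)
        by reflexivity.
      assert (C2 : (Z.shiftr x (d2 / 2) + (d2 + 1)) mod 2 = 1 - chi (digit t g (j * K + pos)) x).
      { change (digit t g (j * K + pos)) with d2. unfold chi.
        rewrite Z.add_assoc. generalize (Z.shiftr x (d2 / 2) + d2). intros y.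
        pose proof (Z.mod_pos_bound y 2). rewrite Z.add_mod by lia.
        assert (Hy : y mod 2 = 0 \/ y mod 2 = 1) by lia.
        destruct Hy as [-> | ->]; reflexivity. }
      rewrite C2, <- C1.
      assert (R1 : chi (digit t g (pos * K + j)) x = 0 \/ chi (digit t g (pos * K + j)) x = 1).
      { unfold chi. match goal with |- ?y mod 2 = _ \/ _ =>
          pose proof (Z.mod_pos_bound y 2) end. lia. }
      assert (R2 : chi (digit t g (j * K + pos)) x = 0 \/ chi (digit t g (j * K + pos)) x = 1).
      { unfold chi. match goal with |- ?y mod 2 = _ \/ _ =>
          pose proof (Z.mod_pos_bound y 2) end. lia. }
      destruct IH as [[I1 I2]|[I1 I2]]; rewrite I1; [|right; split; [lia|auto]].
      destruct (classic (chi (digit t g (pos * K + j)) x = 1 /\ chi (digit t g (j * K + pos)) x = 0))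
        as [[A1 A2]|A].
      * left. rewrite A1, A2. split; [reflexivity|]. intros i Hi Hni.
        destruct (Z.eq_dec i j) as [->|]; [auto|]. apply I2; lia.
      * right. split; [|intros C; apply A, C; auto].
        destruct R1 as [R1|R1], R2 as [R2|R2]; rewrite R1, R2; try reflexivity.
        exfalso; auto.
  - change (vars s0 vK) with (vars s vK) in *. rewrite EK in *.
    change (vars (setv s' vc K) vok2) with (vars s' vok2).
    destruct HP as [[P1 P2]|HP]; [left|right; auto].
    split; [auto|]. intros i Hi Hni. apply P2; auto.
Qed.

(** Quantified over [J] and [P], so that the path table, the layers and the best cell share it.
    After the call the cell accounts for [nw], hence for every larger value too. *)
Lemma relax_spec (s : store) (key nw nc : Z) :
  vars s vBase = base -> vars s vkey = key -> vars s vnw = nw -> vars s vnc = nc ->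
  below X 8 key -> nw <> 0 ->
  let s' := sem w RELAX s in
  (forall a, prot a -> smem s' a = smem s a) /\
  (forall x, x <> key -> cell s' aW x = cell s aW x /\ cell s' aC x = cell s aC x) /\
  (forall J P, entry (cell s aW key) (cell s aC key) J P -> J nw nc ->
    entry (cell s' aW key) (cell s' aC key) J (fun y => P y \/ nw <= y)).
Proof.
  intros EBase Ek Enw Enc Bk Hnw. pose proof base_below as Hbase.
  set (Q := fun s' => (forall a, prot a -> smem s' a = smem s a) /\
    (forall x, x <> key -> cell s' aW x = cell s aW x /\ cell s' aC x = cell s aC x) /\
    (forall J P, entry (cell s aW key) (cell s aC key) J P -> J nw nc ->
      entry (cell s' aW key) (cell s' aC key) J (fun y => P y \/ nw <= y))).
  change (wp w RELAX Q s).
  wp_set.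
  fold (cell s aW key). apply wp_if.
  - red_goal; rwv; words.
  - red_goal; rwv. intros Hc.
    apply wp_seq, wp_store; [red_goal; rwv; words..|].
    apply wp_store; [red_goal; rwv; words..|]. red_goal; rwv.
    assert (Hc' : cell s aW key = 0 \/ nw < cell s aW key).
    { destruct (Z.eqb_spec (cell s aW key) 0), (Z.ltb_spec nw (cell s aW key)); auto; lia. }
    assert (C1 : forall m' x j, 0 <= j < 6 ->
      cell (MkStore m' (set_mem (set_mem (smem s) (base + (6 * key + 4)) nw)
        (base + (6 * key + 5)) nc)) j x =
      if (x =? key) && (j =? 4) then nw else if (x =? key) && (j =? 5) then nc
      else cell s j x).
    { intros m' x j Hj. unfold cell, set_mem. cbn [smem].
      destruct (Z.eqb_spec x key), (Z.eqb_spec j 4), (Z.eqb_spec j 5); cbn [andb]; subst;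
        repeat match goal with |- context [(?a =? ?b)] => destruct (Z.eqb_spec a b) end;
        try reflexivity; lia. }
    unfold Q. split; [|split].
    + intros a Ha. cbn [smem]. unfold set_mem. assert (0 <= key) by exact (below_nonneg X HX _ _ Bk).
      destruct Ha as [Ha|(x & j & -> & Hj)];
        repeat match goal with |- context [(?a =? ?b)] => destruct (Z.eqb_spec a b) end;
        try reflexivity; lia.
    + intros x Hx. rewrite !C1 by lia. apply Z.eqb_neq in Hx. rewrite Hx. auto.
    + intros J P [HJ HP] HJn. rewrite !C1 by lia. rewrite Z.eqb_refl. cbn [andb Z.eqb Pos.eqb].
      split; [auto|]. intros y [Hy|Hy]; [|auto]. specialize (HP y Hy). split; [auto|lia].
  - red_goal; rwv. intros Hc. apply wp_skip. unfold Q. split; [auto|split; [auto|]].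
    intros J P [HJ HP] HJn. unfold cell. cbn [smem setv]. fold (cell s aW key) (cell s aC key).
    destruct (Z.eqb_spec (cell s aW key) 0), (Z.ltb_spec nw (cell s aW key)); try lia.
    split; [auto|]. intros y [Hy|Hy]; [auto|]. split; [auto|lia].
Qed.

Notation cwalk' := (cwalk G K t lab).
Notation ranks' := (ranks G deg adj D).
Notation path_index' := (path_index G deg adj D).

(** At most [K] weights sum to at most [K * Wb < H] in absolute value. An offset weight therefore
    does not wrap and is never the 0 of an empty cell. *)
Lemma cwalk_weight (g p u v : Z) (es : list Z) :
  Z.of_nat (length es) <= K -> cwalk' g p u es v ->
  0 < H + psum G es < 2 ^ Z.of_nat w.
Proof.
  intros Hl Hw. apply cwalk_walk in Hw.
  assert (Hb : Z.abs (psum G es) <= Z.of_nat (length es) * Wb).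
  { apply psum_bound. intros e He. apply HWb. eapply walk_edges; eauto. }
  (* [Wb] only bounds the weights of existing edges; in a graph without edges it may be negative,
     but then only the empty walk exists. *)
  assert (HW0 : 0 <= Wb \/ es = []).
  { destruct es as [|e es]; [auto|left]. destruct Hw as (He & _).
    specialize (HWb e He). lia. }
  destruct HW0 as [HW0| ->].
  - assert (Z.of_nat (length es) * Wb <= K * Wb) by nia. lia.
  - cbn in *. assert (0 < H); [|lia].
    assert (0 < 2 ^ Z.of_nat w) by (apply Z.pow_pos_nonneg; lia). lia.
Qed.

(** * Decoding one path number *)

Section Path.
Variables g p q L : Z.
Hypothesis Hg : 0 <= g < glim.
Hypothesis Hp : 0 <= p.
Hypothesis HL : 1 <= L.
Hypothesis HpL : p + L <= K.
Hypothesis Hq : 0 <= q < lim.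

(* [ready] tells whether the next edge has already been chosen. *)
Definition path_inv (ready : bool) (j : Z) (s : store) : Prop :=
  (vars s vok = 0 \/ vars s vok = 1) /\
  0 <= vars s vrest <= q /\ 0 <= vars s ve < m /\
  0 <= vars s vst < n /\ 0 <= vars s vend < n /\ 0 <= vars s vcode < n ^ j /\
  (vars s vok = 1 -> (ready = true -> src G (vars s ve) = vars s vend) /\
    exists es, Z.of_nat (length es) = j /\ cwalk' g p (vars s vst) es (vars s vend) /\
      vars s vcode = pcode G es /\ vars s vwt = to_word w (H + psum G es)) /\
  (forall es u v, path_index' es q -> Z.of_nat (length es) = L -> cwalk' g p u es v ->
    vars s vok = 1 /\ vars s vst = u /\ exists a b, es = a ++ b /\
      Z.of_nat (length a) = j /\ cwalk' g p u a (vars s vend) /\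
      vars s vwt = to_word w (H + psum G a) /\
      if ready then exists b', b = vars s ve :: b' /\ ranks' b' (vars s vrest)
      else ranks' b (vars s vrest)).

(** By [ranks], the lowest base-[D] digit of [vrest] is the rank of the next edge among those
    leaving [vend]. *)
Lemma choose_spec (s : store) (j : Z) :
  Env s -> vars s vj = j -> 0 <= j < L -> path_inv (j =? 0) j s ->
  path_inv true j (sem w CHOOSE s).
Proof.
  intros E Ej Hj (I1 & I2 & I3 & I4 & I5 & I6 & I7 & I8).
  change (wp w CHOOSE (path_inv true j) s). pose proof base_below as Hbase. env_eqs E.
  assert (Bq : below X 1 q) by (apply (below_le X HX _ lim); [hyp_below|lia]).
  assert (Br : below X 1 (vars s vrest)) by (apply (below_le X HX _ q); [hyp_below|lia]).
  assert (Be : below X 1 (vars s vend)) by (apply (below_le X HX _ n); [hyp_below|lia]).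
  apply wp_if.
  - red_goal; rwv; words.
  - red_goal; rwv. intros Hj0. rewrite (proj2 (Z.eqb_neq j 0) Hj0) in I7, I8.
    apply wp_seq, wp_assign; [red_goal; rwv; words|].
    wp_set.
    set (r := vars s vrest) in *. set (x := vars s vend) in *.
    assert (Hi : 0 <= r mod D < D) by (apply Z.mod_pos_bound; lia).
    assert (Hr : 0 <= r / D <= r).
    { split; [apply Z.div_pos; lia|]. apply Z.div_le_upper_bound; nia. }
    assert (Hr' : 0 <= r / D <= q) by (split; [apply Hr|eapply Z.le_trans; [apply Hr|apply I2]]).
    assert (Hx : smem s (base + (6 * x + 1)) = deg x) by (apply (e_deg _ E); auto).
    assert (Bd : below X 1 (deg x)).
    { specialize (Hdeg x I5). apply (below_le X HX _ m); [hyp_below|lia]. }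
    assert (Hstep : forall es u v, path_index' es q -> Z.of_nat (length es) = L ->
      cwalk' g p u es v -> vars s vok = 1 /\ vars s vst = u /\
      r mod D < deg x /\ exists a b, es = a ++ b /\
      Z.of_nat (length a) = j /\ cwalk' g p u a x /\
      vars s vwt = to_word w (H + psum G a) /\
      exists b', b = adj x (r mod D) :: b' /\ ranks' b' (r / D)).
    { intros es u v Hes Hl Hw. destruct (I8 es u v Hes Hl Hw) as (A1 & A2 & a & b & A3 & A4 & A5 & A6 & A7).
      split; [auto|split; [auto|]].
      destruct b as [|e b]; [rewrite A3, app_nil_r in Hl; clear - Hl A4 Hj; lia|].
      destruct A7 as (i & r' & B1 & B2 & B3 & B4 & B5 & B6).
      assert (Ex : src G e = x).
      { rewrite A3 in Hw. apply cwalk_app in Hw as (y & W1 & W2).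
        destruct W2 as (_ & W2 & _). rewrite W2.
        eapply walk_end; eapply cwalk_walk; eauto. }
      rewrite Ex in B2, B3.
      assert (Er : r mod D = i /\ r / D = r').
      { rewrite B5, (Z.mul_comm D). rewrite Z_mod_plus_full, Z.mod_small by lia.
        rewrite Z.div_add, Z.div_small by lia. auto. }
      destruct Er as [-> ->]. split; [auto|]. exists a, (e :: b).
      split; [auto|split; [auto|split; [auto|split; [auto|]]]]. exists b. now rewrite B3. }
    apply wp_if.
    + red_goal; rwv; fold x; rewrite Hx. words.
    + red_goal; rwv; fold x; rewrite Hx. intros Hlt.
      assert (Hlt' : r mod D < deg x) by (destruct (Z.ltb_spec (r mod D) (deg x)); lia).
      apply wp_assign; [red_goal; rwv; words|]. red_goal; rwv.
      assert (Ea : smem s (base + (6 * (x * m + r mod D) + 0)) = adj x (r mod D))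
        by (apply (e_adj _ E); auto; lia).
      fold x. rewrite Ea.
      destruct (Hadj x (r mod D) I5 ltac:(lia)) as [Ha1 Ha2].
      unfold path_inv; red_goal. fold x.
      split; [auto|]. split; [exact Hr'|]. split; [exact Ha1|]. split; [auto|]. split; [auto|].
      split; [auto|]. split.
      * intros Ho. destruct (I7 Ho) as [_ I7']. split; auto.
      * intros es u v Hes Hl Hw. destruct (Hstep es u v Hes Hl Hw) as (A1 & A2 & _ & A3).
        auto.
    + red_goal; rwv; fold x; rewrite Hx. intros Hlt.
      assert (Hlt' : ~ r mod D < deg x) by (destruct (Z.ltb_spec (r mod D) (deg x)); lia).
      apply wp_assign; [red_goal; rwv; words|]. red_goal; rwv.
      unfold path_inv; red_goal. fold x.
      split; [auto|]. split; [exact Hr'|]. split; [auto|]. split; [auto|]. split; [auto|].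
      split; [auto|]. split; [easy|].
      intros es u v Hes Hl Hw. destruct (Hstep es u v Hes Hl Hw) as (A1 & A2 & A3 & _).
      contradiction.
  - red_goal; rwv. intros ->. apply wp_skip. cbn in I7, I8.
    exact (conj I1 (conj I2 (conj I3 (conj I4 (conj I5 (conj I6 (conj I7 I8))))))).
Qed.

(** Edge weights are two's complement words, so the running weight is known only modulo [2 ^ w];
    [path_spec] removes the modulus at the end by [cwalk_weight]. *)
Lemma step_spec (s : store) (j : Z) :
  Env s -> vars s vj = j -> vars s vp0 = p -> vars s vg = g -> 0 <= j < L ->
  path_inv true j s -> path_inv false (j + 1) (sem w STEP s).
Proof.
  intros E Ej Ep Eg Hj (I1 & I2 & I3 & I4 & I5 & I6 & I7 & I8).
  change (wp w STEP (path_inv false (j + 1)) s). pose proof base_below as Hbase. env_eqs E.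
  set (e := vars s ve) in *.
  assert (Et := e_tail _ E e I3). assert (Eh := e_head _ E e I3). assert (Ew := e_wt _ E e I3).
  assert (Hsrc := src_bound G e I3). assert (Hdst := dst_bound G e I3). fold n in Hsrc, Hdst.
  assert (Bp : below X 1 p) by (apply (below_le X HX _ K); [hyp_below|lia]).
  assert (Bj : below X 1 j) by (apply (below_le X HX _ K); [hyp_below|lia]).
  assert (Be : below X 1 e) by (apply (below_le X HX _ m); [hyp_below|lia]).
  assert (Bs : below X 1 (src G e)) by (apply (below_le X HX _ n); [hyp_below|lia]).
  assert (Bc : below X 1 (vars s vcode)).
  { apply (below_le X HX _ (n ^ K)); [hyp_below|]. split; [lia|].
    apply Z.lt_le_incl, (Z.lt_le_trans _ (n ^ j)); [lia|].
    apply Z.pow_le_mono_r; [clear - Hsrc|clear - Hj HpL Hp]; lia. }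
  apply wp_seq, wp_assign; [red_goal; rwv; words|].
  apply wp_seq, wp_assign; [red_goal; rwv; fold e; rewrite ?Et; words|].
  red_goal; rwv. fold e; rewrite Et.
  replace (smem s (base + (6 * src G e + 2))) with (lab (src G e))
    by (symmetry; apply (e_lab _ E); auto).
  set (s1 := setv (setv s vpos (p + j)) vx (lab (src G e))).
  assert (E1 : Env s1) by (apply Env_setv; [lia|]; apply Env_setv; [lia|auto]).
  apply wp_seq.
  pose proof (check_spec s1 g (p + j) (lab (src G e)) E1 Eg eq_refl eq_refl Hg
    ltac:(clear - Hj HpL Hp; lia)) as Hc.
  assert (Bl : below X 1 (lab (src G e))).
  { apply (below_le X HX _ m); [hyp_below|]. apply Hlabr; auto. }
  specialize (Hc Bl). cbn zeta in Hc. unfold wp at 1.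
  assert (Fv : forall y, assigned CHECK y = false -> vars (sem w CHECK s1) y = vars s1 y)
    by (intros; apply sem_frame; auto).
  assert (Fm : smem (sem w CHECK s1) = smem s) by (apply (sem_mem_frame w CHECK s1); reflexivity).
  set (s2 := sem w CHECK s1) in *.
  assert (V1 : vars s2 vok = vars s vok) by (rewrite Fv; reflexivity).
  assert (V2 : vars s2 vcode = vars s vcode) by (rewrite Fv; reflexivity).
  assert (V3 : vars s2 vN = n) by (rewrite Fv; [exact EN|reflexivity]).
  assert (V4 : vars s2 ve = e) by (rewrite Fv; reflexivity).
  assert (V5 : vars s2 vwt = vars s vwt) by (rewrite Fv; reflexivity).
  assert (V6 : vars s2 vst = vars s vst) by (rewrite Fv; reflexivity).
  assert (V7 : vars s2 vrest = vars s vrest) by (rewrite Fv; reflexivity).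
  clearbody s2.
  assert (Bo : below X 1 (vars s vok)) by (destruct I1 as [-> | ->]; apply (below_const X HX); lia).
  assert (Bo2 : below X 1 (vars s2 vok2))
    by (destruct Hc as [[-> _]|[-> _]]; apply (below_const X HX); lia).
  apply wp_seq, wp_assign; [red_goal; rwv; words|].
  apply wp_seq, wp_assign; [red_goal; rwv; rewrite ?Fm, ?Et; words|].
  apply wp_seq, wp_assign; [red_goal; rwv; rewrite ?Fm, ?Et; words|].
  apply wp_assign; [red_goal; rwv; rewrite ?Fm, ?Et; words|].
  red_goal; rwv. rewrite Fm, Et, Eh, Ew.
  unfold path_inv; red_goal. rewrite V4, V6, V7. rewrite to_word_add_r.
  assert (Hpow : n ^ (j + 1) = n ^ j * n) by (rewrite Z.pow_add_r, Z.pow_1_r; lia).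
  split; [destruct I1 as [-> | ->], Hc as [[-> _]|[-> _]]; cbn; auto|].
  split; [auto|]. split; [auto|]. split; [auto|]. split; [auto|].
  split; [rewrite Hpow; clear - I6 Hsrc; nia|]. split.
  - intros Ho. destruct Hc as [[Hc1 Hc2]|[Hc1 _]]; [|rewrite Hc1 in Ho; slia].
    rewrite Hc1 in Ho. assert (Ho' : vars s vok = 1) by slia.
    destruct (I7 Ho') as (Hse & es & A1 & A2 & A3 & A4). specialize (Hse eq_refl).
    split; [easy|]. exists (es ++ [e]). split; [rewrite length_app; cbn; slia|].
    split; [|split].
    + apply cwalk_snoc. split; [auto|]. rewrite Hse, A1. split; [auto|split; [|auto]].
      rewrite <- Hse. auto.
    + now rewrite pcode_snoc, A3.
    + rewrite A4, to_word_add_l, psum_app. cbn [psum]. f_equal. slia.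
  - intros es u v Hes Hl Hw. destruct (I8 es u v Hes Hl Hw) as (A1 & A2 & a & b & A3 & A4 & A5 & A6 & b' & A7 & A8).
    assert (W : cwalk' g p u (a ++ [e]) (dst G e)).
    { rewrite A3, A7 in Hw. change (e :: b') with ([e] ++ b') in Hw.
      rewrite app_assoc in Hw. apply cwalk_app in Hw as (y & W & _).
      pose proof W as W'. apply cwalk_snoc in W' as (_ & _ & _ & ->). auto. }
    assert (Hcl : cls K t g (p + j) (lab (src G e))).
    { apply cwalk_snoc in W as (_ & _ & W & _). now rewrite A4 in W. }
    destruct Hc as [[Hc1 Hc2]|[_ Hc2]]; [|contradiction].
    rewrite Hc1, A1. split; [reflexivity|]. split; [auto|].
    exists (a ++ [e]), b'. split; [rewrite A3, A7, <- app_assoc; reflexivity|].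
    split; [rewrite length_app; cbn; slia|]. split; [auto|]. split; [|auto].
    rewrite A6, to_word_add_l, psum_app. cbn [psum]. f_equal. slia.
Qed.

(** The last two clauses are soundness and completeness. By the second, a classed walk of [L] edges
    with number [q] has exactly the computed ends and weight, so one number accounts for at most one
    value. *)
Lemma path_spec (s : store) :
  Env s -> vars s vq = q -> vars s vp0 = p -> vars s vL = L -> vars s vg = g ->
  let s' := sem w PATH s in
  (vars s' vok = 0 \/ vars s' vok = 1) /\
  0 <= vars s' vst < n /\ 0 <= vars s' vend < n /\ 0 <= vars s' vcode < n ^ L /\
  (vars s' vok = 1 -> exists es, Z.of_nat (length es) = L /\
    cwalk' g p (vars s' vst) es (vars s' vend) /\
    vars s' vcode = pcode G es /\ vars s' vwt = H + psum G es) /\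
  (forall es u v, path_index' es q -> Z.of_nat (length es) = L -> cwalk' g p u es v ->
    vars s' vok = 1 /\ vars s' vst = u /\ vars s' vend = v /\ vars s' vwt = H + psum G es).
Proof.
  intros E Eq Ep EL Eg. cbn zeta. pose proof base_below as Hbase. env_eqs E.
  assert (Bq : below X 1 q) by (below_by lim).
  assert (Hm0 : 0 < m).
  { pose proof (below_nonneg X HX _ _ Hm). destruct (Z.eq_dec m 0) as [E0|]; [|lia].
    exfalso. unfold lim in Hq. rewrite E0 in Hq. clear - Hq. lia. }
  assert (He : 0 <= q mod m < m) by (apply Z.mod_pos_bound; auto).
  assert (Et := e_tail _ E _ He).
  assert (Hr : 0 <= q / m <= q).
  { clear - Hm0 Hq. split; [apply Z.div_pos; lia|]. apply Z.div_le_upper_bound; nia. }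
  assert (Hs := src_bound G _ He).
  unfold PATH.
  sem_set.
  sem_set.
  sem_set.
  sem_set.
  sem_set.
  sem_set.
  sem_set.
  rewrite Et.
  match goal with |- context [sem w (For vj vL _) ?st] => set (s0 := st) end.
  assert (E0 : Env s0) by (unfold s0; env_setv E).
  destruct (sem_for w (fun j s' => path_inv (j =? 0) j s') vj vL (CHOOSE ;; STEP) s0)
    as (s' & -> & HP).
  - change (vars s0 vL) with (vars s vL). rewrite EL. slia.
  - unfold path_inv, s0; red_goal; rwv. cbn [Z.eqb].
    split; [right; reflexivity|]. split; [exact Hr|]. split; [exact He|].
    split; [exact Hs|]. split; [exact Hs|]. split; [cbn; lia|]. split.
    + intros _. split; [reflexivity|]. exists []. split; [reflexivity|].
      split; [reflexivity|]. split; [reflexivity|]. cbn [psum]. rewrite Z.add_0_r.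
      symmetry. apply to_word_small. unfold word. clear - HH.
      assert (0 < 2 ^ Z.of_nat w) by (apply Z.pow_pos_nonneg; lia). lia.
    + intros es u v Hes Hl Hw. split; [reflexivity|].
      destruct es as [|e es]; [cbn in Hl; slia|].
      destruct Hes as (r & R1 & R2 & R3). destruct Hw as (W1 & W2 & _).
      assert (Em : q mod m = e /\ q / m = r).
      { rewrite R2, (Z.mul_comm _ r). fold m in W1 |- *.
        rewrite Z_mod_plus_full, Z.mod_small by assumption.
        rewrite Z.div_add, Z.div_small by (try assumption; clear - Hm0; lia). auto. }
      destruct Em as [-> ->]. split; [exact W2|]. exists [], (e :: es).
      split; [reflexivity|]. split; [reflexivity|]. split; [symmetry; exact W2|].
      split; [|exists es; auto].
      cbn [psum]. rewrite Z.add_0_r.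
      symmetry. apply to_word_small. unfold word. clear - HH.
      assert (0 < 2 ^ Z.of_nat w) by (apply Z.pow_pos_nonneg; lia). lia.
  - intros j s' Hj IH Hfr Hfm.
    change (vars s0 vL) with (vars s vL) in Hj. rewrite EL in Hj.
    assert (E1 : Env (setv s' vj j)).
    { apply Env_setv; [lia|]. apply (Env_frame s0); [exact E0| |].
      - intros y Hy. apply Hfr; [lia|].
        do 15 (destruct y as [|y]; [reflexivity|]). lia.
      - intros a _. now rewrite Hfm. }
    replace (j + 1 =? 0) with false by (symmetry; apply Z.eqb_neq; slia).
    rewrite sem_seq.
    assert (C : path_inv true j (sem w CHOOSE (setv s' vj j))).
    { apply choose_spec; auto. }
    apply step_spec; auto.
    + apply Env_sem; [reflexivity..|auto].
    + rewrite sem_frame; reflexivity.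
    + rewrite sem_frame by reflexivity. change (vars (setv s' vj j) vp0) with (vars s' vp0).
      framed Hfr Ep.
    + rewrite sem_frame by reflexivity. change (vars (setv s' vj j) vg) with (vars s' vg).
      framed Hfr Eg.
  - change (vars s0 vL) with (vars s vL) in HP |- *. rewrite EL in HP |- *.
    replace (L =? 0) with false in HP by (symmetry; apply Z.eqb_neq; slia).
    destruct HP as (I1 & I2 & I3 & I4 & I5 & I6 & I7 & I8). red_goal.
    split; [exact I1|]. split; [exact I4|]. split; [exact I5|]. split; [exact I6|]. split.
    + intros Ho. destruct (I7 Ho) as (_ & es & A1 & A2 & A3 & A4).
      exists es. split; [exact A1|]. split; [exact A2|]. split; [exact A3|].
      rewrite A4. apply to_word_small.
      assert (0 < H + psum G es < 2 ^ Z.of_nat w); [|unfold word; lia].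
      eapply cwalk_weight; [|exact A2]. slia.
    + intros es u v Hes Hl Hw.
      destruct (I8 es u v Hes Hl Hw) as (A1 & A2 & a & b & A3 & A4 & A5 & A6 & A7).
      assert (b = []).
      { rewrite A3, length_app in Hl. destruct b; [reflexivity|cbn in Hl; slia]. }
      subst b. rewrite app_nil_r in A3. subst a.
      split; [exact A1|]. split; [exact A2|]. split.
      * eapply walk_end; eapply cwalk_walk; eauto.
      * rewrite A6. apply to_word_small.
        assert (0 < H + psum G es < 2 ^ Z.of_nat w); [|unfold word; lia].
        eapply cwalk_weight; [|exact Hw]. slia.
Qed.

End Path.

Lemma Env_relax (s : store) :
  Env s -> below X 8 (vars s vkey) -> vars s vnw <> 0 -> Env (sem w RELAX s).
Proof.
  intros E Bk Hnw.
  destruct (relax_spec s _ _ _ (e_Base _ E) eq_refl eq_refl eq_refl Bk Hnw) as (H1 & _).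
  apply (Env_frame s); [exact E| |exact H1].
  intros y Hy. apply sem_frame. do 15 (destruct y as [|y]; [reflexivity|]). lia.
Qed.

Lemma fresh_bound (fr a b : Z) :
  below X 7 fr -> 0 <= a <= K -> 0 <= b < n -> below X 8 (fr + (a * n + b)).
Proof.
  intros Hf Ha Hb.
  assert (Ba : below X 1 a) by (below_by K).
  assert (Bb : below X 1 b) by (below_by n).
  eapply (below_mono X HX); [|bd HX]. cbn. lia.
Qed.

Lemma fresh_bound2 (fr a b : Z) :
  below X 7 fr -> 0 <= a < n -> 0 <= b < n -> below X 8 (fr + (a * n + b)).
Proof.
  intros Hf Ha Hb.
  assert (Ba : below X 1 a) by (below_by n).
  assert (Bb : below X 1 b) by (below_by n).
  eapply (below_mono X HX); [|bd HX]. cbn. lia.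
Qed.

Lemma pair_key (a b a' b' : Z) :
  0 <= b < n -> 0 <= b' < n -> a * n + b = a' * n + b' -> a = a' /\ b = b'.
Proof.
  intros Hb Hb' E. apply (Z.div_mod_unique n a a' b b'); try (left; assumption).
  now rewrite !(Z.mul_comm n).
Qed.

Definition good (dw dc : Z) : Prop :=
  exists es u, Z.of_nat (length es) = K /\ walk G u es u /\ NoDup (map (src G) es) /\
    dw = H + psum G es /\ dc = pcode G es.

Lemma cwalk_good (g u : Z) (es : list Z) :
  Z.of_nat (length es) = K -> cwalk' g 0 u es u -> good (H + psum G es) (pcode G es).
Proof.
  intros Hl Hw. exists es, u. split; [auto|]. split; [eapply cwalk_walk; eauto|].
  split; [|auto]. eapply (cwalk_nodup G K t lab g 0); [lia| |eauto]. lia.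
Qed.

(** * One guess: cycles without heavy vertices *)

Section Guess.
Variables g fr : Z.
Hypothesis Hg : 0 <= g < glim.
Hypothesis Hfr : 1 <= fr.
Hypothesis Bfr : below X 7 fr.

Definition path_just (p L u v dw dc : Z) : Prop :=
  exists es, Z.of_nat (length es) = L /\ cwalk' g p u es v /\
    dw = H + psum G es /\ dc = pcode G es.

Definition light1_done (x u v y : Z) : Prop :=
  exists es q, 0 <= q < x /\ path_index' es q /\ Z.of_nat (length es) = Sz /\
    cwalk' g 0 u es v /\ y = H + psum G es.

(** Besides the table, it keeps the best cell at [b0], [c0] and the memory behind the table empty,
    as the next area requires. *)
Definition light1_inv (b0 c0 x : Z) (s : store) : Prop :=
  Env s /\ cell s aW 0 = b0 /\ cell s aC 0 = c0 /\
  (forall i, fr + n * n <= i -> cell s aW i = 0) /\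
  forall u v, 0 <= u < n -> 0 <= v < n ->
    entry (cell s aW (fr + (u * n + v))) (cell s aC (fr + (u * n + v)))
      (path_just 0 Sz u v) (light1_done x u v).

Lemma light1_spec (s : store) (b0 c0 : Z) :
  Env s -> vars s vg = g -> vars s vFr = fr -> vars s vp0 = 0 -> vars s vL = Sz ->
  cell s aW 0 = b0 -> cell s aC 0 = c0 ->
  (forall i, fr <= i -> cell s aW i = 0) ->
  light1_inv b0 c0 lim (sem w (For vq vLim LIGHT1_BODY) s).
Proof.
  intros E Eg Ef Ep EL Eb Ec Hz.
  destruct (sem_for w (light1_inv b0 c0) vq vLim LIGHT1_BODY s) as (s' & -> & HP).
  - rewrite (e_Lim _ E). exact (below_nonneg X HX _ _ Hlim).
  - split; [exact E|]. split; [exact Eb|]. split; [exact Ec|]. split.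
    + intros i Hi. apply Hz. pose proof (below_nonneg X HX _ _ Hn). clear - Hi H0. nia.
    + intros u v Hu Hv.
      assert (C0 : cell s aW (fr + (u * n + v)) = 0) by (apply Hz; clear - Hu Hv; nia).
      rewrite C0. split; [congruence|]. intros y (es & q & Hq & _). slia.
  - intros q s' Hq IH Hfv _. rewrite (e_Lim _ E) in Hq.
    destruct IH as (E1 & I2 & I3 & I4 & I5).
    set (s1 := setv s' vq q).
    assert (E1' : Env s1) by (env_setv E1).
    assert (A : Sz <= K) by slia. assert (A' : 1 <= Sz) by slia.
    destruct (path_spec g 0 q Sz Hg ltac:(lia) A' ltac:(slia) Hq s1 E1' eq_refl)
      as (P1 & P2 & P3 & P4 & P5 & P6).
    { unfold s1; red_goal. framed Hfv Ep. }
    { unfold s1; red_goal. framed Hfv EL. }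
    { unfold s1; red_goal. framed Hfv Eg. }
    change (wp w LIGHT1_BODY (light1_inv b0 c0 (q + 1)) s1).
    apply wp_seq. unfold wp at 1.
    assert (F1 : vars (sem w PATH s1) vFr = fr).
    { rewrite sem_frame by reflexivity. unfold s1; red_goal.
      framed Hfv Ef. }
    assert (Fm : smem (sem w PATH s1) = smem s')
      by (rewrite sem_mem_frame; reflexivity).
    assert (E2 : Env (sem w PATH s1)) by (apply Env_sem; [reflexivity..|exact E1']).
    set (s2 := sem w PATH s1) in *. clearbody s2. clear s1 E1'.
    assert (Fc : forall j i, cell s2 j i = cell s' j i) by (intros; unfold cell; now rewrite Fm).
    set (u := vars s2 vst) in *. set (v := vars s2 vend) in *.
    env_eqs E2.
    assert (Bu : below X 1 u) by (below_by n).
    assert (Bv : below X 1 v) by (below_by n).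
    assert (Bk := fresh_bound2 fr u v Bfr P2 P3).
    (* Number [q] adds at most one value, the one just computed. *)
    assert (Hlast : forall u' v' y, light1_done (q + 1) u' v' y -> light1_done q u' v' y \/
      (vars s2 vok = 1 /\ u' = u /\ v' = v /\ y = vars s2 vwt)).
    { intros u' v' y (es & q' & A1 & A2 & A3 & A4 & A5).
      destruct (Z.eq_dec q' q) as [->|].
      - destruct (P6 es u' v' A2 A3 A4) as (Q1 & Q2 & Q3 & Q4).
        right. split; [exact Q1|]. split; [auto|]. split; [auto|]. now rewrite Q4.
      - left. exists es, q'. split; [slia|auto]. }
    apply wp_if.
    + red_goal; rwv; words.
    + red_goal. intros Hok. assert (Ok : vars s2 vok = 1) by (destruct P1; congruence).
      destruct (P5 Ok) as (es & Q1 & Q2 & Q3 & Q4).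
      wp_set.
      wp_set.
      wp_set.
      fold u v.
      match goal with |- wp _ _ _ ?st => set (s3 := st) end.
      assert (E3 : Env s3) by (unfold s3; env_setv E2).
      assert (Hnw : H + psum G es <> 0).
      { destruct (cwalk_weight g 0 u v es ltac:(slia) Q2) as [W0 _]. clear - W0; lia. }
      assert (R := relax_spec s3 (fr + (u * n + v)) (H + psum G es) (pcode G es)).
      destruct R as (R1 & R2 & R3).
        1-4: unfold s3; red_goal; rwv; reflexivity.
      { exact Bk. }
      { exact Hnw. }
      assert (E4 : Env (sem w RELAX s3)).
      { apply Env_relax; [exact E3|exact Bk|]. unfold s3; red_goal. exact Hnw. }
      unfold wp. set (s4 := sem w RELAX s3) in *. clearbody s4.
      assert (F3 : forall j i, cell s3 j i = cell s' j i) by (intros; apply Fc).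
      assert (Hk1 : 1 <= fr + (u * n + v)) by (clear - Hfr P2 P3; nia).
      assert (Hk2 : fr + (u * n + v) < fr + n * n) by (clear - P2 P3; nia).
      split; [exact E4|].
      split; [rewrite (proj1 (R2 0 ltac:(slia))), F3; exact I2|].
      split; [rewrite (proj2 (R2 0 ltac:(slia))), F3; exact I3|].
      split; [intros i Hi; rewrite (proj1 (R2 i ltac:(slia))), F3; auto|].
      intros u' v' Hu' Hv'.
      destruct (Z.eq_dec (fr + (u' * n + v')) (fr + (u * n + v))) as [Ek|Ek].
      * destruct (pair_key u' v' u v Hv' P3 ltac:(slia)) as [-> ->].
        eapply entry_weaken.
        { apply (R3 (path_just 0 Sz u v) (light1_done q u v)).
          - rewrite !F3. apply I5; assumption.
          - exists es. auto. }
        intros y Hy. cbn. destruct (Hlast _ _ _ Hy) as [Hy'|(_ & _ & _ & ->)]; [auto|].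
        right. rewrite Q4. slia.
      * destruct (R2 _ Ek) as [-> ->]. rewrite !F3.
        eapply entry_weaken; [apply I5; assumption|].
        intros y Hy. destruct (Hlast _ _ _ Hy) as [Hy'|(_ & -> & -> & _)]; [auto|congruence].
    + red_goal. intros Hok. apply wp_skip.
      split; [exact E2|]. rewrite !Fc. split; [exact I2|]. split; [exact I3|].
      split; [intros i Hi; rewrite Fc; auto|].
      intros u' v' Hu' Hv'. rewrite !Fc.
      eapply entry_weaken; [apply I5; assumption|].
      intros y Hy. destruct (Hlast _ _ _ Hy) as [Hy'|(? & _)]; [auto|congruence].
  - rewrite (e_Lim _ E) in HP |- *. destruct HP as (E1 & HP).
    split; [env_setv E1|exact HP].
Qed.

Definition light2_done (x y : Z) : Prop :=
  exists es u v q y1, 0 <= q < x /\ path_index' es q /\ Z.of_nat (length es) = Rz /\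
    cwalk' g Sz v es u /\ light1_done lim u v y1 /\ y = y1 + psum G es.

(** Any two halves with matching ends form a walk that respects the classes of all [K] positions, so
    no disjointness test is needed, and combining with the cheapest stored first half is optimal. *)
Lemma light2_spec (s : store) (b0 c0 : Z) (P : Z -> Prop) :
  light1_inv b0 c0 lim s ->
  vars s vg = g -> vars s vFr = fr -> vars s vp0 = Sz -> vars s vL = Rz ->
  entry b0 c0 good P ->
  let s' := sem w (For vq vLim LIGHT2_BODY) s in
  Env s' /\ (forall i, i <> 0 -> cell s' aW i = cell s aW i) /\
  entry (cell s' aW 0) (cell s' aC 0) good (fun y => P y \/ light2_done lim y).
Proof.
  intros (E & Eb & Ec & Iz & It) Eg Ef Ep EL Hent.
  set (Q := fun x s' => Env s' /\
    (forall i, i <> 0 -> cell s' aW i = cell s aW i /\ cell s' aC i = cell s aC i) /\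
    entry (cell s' aW 0) (cell s' aC 0) good (fun y => P y \/ light2_done x y)).
  destruct (sem_for w Q vq vLim LIGHT2_BODY s) as (s' & -> & HP).
  - rewrite (e_Lim _ E). exact (below_nonneg X HX _ _ Hlim).
  - split; [exact E|]. split; [auto|]. rewrite Eb, Ec. eapply entry_weaken; [exact Hent|].
    intros y [Hy|(es & u & v & q & y1 & Hq & _)]; [auto|slia].
  - intros q s' Hq IH Hfv _. rewrite (e_Lim _ E) in Hq.
    destruct IH as (E1 & I2 & I3).
    set (s1 := setv s' vq q).
    assert (E1' : Env s1) by (env_setv E1).
    assert (A1 : 1 <= Rz) by slia. assert (A2 : 0 <= Sz) by slia.
    destruct (path_spec g Sz q Rz Hg A2 A1 ltac:(slia) Hq s1 E1' eq_refl)
      as (P1 & P2 & P3 & P4 & P5 & P6).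
    { unfold s1; red_goal. framed Hfv Ep. }
    { unfold s1; red_goal. framed Hfv EL. }
    { unfold s1; red_goal. framed Hfv Eg. }
    change (wp w LIGHT2_BODY (Q (q + 1)) s1).
    apply wp_seq. unfold wp at 1.
    assert (F1 : vars (sem w PATH s1) vFr = fr).
    { rewrite sem_frame by reflexivity. unfold s1; red_goal.
      framed Hfv Ef. }
    assert (Fm : smem (sem w PATH s1) = smem s')
      by (rewrite sem_mem_frame; reflexivity).
    assert (E2 : Env (sem w PATH s1)) by (apply Env_sem; [reflexivity..|exact E1']).
    set (s2 := sem w PATH s1) in *. clearbody s2. clear s1 E1'.
    assert (Fc : forall j i, cell s2 j i = cell s' j i) by (intros; unfold cell; now rewrite Fm).
    set (v := vars s2 vst) in *. set (u := vars s2 vend) in *.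
    env_eqs E2. pose proof base_below as Hbase.
    assert (Bu : below X 1 u) by (below_by n).
    assert (Bv : below X 1 v) by (below_by n).
    assert (Bk := fresh_bound2 fr u v Bfr P3 P2).
    assert (Hpow : forall a, 0 <= a <= K -> 0 <= n ^ a <= n ^ K).
    { intros a Ha. split; [apply Z.pow_nonneg; clear - P2; lia|].
      apply Z.pow_le_mono_r; [clear - P2|clear - Ha]; lia. }
    assert (BnR : below X 1 (n ^ Rz)).
    { apply (below_le X HX _ (n ^ K)); [hyp_below|]. apply Hpow. slia. }
    assert (Bcode : below X 1 (vars s2 vcode)).
    { apply (below_le X HX _ (n ^ Rz)); [hyp_below|]. clear - P4. lia. }
    assert (Hk1 : 1 <= fr + (u * n + v)) by (clear - Hfr P2 P3; nia).
    destruct (I2 (fr + (u * n + v)) ltac:(clear - Hk1; lia)) as [Tw Tc].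
    pose proof (It u v P3 P2) as [T1 T2].
    assert (Hlast : forall y, light2_done (q + 1) y -> light2_done q y \/
      (vars s2 vok = 1 /\ exists y1, light1_done lim u v y1 /\ y = y1 + (vars s2 vwt - H))).
    { intros y (es & u' & v' & q' & y1 & A3 & A4 & A5 & A6 & A7 & A8).
      destruct (Z.eq_dec q' q) as [->|].
      - destruct (P6 es v' u' A4 A5 A6) as (Q1 & Q2 & Q3 & Q4).
        right. split; [exact Q1|]. exists y1. rewrite Q2, Q3, Q4. split; [exact A7|slia].
      - left. exists es, u', v', q', y1. split; [slia|auto]. }
    (* Nothing new arises if decoding fails or the looked-up cell is empty: by completeness of the
       table, an empty cell means that no numbered first half has these ends. *)
    assert (Hskip : (vars s2 vok = 1 -> cell s aW (fr + (u * n + v)) = 0) ->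
      forall s3, Env s3 -> smem s3 = smem s2 -> Q (q + 1) s3).
    { intros Hno s3 E3 Em.
      assert (F3 : forall j i, cell s3 j i = cell s' j i)
        by (intros; rewrite <- Fc; unfold cell; now rewrite Em).
      split; [exact E3|]. split; [intros i Hi; rewrite !F3; auto|]. rewrite !F3.
      eapply entry_weaken; [exact I3|]. intros y [Hy|Hy]; [auto|].
      destruct (Hlast y Hy) as [Hy'|(Ok & y1 & Hy1 & _)]; [auto|].
      destruct (T2 y1 Hy1) as [Hne _]. exfalso. auto. }
    apply wp_if.
    + red_goal; rwv; words.
    + red_goal. intros Hok. assert (Ok : vars s2 vok = 1) by (destruct P1; congruence).
      destruct (P5 Ok) as (es & Q1 & Q2 & Q3 & Q4).
      wp_set.
      fold u v.
      wp_set.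
      fold (cell s2 aW (fr + (u * n + v))). rewrite Fc, Tw.
      set (cur := cell s aW (fr + (u * n + v))) in *.
      apply wp_if.
      * red_goal. exact I.
      * red_goal. intros Hcur.
        destruct (T1 Hcur) as (es1 & B1 & B2 & B3 & B4).
        assert (W : cwalk' g 0 u (es1 ++ es) u).
        { apply cwalk_app. exists v. rewrite B1. auto. }
        assert (Wl : Z.of_nat (length (es1 ++ es)) = K) by (rewrite length_app; slia).
        assert (Wr := cwalk_weight g 0 u u _ (Z.eq_le_incl _ _ Wl) W).
        assert (Bc1 : below X 1 (pcode G es1)).
        { apply (below_le X HX _ (n ^ K)); [hyp_below|].
          assert (Hc1 : 0 <= pcode G es1 < n ^ Z.of_nat (length es1)).
          { apply pcode_bound. intros e He. apply cwalk_walk in B2.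
            eapply walk_edges; eauto. }
          rewrite B1 in Hc1. specialize (Hpow Sz ltac:(slia)). clear - Hc1 Hpow. lia. }
        (* Two of the three offsets make up [2 ^ w]; what remains is the offset weight of the whole
           walk, which is a word. *)
        assert (Enw : to_word w (to_word w (cur + vars s2 vwt) + H) = H + psum G (es1 ++ es)).
        { rewrite to_word_add_l, B3, Q4, psum_app.
          replace (H + psum G es1 + (H + psum G es) + H) with
            (H + (psum G es1 + psum G es) + 1 * 2 ^ Z.of_nat w) by (rewrite <- HH; ring).
          unfold to_word. rewrite Z_mod_plus_full. apply Z.mod_small.
          rewrite <- psum_app. clear - Wr. lia. }
        apply wp_seq, wp_assign; [red_goal; rwv; words|]. red_goal.
        rewrite EH. rewrite Enw.
        assert (Etc : smem s2 (base + (6 * (fr + (u * n + v)) + 5)) = pcode G es1).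
        { change (cell s2 aC (fr + (u * n + v)) = pcode G es1). rewrite Fc, Tc. exact B4. }
        apply wp_seq, wp_assign; [red_goal; rwv; rewrite ?Etc, <- ?Q3; words|].
        red_goal; rwv. rewrite Etc.
        assert (Ecode : pcode G es1 * n ^ Rz + pcode G es = pcode G (es1 ++ es)).
        { rewrite pcode_app, Q1. reflexivity. }
        rewrite Ecode.
        apply wp_seq, wp_assign; [red_goal; rwv; words|]. red_goal.
        match goal with |- wp _ _ _ ?st => set (s3 := st) end.
        assert (E3 : Env s3) by (unfold s3; env_setv E2).
        assert (Hnw : H + psum G (es1 ++ es) <> 0) by (clear - Wr; lia).
        assert (B0 : below X 8 0).
        { apply (below_mono X HX 1); [lia|]. apply (below_const X HX). lia. }
        destruct (relax_spec s3 0 (H + psum G (es1 ++ es)) (pcode G (es1 ++ es)))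
          as (R1 & R2 & R3).
        1-4: unfold s3; red_goal; rwv; reflexivity.
        { exact B0. }
        { exact Hnw. }
        assert (E4 : Env (sem w RELAX s3)).
        { apply Env_relax; [exact E3|exact B0|]. unfold s3; red_goal. exact Hnw. }
        unfold wp. set (s4 := sem w RELAX s3) in *. clearbody s4.
        assert (F3 : forall j i, cell s3 j i = cell s' j i) by (intros; apply Fc).
        split; [exact E4|]. split.
        { intros i Hi. destruct (R2 i Hi) as [-> ->]. rewrite !F3. auto. }
        eapply entry_weaken.
        { apply (R3 good (fun y => P y \/ light2_done q y)).
          - rewrite !F3. exact I3.
          - eapply cwalk_good; eauto. }
        intros y [Hy|Hy]; [auto|]. cbn.
        destruct (Hlast y Hy) as [Hy'|(_ & y1 & Hy1 & ->)]; [auto|].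
        (* [y1] comes from an arbitrary first half; the stored one is at most as heavy. *)
        right. destruct (T2 y1 Hy1) as [_ Hle].
        rewrite psum_app, Q4. rewrite B3 in Hle. clear - Hle. lia.
      * red_goal. intros Hcur. apply wp_skip. apply Hskip; [auto| |reflexivity].
        env_setv E2.
    + red_goal. intros Hok. apply wp_skip. apply Hskip; [congruence|exact E2|reflexivity].
  - rewrite (e_Lim _ E) in HP |- *. destruct HP as (E1 & HP1 & HP2).
    split; [env_setv E1|]. split; [intros i Hi; apply HP1, Hi|exact HP2].
Qed.

Notation light' := (light G deg D).

Definition light_done (y : Z) : Prop :=
  exists es u, Z.of_nat (length es) = K /\ cwalk' g 0 u es u /\ light' es /\
    y = H + psum G es.

(** The walk is cut after [Sz] edges. Its tails are light, so both parts have path numbers below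
    [lim]. *)
Lemma light_done_split (y : Z) : light_done y -> light2_done lim y.
Proof.
  intros (es & u & Hl & Hw & Hli & Hy).
  set (a := firstn (Z.to_nat Sz) es). set (b := skipn (Z.to_nat Sz) es).
  assert (Hab : es = a ++ b) by (symmetry; apply firstn_skipn).
  assert (Ha : Z.of_nat (length a) = Sz).
  { unfold a. rewrite length_firstn. clear - Hl HS HSR. lia. }
  assert (Hb : Z.of_nat (length b) = Rz).
  { unfold b. rewrite length_skipn. clear - Hl HS HSR. lia. }
  clearbody a b. subst es.
  assert (Hin : forall e, In e (a ++ b) -> 0 <= e < ne G).
  { intros e He. apply cwalk_walk in Hw. eapply walk_edges; eauto. }
  apply cwalk_app in Hw as (v & W1 & W2). rewrite Ha in W2.
  destruct (path_index_exists G deg adj D HD0 Hadjc a Sz) as (q1 & Q1 & Q1').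
  { intros ->. cbn in Ha. slia. }
  { slia. }
  { intros; apply Hin, in_or_app; auto. }
  { intros e He; apply Hli, in_or_app; auto. }
  destruct (path_index_exists G deg adj D HD0 Hadjc b Sz) as (q2 & Q2 & Q2').
  { intros ->. cbn in Hb. slia. }
  { slia. }
  { intros; apply Hin, in_or_app; auto. }
  { intros e He; apply Hli, in_or_app; auto. }
  exists b, u, v, q2, (H + psum G a).
  split; [exact Q2|]. split; [exact Q2'|]. split; [exact Hb|]. split; [exact W2|].
  split; [|rewrite Hy, psum_app; ring].
  exists a, q1. auto.
Qed.

Lemma light_spec (s : store) (P : Z -> Prop) :
  Env s -> vars s vg = g -> vars s vFr = fr ->
  (forall i, fr <= i -> cell s aW i = 0) ->
  entry (cell s aW 0) (cell s aC 0) good P ->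
  let s' := sem w LIGHT s in
  Env s' /\ vars s' vFr = fr + n * n /\
  (forall i, fr + n * n <= i -> cell s' aW i = 0) /\
  entry (cell s' aW 0) (cell s' aC 0) good (fun y => P y \/ light_done y).
Proof.
  intros E Eg Ef Hz Hent. cbn zeta. env_eqs E.
  unfold LIGHT.
  sem_set.
  sem_set.
  rewrite sem_seq.
  match goal with |- context [sem w (For vq vLim LIGHT1_BODY) ?st] => set (s0 := st) end.
  assert (E0 : Env s0) by (unfold s0; env_setv E).
  assert (L1 := light1_spec s0 _ _ E0 Eg Ef eq_refl eq_refl eq_refl eq_refl Hz).
  assert (Fv : forall y, assigned (For vq vLim LIGHT1_BODY) y = false ->
    vars (sem w (For vq vLim LIGHT1_BODY) s0) y = vars s0 y) by (intros; now apply sem_frame).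
  set (s1 := sem w (For vq vLim LIGHT1_BODY) s0) in *. clearbody s1.
  pose proof (proj1 L1) as E1. pose proof (e_S _ E1) as ES1. pose proof (e_R _ E1) as ER1.
  sem_set.
  sem_set.
  rewrite sem_seq.
  match goal with |- context [sem w (For vq vLim LIGHT2_BODY) ?st] => set (s2 := st) end.
  assert (E2 : Env s2) by (unfold s2; env_setv E1).
  destruct (light2_spec s2 (cell s0 aW 0) (cell s0 aC 0) P) as (E3 & C3 & H3).
  { split; [exact E2|apply L1]. }
  { unfold s2; red_goal. rewrite Fv by reflexivity. exact Eg. }
  { unfold s2; red_goal. rewrite Fv by reflexivity. exact Ef. }
  { reflexivity. }
  { reflexivity. }
  { exact Hent. }
  assert (F3 : vars (sem w (For vq vLim LIGHT2_BODY) s2) vFr = fr).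
  { rewrite sem_frame by reflexivity. unfold s2; red_goal. rewrite Fv by reflexivity. exact Ef. }
  set (s3 := sem w (For vq vLim LIGHT2_BODY) s2) in *. clearbody s3.
  pose proof (e_N _ E3) as EN3.
  rewrite sem_assign by (red_goal; rwv; words). red_goal; rwv.
  split; [env_setv E3|]. split; [reflexivity|]. split.
  - intros i Hi. change (cell s3 aW i = 0).
    assert (i <> 0).
    { pose proof (below_nonneg X HX _ _ Hn) as Hn0. clear - Hi Hfr Hn0. nia. }
    rewrite C3 by assumption. destruct L1 as (_ & _ & _ & Lz & _). apply Lz, Hi.
  - eapply entry_weaken; [exact H3|]. intros y [Hy|Hy]; [auto|].
    right. now apply light_done_split.
Qed.

(** * Dynamic programming from one heavy vertex *)

Section Source.
Variables h b0 c0 : Z.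
Hypothesis Hh : 0 <= h < n.

(** While level [i] is running, walks of at most [i] edges are settled, and walks of [i + 1] edges
    as far as their last edge is below [x]. *)
Definition dp_done (i x j v y : Z) : Prop :=
  exists es, Z.of_nat (length es) = j /\ cwalk' g 0 h es v /\ y = H + psum G es /\
    (j <= i \/ (j = i + 1 /\ exists a e, es = a ++ [e] /\ e < x)).

Definition dp_inv (i x : Z) (s : store) : Prop :=
  Env s /\ cell s aW 0 = b0 /\ cell s aC 0 = c0 /\
  (forall j, fr + (K + 1) * n <= j -> cell s aW j = 0) /\
  forall j v, 0 <= j <= K -> 0 <= v < n ->
    entry (cell s aW (fr + (j * n + v))) (cell s aC (fr + (j * n + v)))
      (path_just 0 j h v) (dp_done i x j v).

Lemma dp_level_spec (s : store) (i : Z) :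
  0 <= i < K -> vars s vg = g -> vars s vFr = fr -> vars s vi = i ->
  dp_inv i 0 s -> dp_inv i m (sem w (For ve vM DP_BODY) s).
Proof.
  intros Hi Eg Ef Ei Hinv. pose proof (proj1 Hinv) as E.
  destruct (sem_for w (dp_inv i) ve vM DP_BODY s) as (s' & -> & HP).
  - rewrite (e_M _ E). exact (below_nonneg X HX _ _ Hm).
  - exact Hinv.
  - clear Hinv. intros e s' He IH Hfv _. rewrite (e_M _ E) in He.
    destruct IH as (E1 & I2 & I3 & I4 & I5).
    set (s1 := setv s' ve e).
    assert (E1' : Env s1) by (env_setv E1).
    change (wp w DP_BODY (dp_inv i (e + 1)) s1).
    assert (Et := e_tail _ E1 e He). assert (Ehd := e_head _ E1 e He).
    assert (Ew := e_wt _ E1 e He).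
    assert (Hsrc := src_bound G e He). assert (Hdst := dst_bound G e He).
    fold n in Hsrc, Hdst.
    assert (G1 : vars s' vFr = fr) by (framed Hfv Ef).
    assert (G2 : vars s' vg = g) by (framed Hfv Eg).
    assert (G3 : vars s' vi = i) by (framed Hfv Ei).
    env_eqs E1. pose proof base_below as Hbase.
    set (u := src G e) in *.
    assert (Be : below X 1 e) by (below_by m).
    assert (Bi : below X 1 i) by (below_by K).
    assert (Bu : below X 1 u) by (below_by n).
    assert (Bd : below X 1 (dst G e)) by (below_by n).
    assert (Bk : below X 8 (fr + (i * n + u))) by (apply fresh_bound; [assumption|slia|assumption]).
    assert (Bk2 : below X 8 (fr + ((i + 1) * n + dst G e)))
      by (apply fresh_bound; [assumption|slia|assumption]).
    assert (T := I5 i u ltac:(slia) Hsrc). destruct T as [T1 T2].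
    set (cur := cell s' aW (fr + (i * n + u))) in *.
    (* Scanning [e] adds only walks that end in [e]; without this edge such a walk has [i] edges and
       is settled already. *)
    assert (Hlast : forall j v y, dp_done i (e + 1) j v y -> dp_done i e j v y \/
      (j = i + 1 /\ v = dst G e /\ cls K t g i (lab u) /\
       exists a, Z.of_nat (length a) = i /\ cwalk' g 0 h a u /\ y = H + psum G a + wt G e)).
    { intros j v y (es & A1 & A2 & A3 & A4).
      destruct A4 as [A4|(A4 & a & e' & A5 & A6)]; [left; exists es; auto|].
      destruct (Z.eq_dec e' e) as [->|].
      - right. rewrite A5 in A1, A2, A3. apply cwalk_snoc in A2 as (_ & W1 & W2 & W3).
        rewrite length_app in A1. cbn [length] in A1.
        assert (La : Z.of_nat (length a) = i) by (clear - A1 A4; lia).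
        rewrite La in W2. split; [exact A4|]. split; [auto|]. split; [exact W2|].
        exists a. split; [exact La|]. split; [exact W1|].
        rewrite A3, psum_app. cbn [psum]. ring.
      - left. exists es. split; [exact A1|]. split; [exact A2|]. split; [exact A3|].
        right. split; [exact A4|]. exists a, e'. split; [exact A5|slia]. }
    assert (Hskip : (cur <> 0 -> ~ cls K t g i (lab u)) ->
      forall s3, Env s3 -> smem s3 = smem s' -> dp_inv i (e + 1) s3).
    { intros Hno s3 E3 Em.
      assert (F3 : forall j x, cell s3 j x = cell s' j x)
        by (intros; unfold cell; now rewrite Em).
      split; [exact E3|]. rewrite !F3. split; [exact I2|]. split; [exact I3|].
      split; [intros j Hj; rewrite F3; auto|].
      intros j v Hj Hv. rewrite !F3. eapply entry_weaken; [apply I5; assumption|].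
      intros y Hy. destruct (Hlast j v y Hy) as [|(_ & _ & Hc & a & La & Wa & _)]; [assumption|].
      exfalso. apply Hno; [|exact Hc]. apply (T2 (H + psum G a)).
      exists a. split; [exact La|]. split; [exact Wa|]. split; [reflexivity|]. left; slia. }
    unfold s1.
    apply wp_seq, wp_assign; [red_goal; rwv; words|]. red_goal. rewrite Et.
    wp_set.
    wp_set.
    fold (cell s' aW (fr + (i * n + u))). fold cur.
    apply wp_if; [exact I| |].
    + red_goal. intros Hcur.
      destruct (T1 Hcur) as (a & A1 & A2 & A3 & A4).
      apply wp_seq, wp_assign; [exact I|]. red_goal; rwv.
      wp_set.
      replace (smem s' (base + (6 * u + 2))) with (lab u)
        by (symmetry; apply (e_lab _ E1); assumption).
      assert (Bl : below X 1 (lab u)).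
      { apply (below_le X HX _ m); [hyp_below|]. apply Hlabr; assumption. }
      match goal with |- wp _ _ _ ?st => set (s2 := st) end.
      assert (E2 : Env s2) by (unfold s2; env_setv E1).
      assert (Hc := check_spec s2 g i (lab u) E2 G2 eq_refl eq_refl Hg Hi Bl).
      cbn zeta in Hc. apply wp_seq. unfold wp at 1.
      assert (Fv : forall y, assigned CHECK y = false -> vars (sem w CHECK s2) y = vars s2 y)
        by (intros; now apply sem_frame).
      assert (Fm : smem (sem w CHECK s2) = smem s') by (apply (sem_mem_frame w CHECK s2); reflexivity).
      assert (E3 : Env (sem w CHECK s2)) by (apply Env_sem; [reflexivity..|exact E2]).
      set (s3 := sem w CHECK s2) in *.
      assert (V1 : vars s3 ve = e) by (rewrite Fv; reflexivity).
      assert (V2 : vars s3 vcur = cur) by (rewrite Fv; reflexivity).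
      assert (V3 : vars s3 vkey = fr + (i * n + u)) by (rewrite Fv; reflexivity).
      assert (V4 : vars s3 vu = u) by (rewrite Fv; reflexivity).
      assert (V5 : vars s3 vi = i) by (rewrite Fv; [exact G3|reflexivity]).
      assert (V6 : vars s3 vFr = fr) by (rewrite Fv; [exact G1|reflexivity]).
      pose proof (e_N _ E3) as V7. pose proof (e_Base _ E3) as V8.
      clearbody s3.
      apply wp_if; [exact I| |].
      * red_goal. intros Hok.
        assert (Hcl : cls K t g i (lab u)) by (destruct Hc as [[_ Hc]|[Hc _]]; [exact Hc|congruence]).
        assert (W : cwalk' g 0 h (a ++ [e]) (dst G e)).
        { apply cwalk_snoc. rewrite A1. auto. }
        assert (Wl : Z.of_nat (length (a ++ [e])) = i + 1)
          by (rewrite length_app; cbn [length]; clear - A1; lia).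
        assert (Wr := cwalk_weight g 0 h _ (a ++ [e]) ltac:(slia) W).
        assert (Bc1 : below X 1 (pcode G a)).
        { apply (below_le X HX _ (n ^ K)); [hyp_below|].
          assert (Hc1 : 0 <= pcode G a < n ^ Z.of_nat (length a)).
          { apply pcode_bound. intros x Hx. apply cwalk_walk in A2.
            eapply walk_edges; eauto. }
          rewrite A1 in Hc1.
          assert (n ^ i <= n ^ K) by (apply Z.pow_le_mono_r; [clear - Hsrc|clear - Hi]; lia).
          clear - Hc1 H0. lia. }
        assert (Enw : to_word w (cur + to_word w (wt G e)) = H + psum G (a ++ [e])).
        { rewrite to_word_add_r, A3.
          replace (H + psum G a + wt G e) with (H + psum G (a ++ [e]))
            by (rewrite psum_app; cbn [psum]; ring).
          apply to_word_small. unfold word. clear - Wr. lia. }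
        wp_set.
        rewrite Fm, Ew, Enw.
        assert (Etc : smem s' (base + (6 * (fr + (i * n + u)) + 5)) = pcode G a) by exact A4.
        apply wp_seq, wp_assign; [red_goal; rwv; rewrite ?Fm, ?Etc; words|].
        red_goal; rwv. rewrite Fm, Etc.
        replace (pcode G a * n + u) with (pcode G (a ++ [e])) by (apply pcode_snoc).
        apply wp_seq, wp_assign; [red_goal; rwv; rewrite ?Fm, ?Ehd; words|].
        red_goal; rwv. rewrite Fm, Ehd.
        match goal with |- wp _ _ _ ?st => set (s4 := st) end.
        assert (E4 : Env s4) by (unfold s4; env_setv E3).
        assert (Hnw : H + psum G (a ++ [e]) <> 0) by (clear - Wr; lia).
        destruct (relax_spec s4 (fr + ((i + 1) * n + dst G e)) (H + psum G (a ++ [e]))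
          (pcode G (a ++ [e]))) as (R1 & R2 & R3).
        1-4: unfold s4; red_goal; rwv; reflexivity.
        { exact Bk2. }
        { exact Hnw. }
        assert (E5 : Env (sem w RELAX s4)).
        { apply Env_relax; [exact E4|exact Bk2|]. unfold s4; red_goal. exact Hnw. }
        unfold wp. set (s5 := sem w RELAX s4) in *. clearbody s5.
        assert (F4 : forall j x, cell s4 j x = cell s' j x)
          by (intros; unfold cell; change (smem s4) with (smem s3); now rewrite Fm).
        assert (Hk1 : 1 <= fr + ((i + 1) * n + dst G e)) by (clear - Hfr Hi Hdst; nia).
        assert (Hk2 : fr + ((i + 1) * n + dst G e) < fr + (K + 1) * n) by (clear - Hi Hdst; nia).
        split; [exact E5|].
        split; [rewrite (proj1 (R2 0 ltac:(slia))), F4; exact I2|].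
        split; [rewrite (proj2 (R2 0 ltac:(slia))), F4; exact I3|].
        split; [intros j Hj; rewrite (proj1 (R2 j ltac:(slia))), F4; auto|].
        intros j v Hj Hv.
        destruct (Z.eq_dec (fr + (j * n + v)) (fr + ((i + 1) * n + dst G e))) as [Ek|Ek].
        -- destruct (pair_key j v (i + 1) (dst G e) Hv Hdst ltac:(slia)) as [-> ->].
           eapply entry_weaken.
           { apply (R3 (path_just 0 (i + 1) h (dst G e)) (dp_done i e (i + 1) (dst G e))).
             - rewrite !F4. apply I5; assumption.
             - exists (a ++ [e]). auto. }
           intros y Hy. cbn.
           destruct (Hlast _ _ _ Hy) as [Hy'|(_ & _ & _ & a' & La & Wa & ->)]; [auto|].
           (* The walk stored for [u] in layer [i] is at most as heavy as [a'], and both are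
              extended by the same edge. *)
           right. destruct (T2 (H + psum G a')) as [_ Hle].
           { exists a'. split; [exact La|]. split; [exact Wa|]. split; [reflexivity|]. left; slia. }
           rewrite A3 in Hle. rewrite psum_app. cbn [psum]. clear - Hle. lia.
        -- destruct (R2 _ Ek) as [-> ->]. rewrite !F4.
           eapply entry_weaken; [apply I5; assumption|].
           intros y Hy. destruct (Hlast _ _ _ Hy) as [Hy'|(-> & -> & _)]; [auto|congruence].
      * red_goal. intros Hok. apply wp_skip. apply Hskip; [|exact E3|exact Fm].
        intros _. destruct Hc as [[Hc _]|[_ Hc]]; [congruence|exact Hc].
    + red_goal. intros Hcur. apply wp_skip. apply Hskip; [congruence| |reflexivity].
      env_setv E1.
  - rewrite (e_M _ E) in HP |- *. destruct HP as (E1 & HP).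
    split; [env_setv E1|exact HP].
Qed.

Lemma dp_inv_setv (i x : Z) (s : store) (y : nat) (z : Z) :
  (15 <= y)%nat -> dp_inv i x s -> dp_inv i x (setv s y z).
Proof. intros Hy [E I]. split; [now apply Env_setv|exact I]. Qed.

(** Every last edge is below [m], so a full scan settles the walks of [i + 1] edges; a level just
    begun adds nothing, since no edge is below 0. *)
Lemma dp_inv_next (i : Z) (s : store) : 0 <= i -> dp_inv i m s -> dp_inv (i + 1) 0 s.
Proof.
  intros Hi (E & I2 & I3 & I4 & I5). split; [exact E|]. split; [exact I2|].
  split; [exact I3|]. split; [exact I4|]. intros j v Hj Hv.
  eapply entry_weaken; [apply I5; assumption|].
  intros y (es & A1 & A2 & A3 & A4). exists es.
  split; [exact A1|]. split; [exact A2|]. split; [exact A3|].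
  assert (Hin : forall e, In e es -> 0 <= e < m).
  { intros e He. apply cwalk_walk in A2. eapply walk_edges; eauto. }
  destruct A4 as [A4|(_ & a & e & -> & He)].
  - destruct (Z.eq_dec j (i + 1)) as [->|]; [right|left; slia]. split; [reflexivity|].
    destruct es as [|x es _] using rev_ind; [cbn in A1; slia|].
    exists es, x. split; [reflexivity|]. apply Hin, in_or_app. right; now left.
  - assert (0 <= e < m) by (apply Hin, in_or_app; right; now left). slia.
Qed.

Lemma dp_spec (s : store) :
  vars s vg = g -> vars s vFr = fr -> dp_inv 0 0 s ->
  dp_inv K 0 (sem w (For vi vK (For ve vM DP_BODY)) s).
Proof.
  intros Eg Ef Hinv. pose proof (proj1 Hinv) as E.
  destruct (sem_for w (fun i s' => dp_inv i 0 s') vi vK (For ve vM DP_BODY) s)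
    as (s' & -> & HP).
  - rewrite (e_K _ E). exact (below_nonneg X HX _ _ HK).
  - exact Hinv.
  - intros i s' Hi IH Hfv _. rewrite (e_K _ E) in Hi.
    apply dp_inv_next; [slia|]. apply dp_level_spec; [exact Hi| | |reflexivity|].
    + red_goal. framed Hfv Eg.
    + red_goal. framed Hfv Ef.
    + apply dp_inv_setv; [lia|exact IH].
  - rewrite (e_K _ E) in HP |- *. apply dp_inv_setv; [lia|exact HP].
Qed.

End Source.

Definition heavy_done (h y : Z) : Prop :=
  exists es, Z.of_nat (length es) = K /\ cwalk' g 0 h es h /\ y = H + psum G es.

Lemma heavy_body_spec (s : store) (hi : Z) (P : Z -> Prop) :
  Env s -> vars s vg = g -> vars s vFr = fr -> vars s vhi = hi -> 0 <= hi < nh ->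
  (forall i, fr <= i -> cell s aW i = 0) ->
  entry (cell s aW 0) (cell s aC 0) good P ->
  let s' := sem w HEAVY_BODY s in
  Env s' /\ vars s' vFr = fr + (K + 1) * n /\
  (forall i, fr + (K + 1) * n <= i -> cell s' aW i = 0) /\
  entry (cell s' aW 0) (cell s' aC 0) good (fun y => P y \/ heavy_done (hv hi) y).
Proof.
  intros E Eg Ef Ehi Hhi Hz Hent. pose proof base_below as Hbase. env_eqs E.
  set (Q := fun s' => Env s' /\ vars s' vFr = fr + (K + 1) * n /\
    (forall i, fr + (K + 1) * n <= i -> cell s' aW i = 0) /\
    entry (cell s' aW 0) (cell s' aC 0) good (fun y => P y \/ heavy_done (hv hi) y)).
  change (wp w HEAVY_BODY Q s).
  assert (Bhi : below X 1 hi) by (below_by nh).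
  assert (Hh := Hhv hi Hhi).
  wp_set.
  replace (smem s (base + (6 * hi + 3))) with (hv hi) by (symmetry; apply (e_hv _ E); assumption).
  set (h := hv hi) in *.
  assert (Bh : below X 1 h) by (below_by n).
  apply wp_seq, wp_store; [red_goal; rwv; words..|]. red_goal; rwv.
  apply wp_seq, wp_store; [red_goal; rwv; words..|]. red_goal; rwv.
  match goal with |- wp _ _ _ ?st => set (s1 := st) end.
  assert (C1 : forall x j, 0 <= j < 6 -> cell s1 j x =
      if (x =? fr + h) && (j =? 4) then H else if (x =? fr + h) && (j =? 5) then 0
      else cell s j x).
  { intros x j Hj. unfold s1, cell, set_mem. cbn [smem]. clear - Hj.
    destruct (Z.eqb_spec x (fr + h)), (Z.eqb_spec j 4), (Z.eqb_spec j 5); cbn [andb]; subst;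
      repeat match goal with |- context [(?a =? ?b)] => destruct (Z.eqb_spec a b) end;
      try reflexivity; lia. }
  assert (E1 : Env s1).
  { apply (Env_frame (setv s vh h)); [env_setv E| |].
    - intros y _. reflexivity.
    - intros a Ha. unfold s1. cbn [smem setv]. unfold set_mem.
      clear - Ha Hh Hfr. destruct Ha as [Ha|(x & j & -> & Hj)];
        repeat match goal with |- context [(?a =? ?b)] => destruct (Z.eqb_spec a b) end;
        try reflexivity; lia. }
  assert (G1 : vars s1 vg = g) by exact Eg.
  assert (G2 : vars s1 vFr = fr) by exact Ef.
  assert (G3 : vars s1 vh = h) by reflexivity.
  assert (C0 : forall x, x <> fr + h -> cell s1 aW x = cell s aW x /\ cell s1 aC x = cell s aC x).
  { intros x Hx. rewrite !C1 by lia. rewrite (proj2 (Z.eqb_neq _ _) Hx). auto. }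
  assert (Cw : cell s1 aW (fr + h) = H) by (rewrite C1 by lia; now rewrite Z.eqb_refl).
  assert (Cc : cell s1 aC (fr + h) = 0) by (rewrite C1 by lia; now rewrite Z.eqb_refl).
  clearbody s1. clear C1.
  assert (Hdp : dp_inv h (cell s aW 0) (cell s aC 0) 0 0 s1).
  { split; [exact E1|].
    destruct (C0 0 ltac:(clear - Hh Hfr; lia)) as [-> ->].
    split; [reflexivity|]. split; [reflexivity|]. split.
    - intros j Hj. assert (fr + h < j).
      { pose proof (below_nonneg X HX _ _ HK) as HK0. clear - Hj Hh HK0. nia. }
      rewrite (proj1 (C0 j ltac:(slia))). apply Hz. slia.
    - intros j v Hj Hv.
      (* At the start only the empty walk at [h] is accounted for, as no last edge is below 0. *)
      assert (Hd0 : forall y, dp_done h 0 0 j v y -> j = 0 /\ v = h /\ y = H).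
      { intros y (es & A1 & A2 & A3 & A4).
        destruct A4 as [A4|(_ & a & e & -> & He)].
        - destruct es; [|cbn in A1; slia]. cbn in *. split; [auto|]. split; [auto|]. lia.
        - apply cwalk_walk in A2.
          assert (0 <= e < ne G) by (eapply walk_edges; [exact A2|apply in_or_app; right; now left]).
          slia. }
      destruct (Z.eq_dec (fr + (j * n + v)) (fr + h)) as [Ek|Ek].
      + destruct (pair_key j v 0 h Hv Hh ltac:(slia)) as [-> ->]. rewrite Ek, Cw, Cc.
        split.
        * intros _. exists []. cbn. repeat split; auto; lia.
        * intros y Hy. destruct (Hd0 y Hy) as (_ & _ & ->). split; [|lia].
          assert (0 < 2 ^ Z.of_nat w) by (apply Z.pow_pos_nonneg; lia). clear - HH H0. lia.
      + destruct (C0 _ Ek) as [-> _]. rewrite Hz by (clear - Hj Hv; nia).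
        split; [congruence|]. intros y Hy. destruct (Hd0 y Hy) as (-> & -> & _).
        exfalso. apply Ek. ring. }
  apply wp_seq. unfold wp at 1.
  assert (H2 := dp_spec h (cell s aW 0) (cell s aC 0) s1 G1 G2 Hdp).
  assert (Fv : forall y, assigned (For vi vK (For ve vM DP_BODY)) y = false ->
    vars (sem w (For vi vK (For ve vM DP_BODY)) s1) y = vars s1 y)
    by (intros; now apply sem_frame).
  set (s2 := sem w (For vi vK (For ve vM DP_BODY)) s1) in *.
  assert (V1 : vars s2 vFr = fr) by (rewrite Fv; [exact G2|reflexivity]).
  assert (V2 : vars s2 vh = h) by (rewrite Fv; [exact G3|reflexivity]).
  clearbody s2. clear Fv Hdp.
  destruct H2 as (E2 & I2 & I3 & I4 & I5).
  pose proof (e_N _ E2) as EN2. pose proof (e_K _ E2) as EK2. pose proof (e_Base _ E2) as EB2.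
  assert (Bk : below X 8 (fr + (K * n + h))) by (apply fresh_bound; [assumption|slia|assumption]).
  destruct (I5 K h ltac:(slia) Hh) as [T1 T2].
  wp_set.
  wp_set.
  fold (cell s2 aW (fr + (K * n + h))). set (cur := cell s2 aW (fr + (K * n + h))) in *.
  (* Both branches of the following conditional end with the same update of [vFr], which is treated
     once here. *)
  assert (Hfin : forall s3, Env s3 -> vars s3 vFr = fr ->
    (forall i, fr + (K + 1) * n <= i -> cell s3 aW i = 0) ->
    entry (cell s3 aW 0) (cell s3 aC 0) good (fun y => P y \/ heavy_done (hv hi) y) ->
    wp w (vFr ::= V vFr + (V vK + Num 1) * V vN) Q s3).
  { intros s3 E3 F3 Z3 H3. pose proof (e_N _ E3). pose proof (e_K _ E3).
    apply wp_assign; [red_goal; rwv; words|]. red_goal; rwv.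
    split; [env_setv E3|]. split; [reflexivity|]. split; [exact Z3|exact H3]. }
  assert (Hdone : forall y, heavy_done (hv hi) y -> dp_done h K 0 K h y).
  { intros y (es & A1 & A2 & A3). exists es. split; [exact A1|]. split; [exact A2|].
    split; [exact A3|]. left; slia. }
  apply wp_seq, wp_if; [exact I| |].
  - red_goal. intros Hcur. destruct (T1 Hcur) as (es & A1 & A2 & A3 & A4).
    wp_set.
    fold (cell s2 aC (fr + (K * n + h))).
    wp_set.
    match goal with |- wp _ _ _ ?st => set (s3 := st) end.
    assert (E3 : Env s3) by (unfold s3; env_setv E2).
    assert (B0 : below X 8 0).
    { apply (below_mono X HX 1); [lia|]. apply (below_const X HX). lia. }
    destruct (relax_spec s3 0 cur (cell s2 aC (fr + (K * n + h)))) as (R1 & R2 & R3).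
        1-4: unfold s3; red_goal; rwv; reflexivity.
    { exact B0. }
    { exact Hcur. }
    assert (E4 : Env (sem w RELAX s3)).
    { apply Env_relax; [exact E3|exact B0|]. unfold s3; red_goal. exact Hcur. }
    unfold wp at 1.
    assert (F4 : vars (sem w RELAX s3) vFr = fr) by (rewrite sem_frame; [exact V1|reflexivity]).
    set (s4 := sem w RELAX s3) in *. clearbody s4.
    assert (F3 : forall j i, cell s3 j i = cell s2 j i) by reflexivity.
    apply Hfin; [exact E4|exact F4| |].
    + intros i Hi'. assert (i <> 0).
      { pose proof (below_nonneg X HX _ _ HK) as HK0. clear - Hi' Hh Hfr HK0. nia. }
      rewrite (proj1 (R2 i ltac:(assumption))), F3. auto.
    + eapply entry_weaken.
      { apply (R3 good P); [rewrite !F3, I2, I3; exact Hent|].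
        rewrite A4. rewrite A3. eapply cwalk_good; eauto. }
      intros y [Hy|Hy]; [auto|]. right. apply T2. auto.
  - red_goal. intros Hcur. apply wp_skip. apply Hfin; [|exact V1|exact I4|].
    + env_setv E2.
    + change (entry (cell s2 aW 0) (cell s2 aC 0) good (fun y => P y \/ heavy_done (hv hi) y)).
      rewrite I2, I3. eapply entry_weaken; [exact Hent|].
      intros y [Hy|Hy]; [auto|]. destruct (T2 y (Hdone y Hy)). congruence.
Qed.

End Guess.

(** * All heavy sources and all guesses *)

Let block := (K + 1) * n.

Lemma heavy_spec (s : store) (g fr : Z) (P : Z -> Prop) :
  0 <= g < glim -> 1 <= fr -> below X 7 (fr + nh * block) ->
  Env s -> vars s vg = g -> vars s vFr = fr ->
  (forall i, fr <= i -> cell s aW i = 0) ->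
  entry (cell s aW 0) (cell s aC 0) good P ->
  let s' := sem w HEAVY s in
  Env s' /\ vars s' vFr = fr + nh * block /\
  (forall i, fr + nh * block <= i -> cell s' aW i = 0) /\
  entry (cell s' aW 0) (cell s' aC 0) good
    (fun y => P y \/ exists i, 0 <= i < nh /\ heavy_done g (hv i) y).
Proof.
  intros Hg Hfr Bfr E Eg Ef Hz Hent.
  assert (Hbl : 0 <= block).
  { pose proof (below_nonneg X HX _ _ HK). pose proof (below_nonneg X HX _ _ Hn).
    unfold block. apply Z.mul_nonneg_nonneg; slia. }
  assert (Hnh0 := below_nonneg X HX _ _ Hnh).
  unfold HEAVY. cbn zeta.
  destruct (sem_for w (fun hi s' => Env s' /\ vars s' vFr = fr + hi * block /\
    (forall i, fr + hi * block <= i -> cell s' aW i = 0) /\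
    entry (cell s' aW 0) (cell s' aC 0) good
      (fun y => P y \/ exists i, 0 <= i < hi /\ heavy_done g (hv i) y))
    vhi vNh HEAVY_BODY s) as (s' & -> & HP).
  - rewrite (e_Nh _ E). exact Hnh0.
  - rewrite Z.mul_0_l, Z.add_0_r. split; [exact E|]. split; [exact Ef|]. split; [exact Hz|].
    eapply entry_weaken; [exact Hent|]. intros y [Hy|(i & Hi & _)]; [exact Hy|slia].
  - intros hi s' Hhi (E1 & I1 & I2 & I3) Hfv _. rewrite (e_Nh _ E) in Hhi.
    assert (Hle : 0 <= hi * block <= nh * block).
    { clear - Hhi Hbl. split; [apply Z.mul_nonneg_nonneg; lia|apply Z.mul_le_mono_nonneg_r; lia]. }
    assert (Hf1 : 1 <= fr + hi * block) by slia.
    assert (Bf1 : below X 7 (fr + hi * block)) by (apply (below_le X HX _ _ _ Bfr); slia).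
    destruct (heavy_body_spec g (fr + hi * block) Hg Hf1 Bf1 (setv s' vhi hi) hi
      (fun y => P y \/ exists i, 0 <= i < hi /\ heavy_done g (hv i) y))
      as (A1 & A2 & A3 & A4).
    + env_setv E1.
    + red_goal. framed Hfv Eg.
    + exact I1.
    + reflexivity.
    + exact Hhi.
    + exact I2.
    + exact I3.
    + replace (fr + (hi + 1) * block) with (fr + hi * block + (K + 1) * n)
        by (unfold block; ring).
      split; [exact A1|]. split; [exact A2|]. split; [exact A3|].
      eapply entry_weaken; [exact A4|]. intros y [Hy|(i & Hi & Hy)]; [auto|].
      destruct (Z.eq_dec i hi) as [->|]; [auto|]. left; right. exists i. split; [slia|exact Hy].
  - rewrite (e_Nh _ E) in HP |- *. destruct HP as (E1 & HP).
    split; [env_setv E1|exact HP].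
Qed.

Definition found (g y : Z) : Prop :=
  light_done g y \/ exists i, 0 <= i < nh /\ heavy_done g (hv i) y.

(** A walk with light tails only is found as it stands. Any other is rotated to start at a heavy
    tail; this keeps weight and distinctness but shifts the positions, so the guess is chosen for
    the rotated walk. *)
Lemma closed_walk_found (es : list Z) (u : Z) :
  Z.of_nat (length es) = K -> walk G u es u -> NoDup (map (src G) es) ->
  exists g, 0 <= g < glim /\ found g (H + psum G es).
Proof.
  intros Hl Hw Hd.
  destruct (classic (light G deg D es)) as [Hli|Hli].
  - destruct (cwalk_exists G K t lab Ht Hm2t Hlab u u es Hl Hd Hw) as (g & Hg & Hc).
    exists g. split; [exact Hg|]. left. exists es, u. auto.
  - assert (Hex : exists e, In e es /\ D < deg (src G e)).
    { apply NNPP. intros Hno. apply Hli. intros e He.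
      destruct (Z_le_gt_dec (deg (src G e)) D) as [|Hgt]; [assumption|].
      exfalso. apply Hno. exists e. split; [exact He|slia]. }
    destruct Hex as (e & He & Hde).
    apply in_split in He as (a & b & ->).
    destruct (walk_rotate G a (e :: b) u Hw) as (x & Hx).
    assert (Ex : src G e = x) by (apply Hx).
    assert (Her : 0 <= e < ne G) by (eapply walk_edges; [exact Hx|now left]).
    assert (Hl' : Z.of_nat (length ((e :: b) ++ a)) = K)
      by (rewrite <- Hl, !length_app; clear; lia).
    assert (Hd' : NoDup (map (src G) ((e :: b) ++ a))).
    { eapply Permutation_NoDup; [|exact Hd]. apply Permutation_map, Permutation_app_comm. }
    destruct (cwalk_exists G K t lab Ht Hm2t Hlab x x _ Hl' Hd' Hx) as (g & Hg & Hc).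
    destruct (Hhvc (src G e) (src_bound G e Her) Hde) as (i & Hi & Hhi).
    exists g. split; [exact Hg|]. right. exists i. split; [exact Hi|].
    exists ((e :: b) ++ a). rewrite Hhi, Ex. split; [exact Hl'|]. split; [exact Hc|].
    rewrite !psum_app. ring.
Qed.

Lemma main_spec (s : store) :
  Env s -> vars s vFr = 1 -> (forall i, 0 <= i -> cell s aW i = 0) ->
  let s' := sem w MAIN s in
  Env s' /\ entry (cell s' aW 0) (cell s' aC 0) good
    (fun y => exists es u, Z.of_nat (length es) = K /\ walk G u es u /\
      NoDup (map (src G) es) /\ y = H + psum G es).
Proof.
  intros E Ef Hz. cbn zeta.
  set (per := n * n + nh * block).
  assert (Hn0 := below_nonneg X HX _ _ Hn). assert (HK0 := below_nonneg X HX _ _ HK).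
  assert (Hnh0 := below_nonneg X HX _ _ Hnh).
  assert (Hbl : 0 <= nh * block)
    by (apply Z.mul_nonneg_nonneg; [exact Hnh0|apply Z.mul_nonneg_nonneg; slia]).
  assert (Hnn : 0 <= n * n) by (apply Z.mul_nonneg_nonneg; exact Hn0).
  (* All areas ever opened, [per] cells for each guess. This bounds [vFr] at all times and is the
     origin of the exponent 7. *)
  assert (Bper : below X 7 (1 + glim * per)).
  { unfold per, block. eapply (below_mono X HX); [|bd HX]. cbn. lia. }
  unfold MAIN.
  destruct (sem_for w (fun g s' => Env s' /\ vars s' vFr = 1 + g * per /\
    (forall i, 1 + g * per <= i -> cell s' aW i = 0) /\
    entry (cell s' aW 0) (cell s' aC 0) good
      (fun y => exists g', 0 <= g' < g /\ found g' y))
    vg vG (LIGHT ;; HEAVY) s) as (s' & -> & HP).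
  - rewrite (e_G _ E). exact (below_nonneg X HX _ _ Hglim).
  - rewrite Z.mul_0_l, Z.add_0_r. split; [exact E|]. split; [exact Ef|].
    split; [intros i Hi; apply Hz; clear - Hi; lia|].
    rewrite (Hz 0) by lia. split; [congruence|]. intros y (g' & Hg' & _). clear - Hg'. lia.
  - intros g s' Hg (E1 & I1 & I2 & I3) _ _. rewrite (e_G _ E) in Hg.
    assert (Hper : 0 <= g * per /\ g * per + per <= glim * per).
    { unfold per in *. clear - Hg Hbl Hnn. nia. }
    assert (Hper' : per = n * n + nh * block) by reflexivity.
    assert (Bf1 : below X 7 (1 + g * per)) by (apply (below_le X HX _ _ _ Bper); clear - Hper Hper' Hbl Hnn; lia).
    assert (Hf1 : 1 <= 1 + g * per) by (clear - Hper; lia).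
    destruct (light_spec g (1 + g * per) Hg Hf1 Bf1
      (setv s' vg g) (fun y => exists g', 0 <= g' < g /\ found g' y)) as (A1 & A2 & A3 & A4).
    + env_setv E1.
    + reflexivity.
    + exact I1.
    + exact I2.
    + exact I3.
    + rewrite sem_seq.
      assert (Gg : vars (sem w LIGHT (setv s' vg g)) vg = g) by (rewrite sem_frame; reflexivity).
      set (s1 := sem w LIGHT (setv s' vg g)) in *. clearbody s1.
      assert (Hf2 : 1 <= 1 + g * per + n * n) by (clear - Hper Hnn; lia).
      assert (Bf2 : below X 7 (1 + g * per + n * n + nh * block))
        by (apply (below_le X HX _ _ _ Bper); clear - Hper Hper' Hbl Hnn; lia).
      destruct (heavy_spec s1 g (1 + g * per + n * n)
        (fun y => (exists g', 0 <= g' < g /\ found g' y) \/ light_done g y) Hg Hf2 Bf2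
        A1 Gg A2 A3 A4) as (B1 & B2 & B3 & B4).
      replace (1 + (g + 1) * per) with (1 + g * per + n * n + nh * block)
        by (unfold per; ring).
      split; [exact B1|]. split; [exact B2|]. split; [exact B3|].
      eapply entry_weaken; [exact B4|]. intros y (g' & Hg' & Hy).
      destruct (Z.eq_dec g' g) as [->|].
      * destruct Hy as [Hy|Hy]; auto.
      * left; left. exists g'. split; [clear - Hg' n0; lia|exact Hy].
  - rewrite (e_G _ E) in HP |- *. destruct HP as (E1 & _ & _ & HP).
    split; [env_setv E1|].
    eapply entry_weaken; [exact HP|]. intros y (es & u & Hl & Hw & Hd & ->).
    apply (closed_walk_found es u); assumption.
Qed.

End Main.

(** * Thresholds computed from the number of edges *)

Section Thresholds.
Open Scope Z_scope.

Definition root_step (s m d : Z) : Z := if d ^ s <? m then d + 1 else d.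

(* The least [d >= 1] with [m <= d ^ s]. *)
Definition root (s : Z) (m : nat) : Z := Nat.iter m (root_step s (Z.of_nat m)) 1.

Definition loglog_step (m t : Z) : Z := if m <? 2 ^ 2 ^ t then t else t + 1.

(* The least [t >= 0] with [m < 2 ^ 2 ^ t]. *)
Definition loglog (m : nat) : Z := Nat.iter m (loglog_step (Z.of_nat m)) 0.

Lemma iter_S (A : Type) (f : A -> A) (i : nat) (x : A) :
  Nat.iter (S i) f x = f (Nat.iter i f x).
Proof. reflexivity. Qed.

(** Either every round has raised the value, which is then [i + 1], or the goal has been reached. An
    increment happens only when the former value was too small, which gives minimality. *)
Lemma root_iter (s m : Z) (i : nat) :
  let d := Nat.iter i (root_step s m) 1 in
  1 <= d <= Z.of_nat i + 1 /\ (d = 1 \/ (d - 1) ^ s < m) /\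
  (d = Z.of_nat i + 1 \/ m <= d ^ s).
Proof.
  induction i as [|i IH]; cbn zeta.
  - cbn. lia.
  - cbn zeta in IH. rewrite iter_S. set (d := Nat.iter i _ _) in *.
    unfold root_step. destruct (Z.ltb_spec (d ^ s) m) as [Hl|Hl].
    + replace (d + 1 - 1) with d by lia. lia.
    + lia.
Qed.

Lemma root_spec (s : Z) (m : nat) : 1 <= s ->
  1 <= root s m <= Z.of_nat m + 1 /\ (root s m = 1 \/ (root s m - 1) ^ s < Z.of_nat m) /\
  Z.of_nat m <= root s m ^ s.
Proof.
  intros Hs. destruct (root_iter s (Z.of_nat m) m) as (H1 & H2 & H3). fold (root s m) in *.
  split; [auto|split; [auto|]]. destruct H3 as [H3|H3]; [|auto].
  (* If all [m] rounds raised the value, it is [m + 1], and its [s]-th power is at least itself. *)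
  pose proof (Z.pow_le_mono_r (root s m) 1 s). rewrite Z.pow_1_r in H. lia.
Qed.

Lemma loglog_iter (m : Z) (i : nat) :
  let t := Nat.iter i (loglog_step m) 0 in
  0 <= t <= Z.of_nat i /\ (t = 0 \/ 2 ^ 2 ^ (t - 1) <= m) /\
  (t = Z.of_nat i \/ m < 2 ^ 2 ^ t).
Proof.
  induction i as [|i IH]; cbn zeta.
  - cbn [Nat.iter]. cbn. lia.
  - cbn zeta in IH. rewrite iter_S. set (t := Nat.iter i _ _) in *.
    unfold loglog_step. destruct (Z.ltb_spec m (2 ^ 2 ^ t)) as [Hl|Hl].
    + lia.
    + replace (t + 1 - 1) with t by lia. lia.
Qed.

Lemma loglog_spec (m : nat) :
  0 <= loglog m /\ (loglog m = 0 \/ 2 ^ 2 ^ (loglog m - 1) <= Z.of_nat m) /\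
  Z.of_nat m < 2 ^ 2 ^ loglog m.
Proof.
  destruct (loglog_iter (Z.of_nat m) m) as (H1 & H2 & H3). fold (loglog m) in *.
  split; [lia|split; [auto|]]. destruct H3 as [H3|H3]; [|auto].
  assert (A : forall x, 0 <= x -> x < 2 ^ x) by (intros; apply Z.pow_gt_lin_r; lia).
  rewrite H3. pose proof (A (Z.of_nat m)). pose proof (A (2 ^ Z.of_nat m)). lia.
Qed.

(** [2 ^ 2 ^ t] is the square of its predecessor, which is at most [m]; the summand 2 covers
    [t = 0]. Thus the double power formed in [LOGLOG] stays polynomial in m. *)
Lemma pow_pow_step (m t : Z) :
  0 <= m -> 0 <= t -> t = 0 \/ 2 ^ 2 ^ (t - 1) <= m -> 2 ^ 2 ^ t <= m * m + 2.
Proof.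
  intros Hm Ht [->|H]; [cbn; nia|].
  destruct (Z.eq_dec t 0) as [->|]; [cbn; nia|].
  replace (2 ^ 2 ^ t) with (2 ^ 2 ^ (t - 1) * 2 ^ 2 ^ (t - 1)).
  - assert (0 <= 2 ^ 2 ^ (t - 1)) by (apply Z.pow_nonneg; lia). nia.
  - rewrite <- Z.pow_add_r by (apply Z.pow_nonneg; lia). f_equal.
    replace t with (Z.succ (t - 1)) at 3 by lia. rewrite Z.pow_succ_r by lia. lia.
Qed.

End Thresholds.

(** * Initialisation, adjacency lists and output *)

(** Indexed by variables; only k and m enter, not n. [vL] successively takes the values of [vS] and
    [vR], both at most [k]. *)
Definition limit_bound (k m l : nat) : nat :=
  let s := Nat.div2 (k + 1) in
  match l with
  | vM => m
  | vK => k
  | vS => s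
  | vR => k - s
  | vG => Z.to_nat (2 ^ ((loglog m + 1) * (Z.of_nat k * Z.of_nat k)))
  | vLim => Z.to_nat (Z.of_nat m * root (Z.of_nat s) m ^ (Z.of_nat s - 1))
  | vNh => Z.to_nat (Z.of_nat m / root (Z.of_nat s) m)
  | vL => k
  | _ => 0
  end.

Definition prog_time (k m : nat) : nat :=
  let tb := time_bound (limit_bound k m) in
  tb (LOAD k) + (tb SETUP + (tb CONSTS + (tb EDGES + (tb MAIN + tb OUTPUT)))).

Section Init.
Open Scope Z_scope.
Variable w : nat.
Variable G : wdigraph.
Variable k : nat.
Variables X H Wb : Z.

Let n := nv G.
Let m := ne G.
Let base := 2 + 3 * m.
Let K := Z.of_nat k.
Let Sz := Z.of_nat (Nat.div2 (k + 1)).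
Let Rz := Z.of_nat (k - Nat.div2 (k + 1)).
Let D := root Sz (num_edges G).
Let t := loglog (num_edges G).

Hypothesis HX : 16 <= X.
Hypothesis HXw : fits X w.
Hypothesis Hk : (3 <= k)%nat.
Hypothesis Hn : below X 1 n.
Hypothesis Hm : below X 1 m.
Hypothesis HK : below X 1 K.
Hypothesis HmS : below X 1 ((m + 1) ^ Sz).
Hypothesis Hmm : below X 1 (m * m + 2).
Hypothesis HB : below X 1 (2 ^ (t + 1)).
Hypothesis Hglim : below X 1 (2 ^ ((t + 1) * (K * K))).
Hypothesis HnK : below X 1 (n ^ K).
Hypothesis Hw : (0 < w)%nat.
Hypothesis HH : H = 2 ^ (Z.of_nat w - 1).
Hypothesis HWb : forall e, 0 <= e < m -> Z.abs (wt G e) <= Wb.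
Hypothesis HKW : K * Wb < H.

Ltac words :=
  repeat lazymatch goal with
  | |- _ /\ _ => split
  | |- True => exact I
  | |- safe _ _ _ => progress red_goal
  | |- word w _ => eapply (below_word X HX w _ _ HXw); [solve [bd HX] | reflexivity]
  end.

Ltac wp_set := apply wp_seq, wp_assign; [red_goal; rwv; words|]; red_goal; rwv.

Ltac sem_set := rewrite sem_seq, sem_assign by (red_goal; rwv; words); red_goal; rwv.

Ltac below_by z := apply (below_le X HX _ z); [hyp_below|slia].

Definition mem0 (a : Z) : Z := to_word w (nth (Z.to_nat a) (input_data G) 0).

Record loaded (s : store) : Prop := {
  l_N : vars s vN = n;
  l_M : vars s vM = m;
  l_K : vars s vK = K;
  l_S : vars s vS = Sz;
  l_R : vars s vR = Rz;
  l_Base : vars s vBase = base;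
  l_H : vars s vH = H;
  l_Fr : vars s vFr = 1;
  l_Nh : vars s vNh = 0;
  l_mem : smem s = mem0
}.

Lemma loaded_frame (s s' : store) :
  loaded s -> (forall y, In y [0; 1; 2; 3; 4; 5; 10; 13; 15]%nat -> vars s' y = vars s y) ->
  smem s' = smem s -> loaded s'.
Proof.
  intros [] Hv Hs. constructor; try (rewrite Hv by (cbn; tauto)); auto. congruence.
Qed.

Lemma loaded_sem (c : cmd) (s : store) :
  forallb (fun y => negb (assigned c y)) [0; 1; 2; 3; 4; 5; 10; 13; 15]%nat = true ->
  stores c = false -> loaded s -> loaded (sem w c s).
Proof.
  intros Hc Hs E. apply (loaded_frame s); [exact E| |now apply sem_mem_frame].
  intros y Hy. apply sem_frame. rewrite forallb_forall in Hc. now apply negb_true_iff, Hc.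
Qed.

Lemma loaded_setv (s : store) (x : nat) (z : Z) :
  existsb (Nat.eqb x) [0; 1; 2; 3; 4; 5; 10; 13; 15]%nat = false ->
  loaded s -> loaded (setv s x z).
Proof.
  intros Hx E. apply (loaded_frame s); [exact E| |reflexivity].
  intros y Hy. apply vars_setv_other. intros ->.
  assert (existsb (Nat.eqb x) [0; 1; 2; 3; 4; 5; 10; 13; 15]%nat = true); [|congruence].
  apply existsb_exists. exists x. split; [exact Hy|apply Nat.eqb_refl].
Qed.

Lemma sizes : 1 <= Rz <= Sz /\ Sz + Rz = K /\ 2 <= Sz.
Proof.
  unfold Rz, Sz, K. pose proof (Nat.div2_odd (k + 1)) as E.
  destruct (Nat.odd (k + 1)); cbn [Nat.b2n] in E; lia.
Qed.

Lemma root_facts : 1 <= D <= m + 1 /\ m <= D ^ Sz /\ (D = 1 \/ (D - 1) ^ Sz < m).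
Proof.
  destruct sizes as (_ & _ & HS).
  destruct (root_spec Sz (num_edges G)) as (H1 & H2 & H3); [lia|]. auto.
Qed.

Lemma loglog_facts : 0 <= t /\ m < 2 ^ 2 ^ t.
Proof. destruct (loglog_spec (num_edges G)) as (H1 & H2 & H3). auto. Qed.

Lemma load_spec (s : store) :
  (forall x, vars s x = 0) -> smem s = mem0 ->
  let s' := sem w (LOAD k) s in
  loaded s' /\ vars s' vD = 1 /\ vars s' vT = 0 /\ vars s' vNR = 1 /\ vars s' vLim = m.
Proof.
  intros H0 Hs. cbn zeta.
  set (Q := fun s' => loaded s' /\ vars s' vD = 1 /\ vars s' vT = 0 /\
    vars s' vNR = 1 /\ vars s' vLim = m).
  change (wp w (LOAD k) Q s).
  assert (S0 : smem s 0 = n).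
  { rewrite Hs. unfold mem0. cbn [Z.to_nat input_data nth].
    apply to_word_small. eapply (below_word X HX w _ _ HXw); [exact Hn|reflexivity]. }
  assert (S1 : smem s 1 = m).
  { rewrite Hs. unfold mem0. change (Z.to_nat 1) with 1%nat. cbn [input_data nth].
    apply to_word_small. eapply (below_word X HX w _ _ HXw); [exact Hm|reflexivity]. }
  assert (BS : below X 1 Sz).
  { apply (below_le X HX _ K); [hyp_below|]. pose proof sizes. slia. }
  assert (BR : below X 1 Rz).
  { apply (below_le X HX _ K); [hyp_below|]. pose proof sizes. slia. }
  assert (EH : Z.shiftr (to_word w (0 - 1)) 1 + 1 = H).
  { rewrite HH. unfold to_word. replace (Z.of_nat w) with (Z.succ (Z.of_nat w - 1)) at 1 by lia.
    rewrite Z.pow_succ_r by lia.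
    assert (0 < 2 ^ (Z.of_nat w - 1)) by (apply Z.pow_pos_nonneg; lia).
    set (h := 2 ^ (Z.of_nat w - 1)) in *.
    replace ((0 - 1) mod (2 * h)) with (2 * h - 1)
      by (apply Z.mod_unique with (-1); lia).
    rewrite Z.shiftr_div_pow2 by lia. change (2 ^ 1) with 2.
    replace (2 * h - 1) with (1 + (h - 1) * 2) by ring.
    rewrite Z.div_add by lia. cbn. lia. }
  assert (WH : word w H).
  { unfold word. rewrite HH. split; [apply Z.pow_nonneg; lia|]. apply Z.pow_lt_mono_r; lia. }
  unfold LOAD.
  do 2 (apply wp_seq, wp_assign; [words|]; red_goal; rewrite ?S0, ?S1).
  do 3 (apply wp_seq, wp_assign; [words|]; red_goal).
  apply wp_seq, wp_assign; [words|]; red_goal.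
  apply wp_seq, wp_assign.
  { red_goal. split; [|split; [words|]].
    - split; [words|]. split; [words|]. unfold word.
      pose proof (to_word_word w (0 - 1)) as W1. unfold word in W1.
      rewrite Z.shiftr_div_pow2 by lia. change (2 ^ 1) with 2.
      split; [apply Z.div_pos; lia|]. apply Z.div_lt_upper_bound; lia.
    - rewrite EH. exact WH. }
  red_goal. rewrite EH.
  do 4 (apply wp_seq, wp_assign; [words|]; red_goal).
  apply wp_assign; [words|]; red_goal.
  split; [|repeat split; reflexivity].
  constructor; cbn; auto.
Qed.

Lemma degree_spec (s : store) :
  loaded s -> vars s vD = 1 ->
  loaded (sem w DEGREE s) /\ vars (sem w DEGREE s) vD = D.
Proof.
  intros E ED. split; [now apply loaded_sem|]. unfold DEGREE.
  match goal with |- context [For vi vM ?c] => set (body := c) end.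
  destruct sizes as (_ & _ & HS).
  destruct (sem_for w (fun i s' => loaded s' /\
    vars s' vD = Nat.iter (Z.to_nat i) (root_step Sz m) 1) vi vM body s) as (s' & -> & HP).
  - rewrite (l_M _ E). exact (below_nonneg X HX _ _ Hm).
  - split; [exact E|]. cbn. exact ED.
  - intros i s' Hi (E1 & I1) _ _. rewrite (l_M _ E) in Hi.
    split; [apply loaded_sem; [reflexivity..|]; now apply loaded_setv|].
    replace (Z.to_nat (i + 1)) with (S (Z.to_nat i)) by (clear - Hi; lia). rewrite iter_S.
    destruct (root_iter Sz m (Z.to_nat i)) as (R1 & _).
    set (d := Nat.iter (Z.to_nat i) (root_step Sz m) 1) in *.
    assert (Hd : 1 <= d <= m + 1) by (clear - R1 Hi; lia). clearbody d.
    assert (Hpow : forall j, 0 <= j <= Sz -> below X 1 (d ^ j)).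
    { intros j Hj. apply (below_le X HX _ ((m + 1) ^ Sz)); [hyp_below|].
      split; [apply Z.pow_nonneg; clear - Hd; lia|].
      transitivity (d ^ Sz); [apply Z.pow_le_mono_r|apply Z.pow_le_mono_l]; clear - Hd Hj; lia. }
    assert (Bd : below X 1 d).
    { rewrite <- (Z.pow_1_r d). apply Hpow. clear - HS. lia. }
    set (s1 := setv s' vi i).
    assert (E1' : loaded s1) by now apply loaded_setv.
    change (wp w body (fun s2 => vars s2 vD = root_step Sz m d) s1).
    apply wp_seq, wp_assign; [words|]. red_goal.
    apply wp_seq. unfold wp at 1.
    match goal with |- wp _ _ _ (sem _ (For vj vS ?c) ?st) => set (s2 := st); set (b2 := c) end.
    destruct (sem_for w (fun j s3 => vars s3 vP = d ^ j) vj vS b2 s2) as (s3 & E3 & HP3).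
    + change (vars s2 vS) with (vars s1 vS). rewrite (l_S _ E1'). clear - HS. lia.
    + reflexivity.
    + intros j s3 Hj IH Hfv _. change (vars s2 vS) with (vars s1 vS) in Hj.
      rewrite (l_S _ E1') in Hj.
      change (wp w b2 (fun s4 => vars s4 vP = d ^ (j + 1)) (setv s3 vj j)).
      assert (Fd : vars s3 vD = d) by (framed Hfv I1).
      assert (Bj := Hpow j ltac:(clear - Hj; lia)).
      apply wp_assign; [red_goal; rwv; words|]. red_goal; rwv.
      rewrite Z.pow_add_r, Z.pow_1_r; [reflexivity|clear - Hj; lia|clear; lia].
    + assert (F3 : loaded (sem w (For vj vS b2) s2)).
      { apply loaded_sem; [reflexivity..|]. now apply loaded_setv. }
      assert (Fd : vars (sem w (For vj vS b2) s2) vD = d)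
        by (rewrite sem_frame by reflexivity; exact I1).
      assert (Fp : vars (sem w (For vj vS b2) s2) vP = d ^ Sz).
      { rewrite E3. change (vars s2 vS) with (vars s1 vS) in HP3 |- *.
        rewrite (l_S _ E1') in HP3. exact HP3. }
      set (s4 := sem w (For vj vS b2) s2) in *. clearbody s4.
      pose proof (l_M _ F3) as EM.
      unfold root_step. apply wp_if; [red_goal; rwv; words| |]; red_goal; rwv;
        destruct (Z.ltb_spec (d ^ Sz) m); try (intros C; exfalso; apply C; reflexivity);
        try (intros C; discriminate C); intros _.
      * apply wp_assign; [red_goal; rwv; words|]. red_goal; rwv; reflexivity.
      * apply wp_skip. exact Fd.
  - rewrite (l_M _ E) in HP |- *. destruct HP as [_ HP].
    change (vars s' vD = D). rewrite HP. unfold D, root, m, ne. now rewrite Nat2Z.id.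
Qed.

Lemma loglog_prog_spec (s : store) :
  loaded s -> vars s vT = 0 ->
  loaded (sem w LOGLOG s) /\ vars (sem w LOGLOG s) vT = t.
Proof.
  intros E ET. split; [now apply loaded_sem|]. unfold LOGLOG.
  match goal with |- context [For vi vM ?c] => set (body := c) end.
  destruct (sem_for w (fun i s' => loaded s' /\
    vars s' vT = Nat.iter (Z.to_nat i) (loglog_step m) 0) vi vM body s) as (s' & -> & HP).
  - rewrite (l_M _ E). exact (below_nonneg X HX _ _ Hm).
  - split; [exact E|]. cbn. exact ET.
  - intros i s' Hi (E1 & I1) _ _. rewrite (l_M _ E) in Hi.
    split; [apply loaded_sem; [reflexivity..|]; now apply loaded_setv|].
    replace (Z.to_nat (i + 1)) with (S (Z.to_nat i)) by (clear - Hi; lia). rewrite iter_S.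
    destruct (loglog_iter m (Z.to_nat i)) as (R1 & R2 & _).
    set (d := Nat.iter (Z.to_nat i) (loglog_step m) 0) in *. clearbody d.
    assert (Hp := pow_pow_step m d (below_nonneg X HX _ _ Hm) (proj1 R1) R2).
    assert (B2 : below X 1 (2 ^ 2 ^ d)).
    { apply (below_le X HX _ (m * m + 2)); [hyp_below|]. split; [apply Z.pow_nonneg; lia|exact Hp]. }
    assert (B1 : below X 1 (2 ^ d)).
    { apply (below_le X HX _ (2 ^ 2 ^ d)); [hyp_below|]. split; [apply Z.pow_nonneg; lia|].
      apply Z.lt_le_incl, Z.pow_gt_lin_r; [lia|]. apply Z.pow_nonneg; lia. }
    assert (B0 : below X 1 d).
    { apply (below_le X HX _ (2 ^ d)); [hyp_below|]. split; [apply R1|].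
      apply Z.lt_le_incl, Z.pow_gt_lin_r; [lia|apply R1]. }
    set (s1 := setv s' vi i).
    assert (EM : vars s1 vM = m) by exact (l_M _ E1).
    assert (I1' : vars s1 vT = d) by exact I1. clearbody s1.
    change (wp w body (fun s2 => vars s2 vT = loglog_step m d) s1).
    unfold loglog_step. apply wp_if.
    + red_goal; rwv; rewrite !Z.shiftl_1_l; words.
    + red_goal; rwv; rewrite !Z.shiftl_1_l. destruct (Z.ltb_spec m (2 ^ 2 ^ d));
        [|intros C; exfalso; apply C; reflexivity].
      intros _. apply wp_skip. exact I1'.
    + red_goal; rwv; rewrite !Z.shiftl_1_l. destruct (Z.ltb_spec m (2 ^ 2 ^ d));
        [intros C; discriminate C|].
      intros _. apply wp_assign; [red_goal; rwv; words|]. red_goal; rwv; reflexivity.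
  - rewrite (l_M _ E) in HP |- *. destruct HP as [_ HP].
    change (vars s' vT = t). rewrite HP. unfold t, loglog, m, ne. now rewrite Nat2Z.id.
Qed.

Lemma lim_bound (j : Z) : 0 <= j <= Sz - 1 -> below X 1 (m * D ^ j).
Proof.
  intros Hj. destruct root_facts as ([D1 D2] & _).
  assert (Hm0 := below_nonneg X HX _ _ Hm).
  apply (below_le X HX _ ((m + 1) ^ Sz)); [hyp_below|].
  assert (0 <= D ^ j) by (apply Z.pow_nonneg; clear - D1; lia).
  split; [apply Z.mul_nonneg_nonneg; assumption|].
  transitivity ((m + 1) * (m + 1) ^ j).
  - apply Z.mul_le_mono_nonneg; [assumption|clear; lia|assumption|].
    apply Z.pow_le_mono_l. clear - D1 D2. lia.
  - rewrite <- Z.pow_succ_r by (clear - Hj; lia).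
    apply Z.pow_le_mono_r; [clear - Hm0|clear - Hj]; lia.
Qed.

Lemma powers_spec (s : store) :
  loaded s -> vars s vD = D -> vars s vNR = 1 -> vars s vLim = m ->
  let s' := sem w POWERS s in
  loaded s' /\ vars s' vNR = n ^ Rz /\ vars s' vLim = m * D ^ (Sz - 1).
Proof.
  intros E ED ENR EL. cbn zeta. split; [now apply loaded_sem|].
  destruct sizes as (HS & HSR & HS2). destruct root_facts as ([D1 D2] & _).
  assert (Hn0 := below_nonneg X HX _ _ Hn).
  unfold POWERS. rewrite sem_seq.
  match goal with |- context [For vj vR ?c] => set (c1 := c) end.
  match goal with |- context [For vj vS ?c] => set (c2 := c) end.
  assert (A : vars (sem w (For vj vR c1) s) vNR = n ^ Rz).
  { destruct (sem_for w (fun j s' => vars s' vNR = n ^ j) vj vR c1 s) as (s' & -> & HP).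
    - rewrite (l_R _ E). clear - HS. lia.
    - exact ENR.
    - intros j s' Hj IH Hfv _. rewrite (l_R _ E) in Hj.
      change (wp w c1 (fun s4 => vars s4 vNR = n ^ (j + 1)) (setv s' vj j)).
      assert (FN : vars s' vN = n)
        by (framed Hfv ((l_N _ E))).
      assert (Bj : below X 1 (n ^ j)).
      (* For [n = 0] the bound by [n ^ K = 0] fails at [j = 0], where the power is 1. *)
      { destruct (Z.eq_dec n 0) as [En|].
        - apply (below_const X HX). rewrite En. destruct (Z.eq_dec j 0) as [->|]; [cbn; lia|].
          rewrite Z.pow_0_l; [lia|]. clear - Hj n0. lia.
        - apply (below_le X HX _ (n ^ K)); [hyp_below|].
          split; [apply Z.pow_nonneg; exact Hn0|].
          apply Z.pow_le_mono_r; [clear - Hn0 n0|clear - Hj HS HSR]; lia. }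
      apply wp_assign; [red_goal; rwv; words|]. red_goal; rwv.
      rewrite Z.pow_add_r, Z.pow_1_r; [reflexivity|clear - Hj; lia|clear; lia].
    - rewrite (l_R _ E) in HP. exact HP. }
  assert (E1 : loaded (sem w (For vj vR c1) s)) by now apply loaded_sem.
  assert (ED1 : vars (sem w (For vj vR c1) s) vD = D) by (rewrite sem_frame by reflexivity; exact ED).
  assert (EL1 : vars (sem w (For vj vR c1) s) vLim = m) by (rewrite sem_frame by reflexivity; exact EL).
  set (s1 := sem w (For vj vR c1) s) in *. clearbody s1.
  split; [rewrite sem_frame by reflexivity; exact A|].
  (* The exponent is truncated at 0 because the round [j = 0] does not multiply. *)
  destruct (sem_for w (fun j s' => vars s' vLim = m * D ^ (Z.max 0 (j - 1))) vj vS c2 s1)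
    as (s' & -> & HP).
  - rewrite (l_S _ E1). clear - HS2. lia.
  - cbn. rewrite EL1. lia.
  - intros j s' Hj IH Hfv _. rewrite (l_S _ E1) in Hj.
    assert (FD : vars s' vD = D) by (framed Hfv ED1).
    change (wp w c2 (fun s4 => vars s4 vLim = m * D ^ (Z.max 0 (j + 1 - 1))) (setv s' vj j)).
    assert (Bj := lim_bound (Z.max 0 (j - 1)) ltac:(clear - Hj HS2; lia)).
    assert (BD : below X 1 D).
    { apply (below_le X HX _ ((m + 1) ^ Sz)); [hyp_below|]. split; [clear - D1; lia|].
      transitivity ((m + 1) ^ 1); [rewrite Z.pow_1_r; exact D2|].
      apply Z.pow_le_mono_r; [clear - D1 D2|clear - HS2]; lia. }
    apply wp_if; [exact I| |].
    + red_goal. intros Hj0. apply wp_assign; [red_goal; rwv; words|]. red_goal; rwv.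
      replace (Z.max 0 (j + 1 - 1)) with (Z.succ (Z.max 0 (j - 1))) by (clear - Hj Hj0; lia).
      rewrite Z.pow_succ_r by (clear; lia). ring.
    + red_goal. intros ->. apply wp_skip. exact IH.
  - rewrite (l_S _ E1) in HP. change (vars s' vLim = m * D ^ (Sz - 1)). rewrite HP.
    f_equal. f_equal. clear - HS2. lia.
Qed.

Record ready (s : store) : Prop := {
  r_loaded : loaded s;
  r_D : vars s vD = D;
  r_W : vars s vW = t + 1;
  r_B : vars s vB = 2 ^ (t + 1);
  r_G : vars s vG = 2 ^ ((t + 1) * (K * K));
  r_Lim : vars s vLim = m * D ^ (Sz - 1);
  r_NR : vars s vNR = n ^ Rz
}.

Lemma setup_spec (s : store) :
  (forall x, vars s x = 0) -> smem s = mem0 ->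
  ready (sem w CONSTS (sem w SETUP (sem w (LOAD k) s))).
Proof.
  intros H0 Hs.
  destruct (load_spec s H0 Hs) as (E & ED & ET & ENR & EL).
  set (s1 := sem w (LOAD k) s) in *. clearbody s1.
  unfold SETUP. rewrite !sem_seq.
  destruct (degree_spec s1 E ED) as (E2 & ED2).
  assert (ET2 : vars (sem w DEGREE s1) vT = 0) by (rewrite sem_frame; auto).
  assert (ENR2 : vars (sem w DEGREE s1) vNR = 1) by (rewrite sem_frame; auto).
  assert (EL2 : vars (sem w DEGREE s1) vLim = m) by (rewrite sem_frame; auto).
  set (s2 := sem w DEGREE s1) in *. clearbody s2.
  destruct (loglog_prog_spec s2 E2 ET2) as (E3 & ET3).
  assert (ED3 : vars (sem w LOGLOG s2) vD = D) by (rewrite sem_frame; auto).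
  assert (ENR3 : vars (sem w LOGLOG s2) vNR = 1) by (rewrite sem_frame; auto).
  assert (EL3 : vars (sem w LOGLOG s2) vLim = m) by (rewrite sem_frame; auto).
  set (s3 := sem w LOGLOG s2) in *. clearbody s3.
  destruct (powers_spec s3 E3 ED3 ENR3 EL3) as (E4 & ENR4 & EL4).
  assert (ED4 : vars (sem w POWERS s3) vD = D) by (rewrite sem_frame; auto).
  assert (ET4 : vars (sem w POWERS s3) vT = t) by (rewrite sem_frame; auto).
  set (s4 := sem w POWERS s3) in *. clearbody s4.
  destruct loglog_facts as [Ht0 _].
  assert (BW : below X 1 (t + 1)).
  { apply (below_le X HX _ (2 ^ (t + 1))); [hyp_below|]. split; [lia|].
    apply Z.lt_le_incl, Z.pow_gt_lin_r; lia. }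
  assert (BT : below X 1 t) by (apply (below_le X HX _ (t + 1)); [hyp_below|lia]).
  pose proof (l_K _ E4) as EK4.
  change (wp w CONSTS ready s4).
  wp_set.
  apply wp_seq, wp_assign; [red_goal; rwv; rewrite ?Z.shiftl_1_l; words|].
  red_goal; rwv. rewrite Z.shiftl_1_l.
  apply wp_assign; [red_goal; rwv; rewrite ?Z.shiftl_1_l; words|].
  red_goal; rwv. rewrite Z.shiftl_1_l.
  constructor; try assumption; try reflexivity.
  repeat (apply loaded_setv; [reflexivity|]). exact E4.
Qed.

(** * Adjacency lists, labels and the list of heavy vertices *)

Notation cell' := (cell G).

(** State after the first [x] edges. A vertex that is no tail so far has never had its label
    written, so for general vertices only the range of the label is claimed. Injectivity of ranks
    and of the heavy list serves to count the heavy vertices. *)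
Definition edges_inv (x : Z) (s : store) : Prop :=
  (forall a, 0 <= a < base -> smem s a = mem0 a) /\
  (forall i, 0 <= i -> cell' s aW i = 0) /\
  (forall u, 0 <= u < n -> 0 <= cell' s aDeg u <= x) /\
  (forall u i, 0 <= u < n -> 0 <= i < cell' s aDeg u ->
    0 <= cell' s aAdj (u * m + i) < x /\ src G (cell' s aAdj (u * m + i)) = u) /\
  (forall u i i', 0 <= u < n -> 0 <= i < cell' s aDeg u -> 0 <= i' < cell' s aDeg u ->
    cell' s aAdj (u * m + i) = cell' s aAdj (u * m + i') -> i = i') /\
  (forall e, 0 <= e < x -> exists i, 0 <= i < cell' s aDeg (src G e) /\
    cell' s aAdj (src G e * m + i) = e) /\
  (forall u, 0 <= u < n -> 0 <= cell' s aLab u <= m) /\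
  (forall e, 0 <= e < x -> 0 <= cell' s aLab (src G e) < x /\
    src G (cell' s aLab (src G e)) = src G e) /\
  0 <= vars s vNh <= x /\
  (forall i, 0 <= i < vars s vNh -> 0 <= cell' s aHeavy i < n /\
    D < cell' s aDeg (cell' s aHeavy i)) /\
  (forall i i', 0 <= i < vars s vNh -> 0 <= i' < vars s vNh ->
    cell' s aHeavy i = cell' s aHeavy i' -> i = i') /\
  (forall u, 0 <= u < n -> D < cell' s aDeg u ->
    exists i, 0 <= i < vars s vNh /\ cell' s aHeavy i = u).

Lemma mem0_edge (e : Z) : 0 <= e < m ->
  mem0 (2 + 3 * e) = src G e /\ mem0 (3 + 3 * e) = dst G e /\
  mem0 (4 + 3 * e) = to_word w (wt G e).
Proof.
  intros He. unfold mem0. destruct (input_edge G e He) as (-> & -> & ->).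
  assert (Hs : 0 <= src G e < n) by (apply src_bound; exact He).
  assert (Hd : 0 <= dst G e < n) by (apply dst_bound; exact He).
  assert (below X 1 (src G e)) by (below_by n).
  assert (below X 1 (dst G e)) by (below_by n).
  repeat split; auto; apply to_word_small;
    (eapply (below_word X HX w _ _ HXw); [hyp_below|reflexivity]).
Qed.

Lemma mem0_zero (a : Z) : base <= a -> mem0 a = 0.
Proof.
  intros Ha. unfold mem0. rewrite nth_overflow.
  - apply Z.mod_0_l. apply Z.pow_nonzero; lia.
  - assert (L : forall l : list (nat * nat), length (flat_map
      (fun e => [Z.of_nat (fst e); Z.of_nat (snd e); weight G e]) l) = (3 * length l)%nat).
    { induction l as [|x l IH]; [reflexivity|]. cbn [flat_map app length]. rewrite IH. lia. }
    cbn [input_data length]. rewrite L. unfold base, m, ne, num_edges in Ha. lia.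
Qed.

Lemma base_bound : below X 3 base.
Proof. unfold base. eapply (below_mono X HX); [|bd HX]. cbn. lia. Qed.

Lemma edges_init (s : store) : loaded s -> edges_inv 0 s.
Proof.
  intros E.
  assert (Z0 : forall j i, 0 <= j -> 0 <= i -> cell' s j i = 0).
  { intros j i Hj Hi. unfold cell. rewrite (l_mem _ E). apply mem0_zero.
    fold m. unfold base. lia. }
  pose proof (below_nonneg X HX _ _ Hm) as Hm0.
  destruct root_facts as ([D1 _] & _).
  pose proof (l_Nh _ E) as ENh.
  unfold edges_inv. rewrite ENh.
  split; [intros; now rewrite (l_mem _ E)|].
  split; [intros; apply Z0; lia|].
  split; [intros u Hu; rewrite Z0; lia|].
  split; [intros u i Hu; rewrite Z0; lia|].
  split; [intros u i i' Hu; rewrite Z0; lia|].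
  split; [intros; lia|].
  split; [intros u Hu; rewrite Z0; lia|].
  split; [intros; lia|].
  split; [lia|].
  split; [intros; lia|].
  split; [intros; lia|].
  intros u Hu; rewrite Z0; lia.
Qed.

(** The effect of one round is described cell by cell, apart from the program text, so both outcomes
    of the test [d = D] are instances of the same statement. *)
Lemma edge_step (e : Z) (s s' : store) :
  let u := src G e in let d := cell' s aDeg u in
  0 <= e < m -> edges_inv e s ->
  (forall a, 0 <= a < base -> smem s' a = smem s a) ->
  (forall i, 0 <= i -> cell' s' aW i = cell' s aW i) ->
  (forall x, cell' s' aDeg x = if x =? u then d + 1 else cell' s aDeg x) ->
  (forall x, cell' s' aAdj x = if x =? u * m + d then e else cell' s aAdj x) ->
  (forall x, cell' s' aLab x = if x =? u then e else cell' s aLab x) ->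
  vars s' vNh = (if d =? D then vars s vNh + 1 else vars s vNh) ->
  (forall x, cell' s' aHeavy x =
    if (d =? D) && (x =? vars s vNh) then u else cell' s aHeavy x) ->
  edges_inv (e + 1) s'.
Proof.
  intros u d He (I1 & I2 & I3 & I4 & I5 & I6 & I7 & I8 & I9 & I10 & I11 & I12)
    F1 F2 F3 F4 F5 F6 F7.
  assert (Hu : 0 <= u < n) by (apply src_bound; exact He).
  assert (Hd : 0 <= d <= e) by (apply I3; exact Hu).
  (* Ranks are below the row length [m], so equal addresses belong to the same row and rank. *)
  assert (Key : forall v i, 0 <= i < m -> v * m + i = u * m + d -> v = u /\ i = d).
  { intros v i Hi E. apply (Z.div_mod_unique m v u i d).
    - left; exact Hi.
    - left; clear - Hd He; lia.
    - now rewrite !(Z.mul_comm m). }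
  assert (Old : forall v i, 0 <= v < n -> 0 <= i < cell' s aDeg v ->
    cell' s' aAdj (v * m + i) = cell' s aAdj (v * m + i)).
  { intros v i Hv Hi. rewrite F4. destruct (Z.eqb_spec (v * m + i) (u * m + d)) as [E|]; [|reflexivity].
    exfalso. specialize (I3 v Hv). destruct (Key v i ltac:(clear - I3 Hi He; lia) E) as [-> ->].
    unfold d in Hi. clear - Hi. lia. }
  assert (New : cell' s' aAdj (u * m + d) = e) by (rewrite F4, Z.eqb_refl; reflexivity).
  assert (Deg : forall v i, 0 <= v < n -> 0 <= i < cell' s' aDeg v ->
    (0 <= i < cell' s aDeg v) \/ (v = u /\ i = d)).
  { intros v i Hv Hi. rewrite F3 in Hi. destruct (Z.eqb_spec v u) as [->|]; [|auto].
    unfold d in *. clear - Hi. lia. }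
  assert (DegLe : forall v, cell' s aDeg v <= cell' s' aDeg v).
  { intros v. rewrite F3. destruct (Z.eqb_spec v u) as [->|]; unfold d; clear; lia. }
  split; [intros a Ha; rewrite F1; auto|].
  split; [intros i Hi; rewrite F2; auto|].
  split.
  { intros v Hv. rewrite F3. specialize (I3 v Hv).
    destruct (Z.eqb_spec v u); [clear - Hd|clear - I3]; lia. }
  split.
  { intros v i Hv Hi. destruct (Deg v i Hv Hi) as [Hi'|[-> ->]].
    - rewrite Old by assumption. destruct (I4 v i Hv Hi') as [A B].
      split; [clear - A; lia|exact B].
    - rewrite New. split; [clear - He; lia|reflexivity]. }
  split.
  { intros v i i' Hv Hi Hi' E.
    destruct (Deg v i Hv Hi) as [Gi|[-> ->]]; destruct (Deg _ i' Hv Hi') as [Gi'|[Ev ->]].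
    - rewrite !Old in E by assumption. apply (I5 v); assumption.
    - subst v. rewrite New, Old in E by assumption.
      destruct (I4 u i Hv Gi) as [A _]. exfalso. clear - A E. lia.
    - rewrite New, Old in E by assumption.
      destruct (I4 u i' Hv Gi') as [A _]. exfalso. clear - A E. lia.
    - reflexivity. }
  split.
  { intros e' He'. destruct (Z.eq_dec e' e) as [->|Hne].
    - exists d. fold u. rewrite New. split; [|reflexivity].
      rewrite F3, Z.eqb_refl. clear - Hd. lia.
    - destruct (I6 e' ltac:(clear - He' Hne; lia)) as (i & Hi & E).
      exists i. rewrite Old; [|apply src_bound; clear - He' He; lia|exact Hi].
      split; [|exact E]. specialize (DegLe (src G e')). clear - Hi DegLe. lia. }
  split.
  { intros v Hv. rewrite F5. destruct (Z.eqb_spec v u); [clear - He; lia|auto]. }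
  split.
  { intros e' He'. rewrite F5. destruct (Z.eqb_spec (src G e') u) as [E|E].
    - split; [clear - He; lia|]. symmetry. exact E.
    - assert (Hne : e' <> e) by (intros ->; apply E; reflexivity).
      destruct (I8 e' ltac:(clear - He' Hne; lia)) as [A B]. split; [clear - A; lia|exact B]. }
  assert (Hold : forall i, 0 <= i < vars s vNh -> cell' s' aHeavy i = cell' s aHeavy i).
  { intros i Hi. rewrite F7. destruct (Z.eqb_spec i (vars s vNh)); [exfalso; clear - Hi e0; lia|].
    now rewrite andb_false_r. }
  destruct (Z.eqb_spec d D) as [EdD|EdD].
  - assert (Hnew : cell' s' aHeavy (vars s vNh) = u)
      by (rewrite F7, Z.eqb_refl; reflexivity).
    assert (Hcase : forall i, 0 <= i < vars s' vNh -> 0 <= i < vars s vNh \/ i = vars s vNh)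
      by (intros i Hi; rewrite F6 in Hi; clear - Hi; lia).
    (* Listed vertices already have degree above [D], whereas [u] still has degree [D]: it is not
       listed yet. *)
    assert (Hnotu : forall i, 0 <= i < vars s vNh -> cell' s aHeavy i <> u).
    { intros i Hi E. destruct (I10 i Hi) as [_ A]. rewrite E in A. fold d in A. clear - A EdD. lia. }
    split; [rewrite F6; clear - I9; lia|].
    split.
    { intros i Hi. destruct (Hcase i Hi) as [Hi'| ->].
      - rewrite Hold by exact Hi'. destruct (I10 i Hi') as [A B]. split; [exact A|].
        specialize (DegLe (cell' s aHeavy i)). clear - B DegLe. lia.
      - rewrite Hnew. split; [exact Hu|]. rewrite F3, Z.eqb_refl. clear - EdD. lia. }
    split.
    { intros i i' Hi Hi' E. destruct (Hcase i Hi) as [Gi|Gi]; destruct (Hcase i' Hi') as [Gi'|Gi'].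
      - rewrite !Hold in E by assumption. apply I11; assumption.
      - subst i'. rewrite Hnew, Hold in E by assumption. exfalso. exact (Hnotu i Gi E).
      - subst i. rewrite Hnew, Hold in E by assumption. exfalso. exact (Hnotu i' Gi' (eq_sym E)).
      - congruence. }
    intros v Hv Hdv. rewrite F3 in Hdv. destruct (Z.eqb_spec v u) as [->|Hne].
    + exists (vars s vNh). split; [rewrite F6; clear - I9; lia|exact Hnew].
    + destruct (I12 v Hv Hdv) as (i & Hi & E). exists i.
      split; [rewrite F6; clear - Hi; lia|]. rewrite Hold; assumption.
  - rewrite F6. split; [clear - I9; lia|].
    split.
    { intros i Hi. rewrite Hold by exact Hi. destruct (I10 i Hi) as [A B]. split; [exact A|].
      specialize (DegLe (cell' s aHeavy i)). clear - B DegLe. lia. }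
    split; [intros i i' Hi Hi'; rewrite !Hold by assumption; apply I11; assumption|].
    intros v Hv Hdv.
    assert (Hdv' : D < cell' s aDeg v).
    { rewrite F3 in Hdv. destruct (Z.eqb_spec v u) as [->|]; [|exact Hdv].
      fold d. clear - Hdv EdD. lia. }
    destruct (I12 v Hv Hdv') as (i & Hi & E). exists i. split; [exact Hi|].
    rewrite Hold; assumption.
Qed.

Ltac writes :=
  intros; cbn [smem setv vars set_reg Nat.eqb]; unfold cell, set_mem;
  cbn [smem setv]; fold m base;
  repeat match goal with |- context [(?a =? ?b)] => destruct (Z.eqb_spec a b) end;
  subst; try reflexivity; exfalso; slia.

Lemma edges_spec (s : store) : ready s -> edges_inv m (sem w EDGES s).
Proof.
  intros E. pose proof (r_loaded _ E) as El. pose proof base_bound as Hbase.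
  destruct (sem_for w edges_inv ve vM EDGE_BODY s) as (s' & E' & HP).
  - rewrite (l_M _ El). exact (below_nonneg X HX _ _ Hm).
  - apply edges_init; exact El.
  - intros e s' He IH Hfv _. rewrite (l_M _ El) in He.
    assert (G1 : vars s' vM = m) by (framed Hfv ((l_M _ El))).
    assert (G2 : vars s' vBase = base) by (framed Hfv ((l_Base _ El))).
    assert (G3 : vars s' vD = D) by (framed Hfv ((r_D _ E))).
    change (wp w EDGE_BODY (edges_inv (e + 1)) (setv s' ve e)).
    pose proof IH as (I1 & I2 & I3 & _ & _ & _ & _ & _ & I9 & _).
    destruct (mem0_edge e He) as (Et & _).
    rewrite <- I1 in Et by (unfold base; clear - He; lia).
    set (u := src G e) in *.
    assert (Hu : 0 <= u < n) by (apply src_bound; exact He).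
    set (d := cell' s' aDeg u).
    assert (Hd : 0 <= d <= e) by (apply I3; exact Hu).
    assert (Be : below X 1 e) by (below_by m).
    assert (Bu : below X 1 u) by (below_by n).
    assert (Bd : below X 1 d) by (below_by m).
    set (nh := vars s' vNh) in *.
    assert (Bh : below X 1 nh) by (below_by m).
    wp_set. rewrite Et.
    wp_set.
    change (smem s' (base + (6 * u + 1))) with d.
    apply wp_seq, wp_store; [red_goal; rwv; words..|]. red_goal; rwv.
    apply wp_seq, wp_store; [red_goal; rwv; words..|]. red_goal; rwv.
    apply wp_seq, wp_store; [red_goal; rwv; words..|]. red_goal; rwv.
    assert (Hum : 0 <= u * m) by (apply Z.mul_nonneg_nonneg; [apply Hu|clear - He; lia]).
    pose proof (below_nonneg X HX _ _ Hm) as Hm0.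
    apply wp_if; [red_goal; rwv; words| |]; red_goal; rwv; fold nh; intros Hc.
    + apply wp_seq, wp_store; [red_goal; rwv; fold nh; words..|]. red_goal; rwv.
      apply wp_assign; [red_goal; rwv; fold nh; words|]. red_goal; fold nh.
      assert (EdD : d =? D = true) by (destruct (d =? D); [reflexivity|exfalso; apply Hc; reflexivity]).
      apply (edge_step e s'); [exact He|exact IH|..]; fold u; fold d; fold nh;
        rewrite ?EdD; cbn [andb]; writes.
    + apply wp_skip.
      assert (EdD : d =? D = false) by (destruct (d =? D); [discriminate Hc|reflexivity]).
      apply (edge_step e s'); [exact He|exact IH|..]; fold u; fold d; fold nh;
        rewrite ?EdD; cbn [andb]; writes.
  - change (edges_inv m (sem w (For ve vM EDGE_BODY) s)). rewrite E'.
    rewrite (l_M _ El) in HP |- *. exact HP.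
Qed.

(** The first [D + 1] out-edges of the listed vertices are pairwise distinct. The injection [f]
    reads [q] as a pair of list index and rank and returns the edge with that rank. *)
Lemma heavy_count (s : store) : edges_inv m s -> vars s vNh * (D + 1) <= m.
Proof.
  intros (_ & _ & I3 & I4 & I5 & _ & _ & _ & I9 & I10 & I11 & _).
  set (nh := vars s vNh) in *. destruct root_facts as ([D1 _] & _).
  set (f := fun q => cell' s aAdj (cell' s aHeavy (q / (D + 1)) * m + q mod (D + 1))).
  set (q0 := Z.to_nat (nh * (D + 1))).
  assert (Hq : forall q, In q (map Z.of_nat (seq 0 q0)) ->
    0 <= q / (D + 1) < nh /\ 0 <= q mod (D + 1) < D + 1).
  { intros q Hq. apply in_map_iff in Hq as (i & <- & Hi). apply in_seq in Hi.
    split; [|apply Z.mod_pos_bound; lia].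
    split; [apply Z.div_pos; lia|]. apply Z.div_lt_upper_bound; [lia|]. unfold q0 in Hi. lia. }
  assert (Hf : forall q, In q (map Z.of_nat (seq 0 q0)) ->
    0 <= f q < m /\ src G (f q) = cell' s aHeavy (q / (D + 1))).
  { intros q Hi. destruct (Hq q Hi) as [A B]. destruct (I10 _ A) as [C E].
    apply I4; [exact C|]. clear - B E. lia. }
  assert (Hnd : NoDup (map f (map Z.of_nat (seq 0 q0)))).
  { apply NoDup_map_NoDup_ForallPairs.
    - intros x y Hx Hy E. destruct (Hq x Hx) as [A1 A2]. destruct (Hq y Hy) as [B1 B2].
      destruct (Hf x Hx) as [_ C1]. destruct (Hf y Hy) as [_ C2].
      assert (Ed : x / (D + 1) = y / (D + 1)) by (apply I11; [exact A1|exact B1|congruence]).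
      assert (Em : x mod (D + 1) = y mod (D + 1)).
      { unfold f in E. rewrite Ed in E. destruct (I10 _ B1) as [C F].
        eapply I5; [exact C|clear - A2 F; lia|clear - B2 F; lia|exact E]. }
      rewrite (Z.div_mod x (D + 1)), (Z.div_mod y (D + 1)), Ed, Em by (clear - D1; lia).
      reflexivity.
    - apply FinFun.Injective_map_NoDup; [intros a b Hab; lia|apply seq_NoDup]. }
  assert (Hl := NoDup_incl_length Hnd (l' := map Z.of_nat (seq 0 (Z.to_nat m)))).
  rewrite !length_map, !length_seq in Hl. unfold q0 in Hl.
  assert (Z.to_nat (nh * (D + 1)) <= Z.to_nat m)%nat; [|lia].
  apply Hl. intros e He. apply in_map_iff in He as (q & <- & Hi).
  destruct (Hf q Hi) as [A _]. apply in_map_iff. exists (Z.to_nat (f q)).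
  split; [lia|]. apply in_seq. lia.
Qed.

Lemma main_correct (s : store) :
  ready s ->
  let s' := sem w MAIN (sem w EDGES s) in
  vars s' vN = n /\ vars s' vK = K /\ vars s' vBase = base /\
  entry (cell' s' aW 0) (cell' s' aC 0) (good G K H)
    (fun y => exists es u, Z.of_nat (length es) = K /\ walk G u es u /\
      NoDup (map (src G) es) /\ y = H + psum G es).
Proof.
  intros E. assert (Hi := edges_spec s E).
  pose proof Hi as (I1 & I2 & I3 & I4 & I5 & I6 & I7 & I8 & I9 & I10 & I11 & I12).
  assert (Fv : forall y, assigned EDGES y = false -> vars (sem w EDGES s) y = vars s y)
    by (intros; now apply sem_frame).
  set (s1 := sem w EDGES s) in *. clearbody s1.
  destruct sizes as (HS & HSR & HS2). destruct root_facts as ([D1 D2] & _).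
  destruct loglog_facts as [Ht0 Htm].
  pose proof (r_loaded _ E) as El.
  assert (HH2 : H + H = 2 ^ Z.of_nat w).
  { rewrite HH. replace (Z.of_nat w) with (Z.succ (Z.of_nat w - 1)) at 3 by (clear - Hw; lia).
    rewrite Z.pow_succ_r by (clear - Hw; lia). ring. }
  assert (BW : below X 1 (t + 1)).
  { apply (below_le X HX _ (2 ^ (t + 1))); [hyp_below|]. split; [clear - Ht0; lia|].
    apply Z.lt_le_incl, Z.pow_gt_lin_r; clear - Ht0; lia. }
  assert (BD : below X 1 D).
  { apply (below_le X HX _ ((m + 1) ^ Sz)); [hyp_below|]. split; [clear - D1; lia|].
    transitivity ((m + 1) ^ 1); [rewrite Z.pow_1_r; exact D2|].
    apply Z.pow_le_mono_r; [clear - D1 D2|clear - HS2]; lia. }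
  assert (Bnh : below X 1 (vars s1 vNh)) by (apply (below_le X HX _ m); [hyp_below|exact I9]).
  assert (Blim := lim_bound (Sz - 1) ltac:(clear - HS2; lia)).
  cbn zeta.
  destruct (main_spec w G X K Sz Rz t D (vars s1 vNh) H Wb
    (fun u => cell' s1 aDeg u) (fun u => cell' s1 aLab u) (fun i => cell' s1 aHeavy i)
    (fun u i => cell' s1 aAdj (u * m + i)) HX HXw Hn Hm HK Ht0 BW HB Hglim Blim BD
    ltac:(clear - D1; lia) HnK Bnh HS HSR HH2 HWb HKW ltac:(clear - Htm; lia)
    I3 I4 I6 I7 I8 (fun i Hx => proj1 (I10 i Hx)) I12 s1) as [A B].
  - constructor; try (rewrite Fv by reflexivity); try apply E; try apply El;
      try reflexivity; try (intros; reflexivity).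
    + intros e He. rewrite I1 by (unfold base; fold m in He; clear - He; lia).
      apply mem0_edge; exact He.
    + intros e He. rewrite I1 by (unfold base; fold m in He; clear - He; lia).
      apply mem0_edge; exact He.
    + intros e He. rewrite I1 by (unfold base; fold m in He; clear - He; lia).
      apply mem0_edge; exact He.
  - rewrite Fv by reflexivity. apply El.
  - exact I2.
  - split; [exact (e_N _ _ _ _ _ _ _ _ _ _ _ _ _ _ A)|].
    split; [exact (e_K _ _ _ _ _ _ _ _ _ _ _ _ _ _ A)|].
    split; [exact (e_Base _ _ _ _ _ _ _ _ _ _ _ _ _ _ A)|exact B].
Qed.

(** * Output and overall correctness *)

Lemma output_loop (s : store) (es : list Z) :
  vars s vN = n -> vars s vK = K -> vars s vnc = pcode G es ->
  Z.of_nat (length es) = K -> (forall e, In e es -> 0 <= e < m) ->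
  let s' := sem w (For vj vK
    (Store (V vK - V vj) (V vnc mod V vN) ;; vnc ::= V vnc / V vN)) s in
  smem s' 0 = smem s 0 /\
  map (fun i => smem s' (Z.of_nat i)) (seq 1 k) = map (src G) es.
Proof.
  intros EN EK Ec Hl Hin. cbn zeta.
  match goal with |- context [For vj vK ?c] => set (body := c) end.
  assert (HK0 : 3 <= K) by (unfold K; clear - Hk; lia).
  (* After [j] rounds the code holds the first [K - j] tails and the last [j] cells are written.
     Cell 0 survives because each written index [K - j] is at least 1. *)
  destruct (sem_for w (fun j s' => smem s' 0 = smem s 0 /\
    vars s' vnc = pcode G (firstn (Z.to_nat (K - j)) es) /\
    forall i, K - j < i <= K -> smem s' i = src G (nth (Z.to_nat (i - 1)) es 0))
    vj vK body s) as (s' & -> & HP).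
  - rewrite EK. clear - HK0. lia.
  - split; [reflexivity|]. split; [|intros i Hi; exfalso; clear - Hi; lia].
    rewrite firstn_all2; [exact Ec|]. clear - Hl. lia.
  - intros j s' Hj (J1 & J2 & J3) Hfv _. rewrite EK in Hj.
    assert (G1 : vars s' vN = n) by (framed Hfv EN).
    assert (G2 : vars s' vK = K) by (framed Hfv EK).
    assert (Hlt : (Z.to_nat (K - (j + 1)) < length es)%nat) by (clear - Hj Hl; lia).
    set (e := nth (Z.to_nat (K - (j + 1))) es 0).
    assert (He : 0 <= e < m) by (apply Hin, nth_In, Hlt).
    assert (Hs : 0 <= src G e < n) by (apply src_bound; exact He).
    set (p := firstn (Z.to_nat (K - (j + 1))) es).
    assert (Ep : firstn (Z.to_nat (K - j)) es = p ++ [e]).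
    { replace (Z.to_nat (K - j)) with (S (Z.to_nat (K - (j + 1)))) by (clear - Hj; lia).
      unfold p, e. clear - Hlt. revert Hlt. generalize (Z.to_nat (K - (j + 1))). intros q.
      revert q; induction es as [|x es IH]; intros q Hq; cbn in Hq; [lia|].
      destruct q as [|q]; [reflexivity|]. cbn [firstn app nth]. f_equal. apply IH. lia. }
    rewrite Ep, pcode_snoc in J2.
    assert (Em : (pcode G p * n + src G e) mod n = src G e).
    { rewrite Z.add_comm, Z_mod_plus_full. apply Z.mod_small, Hs. }
    assert (Ed : (pcode G p * n + src G e) / n = pcode G p).
    { rewrite Z.add_comm, Z.div_add by (clear - Hs; lia). rewrite Z.div_small by exact Hs.
      reflexivity. }
    fold n in J2.
    assert (Bs : below X 1 (src G e)) by (apply (below_le X HX _ n); [hyp_below|clear - Hs; lia]).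
    assert (Bp : below X 1 (pcode G p)).
    { apply (below_le X HX _ (n ^ K)); [hyp_below|].
      assert (Hc : 0 <= pcode G p < n ^ Z.of_nat (length p)).
      { apply pcode_bound. intros x Hx. apply Hin. unfold p in Hx.
        rewrite <- (firstn_skipn (Z.to_nat (K - (j + 1))) es). apply in_or_app. now left. }
      assert (n ^ Z.of_nat (length p) <= n ^ K).
      { apply Z.pow_le_mono_r; [clear - Hs; lia|]. unfold p. rewrite length_firstn.
        clear - Hl. lia. }
      clear - Hc H0. lia. }
    assert (BKj : below X 1 (K - j)) by (apply (below_le X HX _ K); [hyp_below|clear - Hj; lia]).
    assert (Bj : below X 1 j) by (apply (below_le X HX _ K); [hyp_below|clear - Hj; lia]).
    set (Q := fun s' : store => smem s' 0 = smem s 0 /\ vars s' vnc = pcode G p /\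
      forall i, K - (j + 1) < i <= K -> smem s' i = src G (nth (Z.to_nat (i - 1)) es 0)).
    change (wp w body Q (setv s' vj j)).
    apply wp_seq, wp_store.
    { red_goal; rwv; words. }
    { red_goal; rwv. rewrite ?Em; words. }
    red_goal; rwv. rewrite Em.
    apply wp_assign; [red_goal; rwv; rewrite ?Ed; words|]. red_goal; rwv. rewrite Ed.
    unfold Q. cbn [smem vars setv]. split; [|split; [reflexivity|]].
    + unfold set_mem. destruct (Z.eqb_spec 0 (K - j)); [exfalso; clear - Hj e0; lia|exact J1].
    + intros i Hi. unfold set_mem. destruct (Z.eqb_spec i (K - j)) as [->|Hne].
      * unfold e. f_equal. f_equal. clear - Hj. lia.
      * apply J3. clear - Hi Hne. lia.
  - rewrite EK in HP |- *. destruct HP as (J1 & _ & J3). cbn [smem setv].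
    split; [exact J1|].
    apply nth_ext with (d := 0) (d' := src G 0).
    + rewrite !length_map, length_seq. unfold K in Hl. clear - Hl. lia.
    + intros i Hi. rewrite length_map, length_seq in Hi.
      rewrite (nth_indep _ 0 (smem s' (Z.of_nat 0))) by (rewrite length_map, length_seq; exact Hi).
      rewrite (map_nth (fun i => smem s' (Z.of_nat i))), (map_nth (src G)), seq_nth by exact Hi.
      rewrite J3 by (unfold K; clear - Hi; lia). f_equal. f_equal. clear. lia.
Qed.

(** Every cycle forces the best cell to be nonempty and at most its own offset weight. This gives
    minimality if the cell is nonempty and the absence of cycles if it is empty. *)
Lemma output_spec (s : store) :
  vars s vN = n -> vars s vK = K -> vars s vBase = base ->
  entry (cell' s aW 0) (cell' s aC 0) (good G K H)
    (fun y => exists es u, Z.of_nat (length es) = K /\ walk G u es u /\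
      NoDup (map (src G) es) /\ y = H + psum G es) ->
  output_correct G k (smem (sem w OUTPUT s)).
Proof.
  intros EN EK EBase [Hg Hc]. pose proof base_bound as Hbase.
  assert (Hcyc : forall c, is_kcycle G k c ->
    cell' s aW 0 <> 0 /\ cell' s aW 0 <= H + cycle_weight G c).
  { intros c Hcy. destruct (kcycle_closed_walk G k c ltac:(lia) Hcy) as (es & u & A1 & A2 & A3 & A4).
    apply Hc. exists es, u. rewrite A2, A4. auto. }
  change (wp w OUTPUT (fun s' => output_correct G k (smem s')) s).
  wp_set.
  wp_set.
  change (smem s (base + (6 * 0 + 4))) with (cell' s aW 0).
  change (smem s (base + (6 * 0 + 5))) with (cell' s aC 0).
  apply wp_if; [exact I| |]; red_goal; intros H0.
  - destruct (Hg H0) as (es & u & A1 & A2 & A3 & A4 & A5).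
    apply wp_seq, wp_store; [words..|]. red_goal.
    match goal with |- wp _ _ _ ?st => set (s1 := st) end.
    destruct (output_loop s1 es) as [O1 O2].
    + exact EN.
    + exact EK.
    + exact A5.
    + exact A1.
    + intros e He. eapply walk_edges; eauto.
    + unfold wp. left. split; [rewrite O1; reflexivity|].
      assert (Hes : es <> []) by (intros ->; cbn in A1; unfold K in A1; clear - A1 Hk; lia).
      destruct (closed_walk_kcycle G es u k Hes A2 ltac:(unfold K in A1; clear - A1; lia) A3)
        as [B1 B2].
      exists (map (fun e => fst (arc G e)) es). split; [split; [exact B1|]|].
      * intros c' Hc'. destruct (Hcyc c' Hc') as [_ Hle]. rewrite B2.
        rewrite A4 in Hle. clear - Hle. lia.
      * rewrite O2, map_map. reflexivity.
  - apply wp_store; [words..|]. red_goal. right. split; [reflexivity|].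
    intros (c & Hcy). destruct (Hcyc c Hcy). contradiction.
Qed.

Theorem prog_correct (s : store) :
  (forall x, vars s x = 0) -> smem s = mem0 ->
  output_correct G k (smem (sem w (PROG k) s)).
Proof.
  intros H0 Hs. unfold PROG. rewrite !sem_seq.
  destruct (main_correct _ (setup_spec s H0 Hs)) as (A & B & C & E).
  apply output_spec; assumption.
Qed.

(** The phases are bounded one by one, each with its own tracked variables: a limit such as [vLim]
    is computed by arithmetic in one phase and serves as a limit only in a later one. *)
Lemma prog_time_bound (s : store) :
  (forall x, vars s x = 0) -> smem s = mem0 ->
  (time w (PROG k) s <= prog_time k (num_edges G))%nat.
Proof.
  intros H0 Hs. unfold PROG, prog_time. cbn [time]. cbn zeta.
  set (rho := limit_bound k (num_edges G)).
  pose proof (setup_spec s H0 Hs) as E3.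
  destruct (load_spec s H0 Hs) as (E1 & _).
  assert (V3 : forall y, assigned (LOAD k) y = false -> assigned SETUP y = false ->
    assigned CONSTS y = false ->
    vars (sem w CONSTS (sem w SETUP (sem w (LOAD k) s))) y = 0).
  { intros y Y1 Y2 Y3. rewrite !sem_frame by assumption. apply H0. }
  assert (T1 : (time w (LOAD k) s <= time_bound rho (LOAD k))%nat).
  { apply (time_le_bound w rho (fun _ => false)); [cbn; tauto|discriminate]. }
  set (s1 := sem w (LOAD k) s) in *.
  assert (Nat2 : forall z : nat, Z.to_nat (Z.of_nat z) = z) by apply Nat2Z.id.
  assert (Q : forall c tr s0, (forall y, tr y = true -> vars s0 y = Z.of_nat (rho y)) ->
    tracked rho tr c -> (time w c s0 <= time_bound rho c)%nat).
  { intros c tr s0 Hv Htr. apply (time_le_bound w rho tr); [exact Htr|].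
    intros y Hy. rewrite (Hv y Hy), Nat2. apply le_n. }
  assert (T2 : (time w SETUP s1 <= time_bound rho SETUP)%nat).
  { apply (Q SETUP (fun y => existsb (Nat.eqb y) [1; 3; 4]%nat)).
    - intros y Hy. apply existsb_exists in Hy as (z & Hz & Ez). apply Nat.eqb_eq in Ez.
      subst z. destruct Hz as [<-|[<-|[<-|[]]]]; apply E1.
    - cbn. tauto. }
  set (s2 := sem w SETUP s1) in *.
  assert (T3 : (time w CONSTS s2 <= time_bound rho CONSTS)%nat).
  { apply (time_le_bound w rho (fun _ => false)); [cbn; tauto|discriminate]. }
  set (s3 := sem w CONSTS s2) in *.
  pose proof (r_loaded _ E3) as L3.
  assert (T4 : (time w EDGES s3 <= time_bound rho EDGES)%nat).
  { apply (Q EDGES (fun y => existsb (Nat.eqb y) [1]%nat)).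
    - intros y Hy. apply existsb_exists in Hy as (z & Hz & Ez). apply Nat.eqb_eq in Ez.
      subst z. destruct Hz as [<-|[]]; apply L3.
    - cbn. tauto. }
  assert (Hi := edges_spec s3 E3). assert (Hh := heavy_count _ Hi).
  destruct Hi as (_ & _ & _ & _ & _ & _ & _ & _ & I9 & _).
  assert (Fv : forall y, assigned EDGES y = false -> vars (sem w EDGES s3) y = vars s3 y)
    by (intros; now apply sem_frame).
  destruct (main_correct s3 E3) as (_ & EK5 & _).
  set (s4 := sem w EDGES s3) in *.
  destruct root_facts as ([D1 _] & _).
  assert (T5 : (time w MAIN s4 <= time_bound rho MAIN)%nat).
  { apply (time_le_bound w rho (fun y => existsb (Nat.eqb y) [1; 2; 3; 4; 11; 12; 13; 30]%nat)).
    - assert (R3 : (rho 3 <= rho 30)%nat).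
      { change (Nat.div2 (k + 1) <= k)%nat. pose proof sizes as Hsz. unfold Sz, Rz, K in Hsz. clear - Hsz. lia. }
      assert (R4 : (rho 4 <= rho 30)%nat) by apply Nat.le_sub_l.
      clear - R3 R4. clearbody rho. cbn. repeat split; auto; right.
      + exists vS. auto.
      + exists vR. auto.
    - intros y Hy. apply existsb_exists in Hy as (z & Hz & Ez). apply Nat.eqb_eq in Ez.
      subst z. destruct Hz as [<-|[<-|[<-|[<-|[<-|[<-|[<-|[<-|[]]]]]]]]].
      + rewrite Fv, (l_M _ L3) by reflexivity. unfold m, ne. rewrite Nat2. apply le_n.
      + rewrite Fv, (l_K _ L3) by reflexivity. unfold K. rewrite Nat2. apply le_n.
      + rewrite Fv, (l_S _ L3) by reflexivity. unfold Sz. rewrite Nat2. apply le_n.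
      + rewrite Fv, (l_R _ L3) by reflexivity. unfold Rz. rewrite Nat2. apply le_n.
      + rewrite Fv, (r_G _ E3) by reflexivity. apply le_n.
      + rewrite Fv, (r_Lim _ E3) by reflexivity. apply le_n.
      (* Here [heavy_count] enters: there are at most [m / D] sources. *)
      + change (rho vNh) with (Z.to_nat (m / D)).
        assert (Hm0 := below_nonneg X HX _ _ Hm). destruct I9 as [I9 _].
        assert (Hle : vars s4 vNh <= m / D).
        { apply Z.div_le_lower_bound; [clear - D1; lia|]. clear - Hh I9 D1. nia. }
        apply Z2Nat.inj_le; [exact I9|clear - I9 Hle; lia|exact Hle].
      + rewrite Fv, V3 by reflexivity. apply Nat.le_0_l. }
  set (s5 := sem w MAIN s4) in *.
  assert (T6 : (time w OUTPUT s5 <= time_bound rho OUTPUT)%nat).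
  { apply (Q OUTPUT (fun y => existsb (Nat.eqb y) [2]%nat)).
    - intros y Hy. apply existsb_exists in Hy as (z & Hz & Ez). apply Nat.eqb_eq in Ez.
      subst z. destruct Hz as [<-|[]]. exact EK5.
    - cbn. tauto. }
  clear - T1 T2 T3 T4 T5 T6. lia.
Qed.

End Init.

(** * Word size *)

Section WordSize.
Open Scope Z_scope.
Variable G : wdigraph.
Variable k : nat.
Hypothesis Hk : (3 <= k)%nat.

Let b := Z.of_nat (bits (order G)).
Let K := Z.of_nat k.
Let n := nv G.
Let m := ne G.
(** The factor 6 is dictated by the number of guesses, [2 ^ ((t + 1) * (K * K))] with
    [t + 1 <= b + 4 < 6 * b]; the powers of n and m fit as well. *)
Let X := 2 ^ (6 * b * (K * K)).
Let t := loglog (num_edges G).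

Lemma b_pos : 1 <= b.
Proof. unfold b, bits. lia. Qed.

Lemma nv_lt : 0 <= n < 2 ^ b.
Proof.
  unfold n, nv, b, bits. split; [lia|].
  destruct (Nat.eq_dec (order G) 0) as [->|Hn]; [cbn; lia|].
  destruct (Nat.log2_spec (order G)) as [_ H]; [lia|].
  apply Nat2Z.inj_lt in H. rewrite Nat2Z.inj_pow in H. exact H.
Qed.

Lemma ne_lt : 0 <= m < 2 ^ (2 * b).
Proof.
  pose proof nv_lt as Hn. pose proof (ne_le G) as H. fold n m in H.
  replace (2 * b) with (b + b) by lia. pose proof b_pos.
  rewrite Z.pow_add_r by lia. unfold m, ne in *. nia.
Qed.

Lemma exponent_large : 54 * b <= 6 * b * (K * K) /\ 6 * b * K <= 6 * b * (K * K) /\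
  K * K <= b * (K * K) /\ 9 <= K * K /\ 3 <= K.
Proof.
  pose proof b_pos as Hb. assert (HK : 3 <= K) by (unfold K; lia).
  assert (H1 : 9 <= K * K) by nia. assert (H2 : K <= K * K) by nia.
  clear - Hb HK H1 H2. generalize dependent (K * K). intros y H1 H2.
  clearbody b K. repeat split; nia.
Qed.

Lemma below_X (z e : Z) : 0 <= z -> z <= 2 ^ e -> e < 6 * b * (K * K) -> 16 <= X -> below X 1 z.
Proof.
  intros H0 H1 H2 HX. apply (below_one X HX). split; [exact H0|].
  eapply Z.le_lt_trans; [exact H1|]. destruct (Z_le_gt_dec 0 e).
  - apply Z.pow_lt_mono_r; lia.
  - rewrite Z.pow_neg_r by lia. lia.
Qed.

Lemma X_large : 16 <= X.
Proof.
  pose proof exponent_large as (H & _). pose proof b_pos.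
  change 16 with (2 ^ 4). apply Z.pow_le_mono_r; lia.
Qed.

(** From [2 ^ 2 ^ t <= m * m + 2] and [m < 2 ^ (2 * b)] follows [2 ^ t <= 4 * b + 1]; the crude
    estimate [b < 2 ^ b] does the rest. *)
Lemma loglog_bound : 0 <= t /\ t + 1 <= b + 4.
Proof.
  pose proof b_pos as Hb. pose proof ne_lt as Hm.
  destruct (loglog_spec (num_edges G)) as (H1 & H2 & _). fold t in H1, H2.
  split; [exact H1|].
  change (Z.of_nat (num_edges G)) with m in H2.
  assert (P := pow_pow_step m t (proj1 Hm) H1 H2).
  assert (Q : 2 ^ t <= 4 * b + 1).
  { apply (Z.pow_le_mono_r_iff 2); [lia..|].
    transitivity (m * m + 2); [exact P|].
    rewrite Z.pow_add_r by lia. replace (4 * b) with (2 * b + 2 * b) by lia.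
    rewrite Z.pow_add_r by lia. change (2 ^ 1) with 2.
    assert (2 <= 2 ^ (2 * b)) by (change 2 with (2 ^ 1) at 1; apply Z.pow_le_mono_r; lia).
    nia. }
  assert (R : b < 2 ^ b) by (apply Z.pow_gt_lin_r; lia).
  assert (2 ^ t <= 2 ^ (b + 3)).
  { rewrite Z.pow_add_r by lia. change (2 ^ 3) with 8. lia. }
  apply (Z.pow_le_mono_r_iff 2) in H; lia.
Qed.

(** In the threshold for [a], [72 = 12 * 6] makes [X ^ 12] fit into a word, and [k + c + 1] makes
    [H = 2 ^ (w - 1)] exceed k times the largest weight, using [k < 2 ^ k]. *)
Lemma program_correct (c a : nat) :
  (72 * (k * k) + k + c + 1 <= a)%nat ->
  weights_fit (c * bits (order G)) G ->
  let w := (a * bits (order G))%nat in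
  exists t : nat, (t <= prog_time k (num_edges G))%nat /\
    let s := run w (compile (PROG k)) t (initial_state w G) in
    halted (compile (PROG k)) s /\ output_correct G k (mem s).
Proof.
  intros Ha Hwt w.
  pose proof b_pos as Hb. pose proof nv_lt as Hn. pose proof ne_lt as Hm.
  pose proof exponent_large as (L1 & L2 & L3 & L4 & L5). pose proof X_large as HX.
  destruct loglog_bound as [T1 T2].
  assert (Ew : Z.of_nat w = Z.of_nat a * b) by (unfold w, b; lia).
  assert (HXw : fits X w).
  { apply fits_intro; [exact HX|]. unfold X. rewrite <- Z.pow_mul_r by lia.
    apply Z.pow_le_mono_r; [lia|]. rewrite Ew.
    assert (72 * (K * K) <= Z.of_nat a) by (unfold K; lia). nia. }
  assert (Hw1 : Z.of_nat c * b + K + 1 <= Z.of_nat w).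
  { rewrite Ew. assert (Z.of_nat c + K + 1 <= Z.of_nat a) by (unfold K; lia). nia. }
  set (s0 := MkStore (fun _ => 0) (mem0 w G)).
  set (Sz := Z.of_nat (Nat.div2 (k + 1))).
  assert (HSz : 0 <= Sz <= K).
  { unfold Sz, K. pose proof (Nat.div2_odd (k + 1)) as E.
    destruct (Nat.odd (k + 1)); cbn [Nat.b2n] in E; lia. }
  assert (B1 : below X 1 n) by (apply (below_X _ b); [lia..|exact HX]).
  assert (B2 : below X 1 m) by (apply (below_X _ (2 * b)); [lia..|exact HX]).
  assert (B3 : below X 1 K).
  { apply (below_X _ K); [lia| |nia|exact HX]. apply Z.lt_le_incl, Z.pow_gt_lin_r; lia. }
  assert (B4 : below X 1 ((m + 1) ^ Sz)).
  { apply (below_X _ (2 * b * Sz)); [apply Z.pow_nonneg; lia| | |exact HX].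
    2: { clear - L2 HSz Hb L5. clearbody b K. nia. }
    rewrite Z.pow_mul_r by lia. apply Z.pow_le_mono_l. lia. }
  assert (B5 : below X 1 (m * m + 2)).
  { apply (below_X _ (2 * b + 2 * b + 1)); [clear - Hm; nia| |lia|exact HX].
    rewrite !Z.pow_add_r by lia. change (2 ^ 1) with 2.
    assert (H2 : 2 <= 2 ^ (2 * b)) by (change 2 with (2 ^ 1) at 1; apply Z.pow_le_mono_r; lia).
    clear - Hm H2. nia. }
  assert (B6 : below X 1 (2 ^ (t + 1))).
  { apply (below_X _ (t + 1)); [apply Z.pow_nonneg; lia|lia|lia|exact HX]. }
  assert (B7 : below X 1 (2 ^ ((t + 1) * (K * K)))).
  { apply (below_X _ ((t + 1) * (K * K))); [apply Z.pow_nonneg; lia|lia| |exact HX].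
    clear - T2 Hb L4. generalize dependent (K * K). intros y Hy. clearbody b t. nia. }
  assert (B8 : below X 1 (n ^ K)).
  { apply (below_X _ (b * K)); [apply Z.pow_nonneg; lia| |nia|exact HX].
    rewrite Z.pow_mul_r by lia. apply Z.pow_le_mono_l. lia. }
  assert (Hw0 : (0 < w)%nat) by lia.
  assert (HWb : forall e, 0 <= e < m -> Z.abs (wt G e) <= 2 ^ (Z.of_nat c * b)).
  { intros e He. specialize (Hwt (arc G e) (arc_in G e He)).
    rewrite Nat2Z.inj_mul in Hwt. fold b in Hwt. unfold wt. lia. }
  assert (HKW : K * 2 ^ (Z.of_nat c * b) < 2 ^ (Z.of_nat w - 1)).
  { apply Z.lt_le_trans with (2 ^ K * 2 ^ (Z.of_nat c * b)).
    - apply Z.mul_lt_mono_pos_r; [apply Z.pow_pos_nonneg; lia|]. apply Z.pow_gt_lin_r; lia.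
    - rewrite <- Z.pow_add_r by nia. apply Z.pow_le_mono_r; lia. }
  exists (time w (PROG k) s0). split.
  - apply (prog_time_bound w G k X (2 ^ (Z.of_nat w - 1)) (2 ^ (Z.of_nat c * b)));
      first [assumption|reflexivity|auto].
  - cbn zeta.
    assert (Hwf : wf_store w s0).
    { split; intros; [|apply to_word_word]. unfold word. cbn.
      split; [lia|]. apply Z.pow_pos_nonneg; lia. }
    destruct (compile_correct w (PROG k) s0 (initial_state w G) (PROG_wf k) Hwf) as [A B].
    + split; intros; reflexivity.
    + reflexivity.
    + split; [exact A|].
      assert (O : output_correct G k (smem (sem w (PROG k) s0))).
      { apply (prog_correct w G k X (2 ^ (Z.of_nat w - 1)) (2 ^ (Z.of_nat c * b)));
          first [assumption|reflexivity|auto]. }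
      unfold output_correct in *. rewrite B.
      destruct O as [(O1 & c0 & O2 & O3)|O]; [left|right; exact O].
      split; [exact O1|]. exists c0. split; [exact O2|]. rewrite <- O3.
      apply map_ext. intros i. apply B.
Qed.

End WordSize.

(** * Running time *)

Section RunningTime.
Variable k : nat.

Let rho0 := limit_bound k 0.

(** Loops inside the named subprograms are limited in terms of k alone, so their bounds coincide by
    computation with those for m = 0 and become the constants [a1] to [a10]. What remains is the
    nesting of the loops over guesses, paths, sources and edges; 1000 is a generous factor. *)
Lemma prog_time_poly :
  exists C, forall m : nat,
  prog_time k m <= C * (1 + m + limit_bound k m vG *
    (1 + limit_bound k m vLim + limit_bound k m vNh * (1 + m))).
Proof.
  set (a1 := time_bound rho0 LIGHT1_BODY). set (a2 := time_bound rho0 LIGHT2_BODY).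
  set (a3 := time_bound rho0 DP_BODY). set (a4 := time_bound rho0 EDGE_BODY).
  set (a5 := time_bound rho0 RELAX). set (a6 := time_bound rho0 (LOAD k)).
  set (a7 := time_bound rho0 POWERS). set (a8 := time_bound rho0 CONSTS).
  set (a9 := time_bound rho0 OUTPUT).
  set (a10 := time_bound rho0 (For vj vS (vP ::= V vP * V vD))).
  exists (1000 * (1 + k) * (1 + a1 + a2 + a3 + a4 + a5 + a6 + a7 + a8 + a9 + a10)).
  intros m. unfold prog_time. cbn zeta.
  set (rho := limit_bound k m).
  change (time_bound rho (LOAD k)) with a6. change (time_bound rho CONSTS) with a8.
  change (time_bound rho OUTPUT) with a9.
  unfold SETUP, DEGREE, LOGLOG, EDGES, MAIN, LIGHT, HEAVY, HEAVY_BODY, put.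
  cbn [time_bound].
  change (time_bound rho POWERS) with a7.
  change (time_bound rho EDGE_BODY) with a4.
  change (time_bound rho LIGHT1_BODY) with a1. change (time_bound rho LIGHT2_BODY) with a2.
  change (time_bound rho DP_BODY) with a3. change (time_bound rho RELAX) with a5.
  change (3 + rho 3 * (ecost (V 44 * V 6) + 1 + 5)) with a10.
  change (rho vM) with m. change (rho vK) with k.
  unfold get, addr. cbn [ecost].
  generalize (rho vG) (rho vLim) (rho vNh).
  clearbody a1 a2 a3 a4 a5 a6 a7 a8 a9 a10. clear rho rho0.
  intros g l h.
  set (A := 1 + a1 + a2 + a3 + a4 + a5 + a6 + a7 + a8 + a9 + a10).
  set (P := 1000 * (1 + k) * A).
  assert (HP : 1000 * A <= P) by (unfold P; nia).
  assert (HA : 1 <= A) by (unfold A; lia).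
  assert (Hdp : k * (3 + m * (a3 + 5) + 5) <= 8 * (k * A) * (1 + m)).
  { assert (3 + m * (a3 + 5) + 5 <= 8 * A * (1 + m)) by (unfold A; nia). nia. }
  assert (Hp : 100 * A + 8 * (k * A) <= P) by (unfold P; nia).
  match goal with |- context [h * ?c] => assert (Hh : c <= P * (1 + m)) end.
  { assert (100 * A * (1 + m) + 8 * (k * A) * (1 + m) <= P * (1 + m)) by nia.
    assert (100 * A <= 100 * A * (1 + m)) by nia.
    assert (a5 + 90 <= 100 * A) by (unfold A; lia). lia. }
  match type of Hh with ?c <= _ => set (hc := c) in *; clearbody hc end.
  match goal with |- context [g * ?c] => assert (Hg : c <= P * (1 + l + h * (1 + m))) end.
  { assert (h * hc <= P * (h * (1 + m))) by nia.
    assert (l * (a1 + 5) + l * (a2 + 5) <= P * l).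
    { assert (a1 + 5 + (a2 + 5) <= P) by (unfold A in HP; lia). nia. }
    assert (50 <= P) by lia. lia. }
  match type of Hg with ?c <= _ => set (gc := c) in *; clearbody gc end.
  assert (g * gc <= P * (g * (1 + l + h * (1 + m)))) by nia.
  assert (a6 + a7 + a8 + a9 + 30 <= P) by (unfold A in HP; lia).
  assert (Hm : a10 + a4 + 50 <= P) by (unfold A in HP; lia).
  assert (m * (a10 + a4 + 50) <= P * m) by nia.
  lia.
Qed.

Open Scope R_scope.

Let s := Nat.div2 (k + 1).
Hypothesis Hk : (3 <= k)%nat.

Lemma half_large : (2 <= s)%nat.
Proof.
  unfold s. pose proof (Nat.div2_odd (k + 1)) as E.
  destruct (Nat.odd (k + 1)); cbn [Nat.b2n] in E; lia.
Qed.

Lemma ln_le_ln (x y : R) : 0 < x -> x <= y -> ln x <= ln y.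
Proof. intros Hx [H| ->]; [left; now apply ln_increasing|right; reflexivity]. Qed.

Lemma ln_ge_1 (m : nat) : (3 <= m)%nat -> 1 <= ln (INR m).
Proof.
  intros Hm. rewrite <- (ln_exp 1). apply ln_le_ln; [apply exp_pos|].
  pose proof exp_le_3. apply le_INR in Hm. simpl INR in Hm. lra.
Qed.

Lemma INR_to_nat (z : Z) : (0 <= z)%Z -> INR (Z.to_nat z) = IZR z.
Proof. intros Hz. rewrite INR_IZR_INZ. now rewrite Z2Nat.id. Qed.

(** By minimality of [t], [2 ^ (t - 1)] is at most the binary logarithm of m, so a digit takes
    [4 * 2 ^ (t - 1) <= 8 * ln m] values, as [ln 2 > 1/2]. A guess has [k * k] digits. *)
Lemma guesses_bound (m : nat) : (3 <= m)%nat ->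
  INR (limit_bound k m vG) <= (8 * ln (INR m)) ^ (k * k).
Proof.
  intros Hm. pose proof (ln_ge_1 m Hm) as Hln.
  destruct (loglog_spec m) as (H1 & H2 & _). unfold limit_bound.
  set (t := loglog m) in *.
  rewrite INR_to_nat by (apply Z.pow_nonneg; lia).
  rewrite <- Nat2Z.inj_mul, Z.pow_mul_r by lia. rewrite <- pow_IZR.
  apply pow_incr. split; [apply IZR_le, Z.pow_nonneg; lia|].
  (* For [t = 0] minimality says nothing, but a digit takes 2 values and [ln m >= 1]. *)
  destruct (Z.eq_dec t 0) as [->|Ht]; [simpl; lra|].
  destruct H2 as [H2|H2]; [contradiction|].
  replace (t + 1)%Z with (2 + (t - 1))%Z by ring. rewrite Z.pow_add_r by lia.
  change (2 ^ 2)%Z with 4%Z.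
  assert (Hp : (0 <= 2 ^ (t - 1))%Z) by (apply Z.pow_nonneg; lia).
  set (p := (2 ^ (t - 1))%Z) in *. rewrite mult_IZR.
  apply IZR_le in H2. rewrite <- INR_IZR_INZ in H2.
  rewrite <- (Z2Nat.id p Hp), <- pow_IZR in H2.
  assert (Hl : ln (2 ^ Z.to_nat p) <= ln (INR m)) by (apply ln_le_ln; [apply pow_lt; lra|exact H2]).
  rewrite ln_pow, INR_to_nat in Hl by (lra || assumption).
  pose proof ln_lt_2. apply IZR_le in Hp. nra.
Qed.

(** [y] is the real root m^(1/s). The last equation expresses the target as m^2/y, so the later
    estimates avoid real exponents. *)
Lemma exponent_split (m : nat) : (3 <= m)%nat ->
  exists y, 1 <= y /\ y ^ s = INR m /\
    Rpower (INR m) (2 - 1 / INR s) * y = INR m * INR m.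
Proof.
  intros Hm. pose proof half_large as Hs. apply le_INR in Hm, Hs. simpl INR in Hm, Hs.
  exists (Rpower (INR m) (/ INR s)).
  assert (0 < / INR s) by (apply Rinv_0_lt_compat; lra).
  split; [|split].
  - rewrite <- (Rpower_O (INR m)) by lra. apply Rle_Rpower; lra.
  - rewrite <- Rpower_pow by apply exp_pos. rewrite Rpower_mult.
    replace (/ INR s * INR s) with 1 by (field; lra). apply Rpower_1; lra.
  - rewrite <- Rpower_plus. replace (2 - 1 / INR s + / INR s) with (INR 2) by (simpl; field; lra).
    rewrite Rpower_pow by lra. ring.
Qed.

(** Rounding the root up costs at most a factor 2: [d - 1 <= y] by minimality, and [y >= 1]. *)
Lemma root_bounds (m : nat) (y : R) : 1 <= y -> y ^ s = INR m ->
  let d := IZR (root (Z.of_nat s) m) in y <= d <= 2 * y.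
Proof.
  intros Hy Hm. cbn zeta. pose proof half_large as Hs.
  destruct (root_spec (Z.of_nat s) m) as ([D1 _] & D2 & D3); [lia|].
  set (D := root (Z.of_nat s) m) in *. split.
  - apply IZR_le in D3. rewrite <- INR_IZR_INZ, <- pow_IZR, <- Hm in D3.
    apply IZR_le in D1. destruct (Rle_lt_dec y (IZR D)) as [|Hlt]; [assumption|exfalso].
    assert (IZR D ^ s < y ^ s); [|lra].
    destruct s as [|s']; [lia|]. cbn [pow].
    assert (IZR D ^ s' <= y ^ s') by (apply pow_incr; lra).
    assert (0 < IZR D ^ s') by (apply pow_lt; lra). nra.
  - destruct D2 as [D2|D2]; [rewrite D2; lra|].
    apply IZR_lt in D2. rewrite <- INR_IZR_INZ, <- pow_IZR, <- Hm, minus_IZR in D2.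
    destruct (Rle_lt_dec (IZR D - 1) y) as [|Hlt]; [lra|exfalso].
    assert (y ^ s <= (IZR D - 1) ^ s) by (apply pow_incr; lra). lra.
Qed.

Lemma prog_time_soft_O :
  soft_O (prog_time k) (fun m => Rpower (INR m) (2 - 1 / INR s)).
Proof.
  destruct prog_time_poly as [C HC].
  (* The 2 pays for [1 + m]; [3 + 2 ^ s] is 1 plus [2 ^ s] for the paths plus 2 for the sources;
     [8 ^ (k * k)] and the degree [k * k] come from [guesses_bound]. From m = 3 on, [ln m >= 1]. *)
  exists (INR C * (2 + 8 ^ (k * k) * (3 + 2 ^ s))), (k * k)%nat, 3%nat.
  intros m Hm. pose proof half_large as Hs.
  destruct (exponent_split m Hm) as (y & Y1 & Y2 & Y3).
  set (f := Rpower (INR m) (2 - 1 / INR s)) in *.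
  set (M := INR m) in *.
  destruct (root_bounds m y Y1 Y2) as [D1 D2].
  assert (HM : 3 <= M) by (apply le_INR in Hm; simpl INR in Hm; unfold M; lra).
  assert (Hf : M <= f).
  { assert (y <= M).
    { rewrite <- Y2. clear - Hs Y1. destruct s as [|s']; [lia|]. cbn [pow].
      assert (1 <= y ^ s') by (apply pow_R1_Rle; lra). nra. }
    nra. }
  set (d := IZR (root (Z.of_nat s) m)) in *.
  destruct (root_spec (Z.of_nat s) m) as ([R1 _] & _); [lia|].
  assert (HL : INR (limit_bound k m vLim) <= 2 ^ s * f).
  { unfold limit_bound. fold s. rewrite INR_to_nat.
    2: { apply Z.mul_nonneg_nonneg; [lia|]. apply Z.pow_nonneg. lia. }
    rewrite mult_IZR, <- INR_IZR_INZ. fold M.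
    replace (Z.of_nat s - 1)%Z with (Z.of_nat (s - 1)) by lia. rewrite <- pow_IZR. fold d.
    assert (d ^ (s - 1) <= (2 * y) ^ (s - 1)) by (apply pow_incr; lra).
    rewrite Rpow_mult_distr in H.
    (* Since [y ^ s = m], this is m^2/y: the number of paths meets the target up to a power of 2. *)
    assert (E : M * y ^ (s - 1) = f).
    { apply (Rmult_eq_reg_r y); [|lra]. rewrite Y3. rewrite Rmult_assoc. f_equal.
      rewrite <- Y2. replace s with (S (s - 1)) at 2 by lia. cbn [pow]. ring. }
    assert (2 ^ s = 2 * 2 ^ (s - 1)) by (replace s with (S (s - 1)) at 1 by lia; reflexivity).
    assert (0 < 2 ^ (s - 1)) by (apply pow_lt; lra).
    apply Rle_trans with (M * (2 ^ (s - 1) * y ^ (s - 1))).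
    - apply Rmult_le_compat_l; lra.
    - replace (M * (2 ^ (s - 1) * y ^ (s - 1))) with (2 ^ (s - 1) * f) by (rewrite <- E; ring).
      rewrite H0. nra. }
  assert (HN : INR (limit_bound k m vNh) * (1 + M) <= 2 * f).
  { unfold limit_bound. fold s.
    rewrite INR_to_nat by (apply Z.div_pos; lia).
    assert (Q := Z.mul_div_le (Z.of_nat m) (root (Z.of_nat s) m) ltac:(lia)).
    apply IZR_le in Q. rewrite mult_IZR, <- INR_IZR_INZ in Q. fold M d in Q.
    assert (Q0 : (0 <= Z.of_nat m / root (Z.of_nat s) m)%Z) by (apply Z.div_pos; lia).
    apply IZR_le in Q0.
    set (N := IZR (Z.of_nat m / root (Z.of_nat s) m)) in *.
    (* At most m/y sources, each of cost [1 + m <= 2 * m]: again m^2/y up to the factor 2. *)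
    assert (y * N <= M) by nra.
    apply (Rmult_le_reg_r y); [lra|].
    replace (2 * f * y) with (2 * (M * M)) by (rewrite <- Y3; ring).
    assert (0 <= N * y) by nra. nra. }
  assert (HG := guesses_bound m Hm). fold M in HG.
  assert (Hln := ln_ge_1 m Hm). fold M in Hln.
  rewrite Rpow_mult_distr in HG.
  assert (Hl1 : 1 <= ln M ^ (k * k)) by (apply pow_R1_Rle; exact Hln).
  set (l := ln M ^ (k * k)) in *.
  specialize (HC m). apply le_INR in HC.
  rewrite mult_INR, !plus_INR, mult_INR, !plus_INR, mult_INR, plus_INR in HC.
  change (INR 1) with 1 in HC. fold M in HC.
  set (g := INR (limit_bound k m vG)) in *. set (L := INR (limit_bound k m vLim)) in *.
  set (N := INR (limit_bound k m vNh)) in *.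
  assert (H8 : 0 < 8 ^ (k * k)) by (apply pow_lt; lra).
  assert (H2s : 0 < 2 ^ s) by (apply pow_lt; lra).
  assert (Hg0 : 0 <= g) by apply pos_INR.
  assert (Hin : 1 + L + N * (1 + M) <= (3 + 2 ^ s) * f) by nra.
  assert (Hgl : g * (1 + L + N * (1 + M)) <= 8 ^ (k * k) * l * ((3 + 2 ^ s) * f)).
  { apply Rmult_le_compat; [exact Hg0| |exact HG|exact Hin].
    assert (0 <= L) by apply pos_INR. assert (0 <= N) by apply pos_INR. nra. }
  apply Rle_trans with (1 := HC).
  rewrite !Rmult_assoc. apply Rmult_le_compat_l; [apply pos_INR|].
  assert (2 * f <= 2 * f * l) by nra.
  replace ((2 + 8 ^ (k * k) * (3 + 2 ^ s)) * (f * l)) with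
    (2 * f * l + 8 ^ (k * k) * l * ((3 + 2 ^ s) * f)) by ring.
  lra.
Qed.

Lemma min_kcycle_solvable :
  min_kcycle_solvable_in k (fun m => Rpower (INR m) (2 - 1 / INR s)).
Proof.
  exists (compile (PROG k)). intros c. exists (72 * (k * k) + k + c + 1)%nat.
  intros a Ha. exists (prog_time k). split; [exact prog_time_soft_O|].
  intros G Hw. exact (program_correct G k Hk c a Ha Hw).
Qed.

End RunningTime.

Lemma solvable_ext (k : nat) (f f' : nat -> R) :
  (forall m, f m = f' m) -> min_kcycle_solvable_in k f -> min_kcycle_solvable_in k f'.
Proof.
  intros E [P HP]. exists P. intros c. destruct (HP c) as [a0 H0]. exists a0.
  intros a Ha. destruct (H0 a Ha) as (T & (C & d & m0 & HT) & H1). exists T.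
  split; [|exact H1]. exists C, d, m0. intros m Hm. rewrite <- E. now apply HT.
Qed.

Theorem theorem1p5 (k : nat) (hk : 3 <= k) :
  (Nat.Odd k ->
    min_kcycle_solvable_in k
      (fun m => Rpower (INR m) (2 - 2 / (INR k + 1)))) /\
  (Nat.Even k ->
    min_kcycle_solvable_in k
      (fun m => Rpower (INR m) (2 - 2 / INR k))).
Proof.
  split; intros [j ->].
  (* For [k = 2 * j + 1] the longer half has [j + 1] edges, and 1/(j+1) = 2/(k+1). *)
  - apply (solvable_ext _ (fun m => Rpower (INR m) (2 - 1 / INR (S j)))).
    + intros m. f_equal. rewrite plus_INR, mult_INR, S_INR. simpl (INR 2). simpl (INR 1).
      pose proof (pos_INR j). field. lra.
    + pose proof (min_kcycle_solvable _ hk) as H.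
      replace (2 * j + 1 + 1) with (2 * S j) in H by lia.
      rewrite Nat.div2_double in H. exact H.
  (* For [k = 2 * j] both halves have [j] edges, since [Nat.div2] rounds down, and 1/j = 2/k. *)
  - apply (solvable_ext _ (fun m => Rpower (INR m) (2 - 1 / INR j))).
    + intros m. f_equal. rewrite mult_INR. simpl (INR 2).
      assert (0 < INR j)%R by (apply lt_0_INR; lia). field. lra.
    + pose proof (min_kcycle_solvable _ hk) as H.
      rewrite Nat.add_1_r, Nat.div2_succ_double in H. exact H.
Qed.
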